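(* Let $n\ge 1$ be an integer, let $K$ be a field of characteristic zero, and let $f\in R=K[[x_1,\dots,x_n]]$ define an isolated hypersurface singularity at the origin. Then $$\frac{\mu(f)}{\tau(f)}\le \frac{1}{\mathcal{H}_{\frac{n+1}{2}}(n)-\mathcal{H}_{\frac{n-1}{2}}(n)}.$$
   Context: Let $R=K[[x_1,\dots,x_n]]$ with maximal ideal $\mathfrak m=(x_1,\dots,x_n)$. A hypersurface singularity at the origin is a power series $f\in\mathfrak m^2$. Put $j(f)=\left(\frac{\partial f}{\partial x_1},\dots,\frac{\partial f}{\partial x_n}\right)$, $tj(f)=(f)+j(f)$, $\mu(f)=\dim_K R/j(f)$ and $\tau(f)=\dim_K R/tj(f)$. The singularity $f$ is isolated if $\tau(f)<\infty$ (in characteristic zero this is equivalent to $\mu(f)<\infty$). For real $0\le s\le n$, $\mathcal{H}_s(n)=\sum_{i=0}^{\lfloor s\rfloor}\frac{(-1)^i}{n!}\binom{n}{i}(s-i)^n$; this is the Lebesgue measure of $\{(x_1,\dots,x_n)\in[0,1]^n\mid x_1+\dots+x_n\le s\}$. *)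

(* Defs.v *)
From HB Require Import structures.
(* mpoly has to be imported before the mathcomp-analysis files: in the other
   order their notations clash. *)
From mathcomp Require Import all_boot all_order all_algebra.
From mathcomp Require Import mpoly.
From mathcomp Require Import boolp classical_sets reals constructive_ereal.

Set Implicit Arguments.
Unset Strict Implicit.
Unset Printing Implicit Defensive.

Import Order.TTheory GRing.Theory Num.Theory.

Local Open Scope classical_set_scope.
Local Open Scope ring_scope.

(* The ring A[[x_1, ..., x_n]]: a power series is its family of coefficients,
   indexed by the monomials 'X_{1..n}.  It is wrapped in a record so that it does
   not inherit the pointwise product of function types. *)
Record mpseries (n : nat) (A : comNzRingType) :=
  MPSeries { pscoeff : 'X_{1..n} -> A }.

Notation "{ 'mpseries' A [ n ] }" := (mpseries n A)
  (at level 0, A, n at level 2, format "{ 'mpseries'  A [ n ] }") : type_scope.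

Section PowerSeriesRing.
Context (n : nat) (A : comNzRingType).
Implicit Types f g h : {mpseries A[n]}.

Lemma mpseriesP f g : pscoeff f =1 pscoeff g -> f = g.
Proof. by case: f g => [f] [g] /= fg; congr MPSeries; apply/funext. Qed.

HB.instance Definition _ := gen_eqMixin {mpseries A[n]}.
HB.instance Definition _ := gen_choiceMixin {mpseries A[n]}.

Definition mps_zero : {mpseries A[n]} := MPSeries (fun=> 0).
Definition mps_opp f := MPSeries (fun m => - pscoeff f m).
Definition mps_add f g := MPSeries (fun m => pscoeff f m + pscoeff g m).

Fact mps_addA : associative mps_add.
Proof. by move=> f g h; apply: mpseriesP => m /=; rewrite addrA. Qed.
Fact mps_addC : commutative mps_add.
Proof. by move=> f g; apply: mpseriesP => m /=; rewrite addrC. Qed.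
Fact mps_add0 : left_id mps_zero mps_add.
Proof. by move=> f; apply: mpseriesP => m /=; rewrite add0r. Qed.
Fact mps_addN : left_inverse mps_zero mps_opp mps_add.
Proof. by move=> f; apply: mpseriesP => m /=; rewrite addNr. Qed.

HB.instance Definition _ := GRing.isZmodule.Build {mpseries A[n]}
  mps_addA mps_addC mps_add0 mps_addN.

Definition mps_one : {mpseries A[n]} := MPSeries (fun m => (m == 0%MM)%:R).

Definition mps_mul f g : {mpseries A[n]} := MPSeries (fun m =>
  \sum_(k : 'X_{1..n < (mdeg m).+1} | (k <= m)%MM)
    pscoeff f k * pscoeff g (m - k)%MM).

Definition mps_trunc d f : {mpoly A[n]} :=
  \sum_(m : 'X_{1..n < d}) pscoeff f m *: 'X_[m].

Lemma mcoeff_trunc d f m : (mdeg m < d)%N -> (mps_trunc d f)@_m = pscoeff f m.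
Proof. by move=> md; rewrite mcoeff_mpoly. Qed.

Lemma pscoeffM_trunc d f g m : (mdeg m < d)%N ->
  pscoeff (mps_mul f g) m = (mps_trunc d f * mps_trunc d g)@_m.
Proof.
move=> md; rewrite [RHS](mcoeff_poly_mul_lin _ _ (ltnSn (mdeg m))).
apply: eq_bigr => k _.
rewrite !mcoeff_trunc // ?(leq_ltn_trans (mdegB _ _)) //.
exact: leq_trans (bmdeg k) md.
Qed.

Fact mps_mulC : commutative mps_mul.
Proof.
move=> f g; apply: mpseriesP => m.
by rewrite !(@pscoeffM_trunc (mdeg m).+1) // mulrC.
Qed.

Fact mps_mulA : associative mps_mul.
Proof.
move=> f g h; apply: mpseriesP => m; set d := (mdeg m).+1.
have kd (k : 'X_{1..n < d}) : (mdeg (m - k)%MM < d)%N.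
  by rewrite ltnS (leq_trans (mdegB _ _)).
have -> : pscoeff (mps_mul f (mps_mul g h)) m
    = (mps_trunc d f * (mps_trunc d g * mps_trunc d h))@_m.
  rewrite [RHS](mcoeff_poly_mul_lin _ _ (ltnSn (mdeg m))); apply: eq_bigr => k _.
  by rewrite mcoeff_trunc ?bmdeg // -pscoeffM_trunc ?kd.
rewrite mulrA [RHS](_ : _ = (mps_trunc d f * mps_trunc d g * mps_trunc d h)@_m) //.
rewrite [RHS](mcoeff_poly_mul_lin _ _ (ltnSn (mdeg m))); apply: eq_bigr => k _.
by rewrite mcoeff_trunc ?kd // -pscoeffM_trunc ?bmdeg.
Qed.

Fact mps_mul1 : left_id mps_one mps_mul.
Proof.
move=> f; apply: mpseriesP => m; set d := (mdeg m).+1.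
rewrite (@pscoeffM_trunc d) // (_ : mps_trunc d mps_one = 1).
  by rewrite mul1r mcoeff_trunc.
apply/mpolyP => k; rewrite mcoeff1; case: (ltnP (mdeg k) d) => kd.
  by rewrite mcoeff_trunc.
rewrite [in RHS](_ : (k == 0%MM) = false); last first.
  by apply/negbTE; rewrite -mdeg_eq0 -lt0n (leq_trans _ kd).
rewrite /mps_trunc raddf_sum big1 //= => i _; rewrite mcoeffZ mcoeffX.
case: (bmnm i =P k) => [ik|]; last by rewrite mulr0.
by move: kd; rewrite -ik leqNgt bmdeg.
Qed.

Fact mps_mulDl : left_distributive mps_mul mps_add.
Proof.
move=> f g h; apply: mpseriesP => m /=; rewrite -big_split /=.
by apply: eq_bigr => k _; rewrite mulrDl.
Qed.

Fact mps_one_neq0 : mps_one != 0.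
Proof.
apply/eqP => /(congr1 (fun f => pscoeff f 0%MM)) /= /eqP.
by rewrite eqxx oner_eq0.
Qed.

HB.instance Definition _ := GRing.Zmodule_isComNzRing.Build {mpseries A[n]}
  mps_mulA mps_mulC mps_mul1 mps_mulDl mps_one_neq0.

Definition mps_scale (a : A) f := MPSeries (fun m => a * pscoeff f m).

Fact mps_scaleA a b f : mps_scale a (mps_scale b f) = mps_scale (a * b) f.
Proof. by apply: mpseriesP => m /=; rewrite mulrA. Qed.
Fact mps_scale1 : left_id 1 mps_scale.
Proof. by move=> f; apply: mpseriesP => m /=; rewrite mul1r. Qed.
Fact mps_scaleDr : right_distributive mps_scale +%R.
Proof. by move=> a f g; apply: mpseriesP => m /=; rewrite mulrDr. Qed.
Fact mps_scaleDl f : {morph mps_scale^~ f : a b / a + b}.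
Proof. by move=> a b; apply: mpseriesP => m /=; rewrite mulrDl. Qed.

HB.instance Definition _ := GRing.Zmodule_isLmodule.Build A {mpseries A[n]}
  mps_scaleA mps_scale1 mps_scaleDr mps_scaleDl.

Fact mps_scaleAl (a : A) f g : a *: (f * g) = a *: f * g.
Proof.
apply: mpseriesP => m /=; rewrite big_distrr /=.
by apply: eq_bigr => k _; rewrite mulrA.
Qed.

HB.instance Definition _ :=
  GRing.Lmodule_isLalgebra.Build A {mpseries A[n]} mps_scaleAl.
HB.instance Definition _ :=
  GRing.Lalgebra_isComAlgebra.Build A {mpseries A[n]}.

Definition mps_var (i : 'I_n) : {mpseries A[n]} :=
  MPSeries (fun m => (m == U_(i)%MM)%:R).

Definition mps_deriv (i : 'I_n) f : {mpseries A[n]} :=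
  MPSeries (fun m => pscoeff f (m + U_(i))%MM *+ (m i).+1).

End PowerSeriesRing.

Section Ideals.
Context (A : comNzRingType).

Definition ideal_gen (I : finType) (g : I -> A) : set A :=
  [set x | exists a : I -> A, x = \sum_i a i * g i].

Definition ideal_add (I J : set A) : set A := [set x + y | x in I & y in J].

Definition ideal_mul (I J : set A) : set A :=
  [set x | exists (k : nat) (a b : 'I_k -> A),
    [/\ forall i, I (a i), forall i, J (b i) & x = \sum_i a i * b i]].

End Ideals.

Section QuotientDimension.
Context (K : fieldType) (V : lmodType K).

(* The classes of e_1, ..., e_d form a K-basis of V / W. *)
Definition quot_basis (W : set V) (d : nat) (e : 'I_d -> V) : Prop :=
  (forall v, exists c : 'I_d -> K, W (v - \sum_i c i *: e i)) /\
  (forall c : 'I_d -> K, W (\sum_i c i *: e i) -> forall i, c i = 0).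

(* dim_K (V / W), for W a subspace of V, as an extended real: the size of a
   finite basis if there is one, +oo otherwise. *)
Definition quot_dim (R : realType) (W : set V) : \bar R :=
  xget +oo%E [set d%:R%:E | d in
    [set d | exists e : 'I_d -> V, quot_basis W e]].

End QuotientDimension.

Section Singularities.
Context (n : nat) (K : fieldType).
Implicit Type f : {mpseries K[n]}.

Definition max_ideal : set {mpseries K[n]} := ideal_gen (@mps_var n K).

Definition jacobian_ideal f : set {mpseries K[n]} :=
  ideal_gen (fun i : 'I_n => mps_deriv i f).

Definition tjurina_ideal f : set {mpseries K[n]} :=
  ideal_add (ideal_gen (fun _ : unit => f)) (jacobian_ideal f).

Definition milnor_number (R : realType) f : \bar R :=
  quot_dim R (jacobian_ideal f).

Definition tjurina_number (R : realType) f : \bar R :=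
  quot_dim R (tjurina_ideal f).

Definition hypersurface_singularity f : Prop :=
  ideal_mul max_ideal max_ideal f.

Definition isolated_singularity (R : realType) f : Prop :=
  hypersurface_singularity f /\ (tjurina_number R f < +oo)%E.

End Singularities.

(* For 0 <= s <= n, the volume of {x in [0, 1]^n | x_1 + ... + x_n <= s}, by
   inclusion-exclusion; Num.truncn s is the integer part of s >= 0. *)
Definition cube_corner_volume (R : realType) (n : nat) (s : R) : R :=
  \sum_(0 <= i < (Num.truncn s).+1)
    (-1) ^+ i / (n`!)%:R * ('C(n, i))%:R * (s - i%:R) ^+ n.

(* Main.v *)
(* Let [J] be the Jacobian ideal of [f] and [I = (f) + J]; [mu] and [tau] are the
   dimensions of the quotients by [J] and [I].  Replacing [f] by a polynomial [F]
   close to it, one may assume that the partial derivatives [y_j] of [F] have leading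
   forms [x_j^d], so that [K[x]] is free over [S = K[y]].

   The polynomial [F] is integral over [J], up to a unit at the origin.  Otherwise
   the coefficients of its characteristic polynomial over [S] would have a smallest
   slope [p/q < 1].  But the Euler derivation of [S] extends to a derivation [E] of
   the fraction field of [K[x]], with [E F = (E - 1) phi] for [phi = \sum_j x_j y_j],
   and this makes the traces of the powers of [F], hence by Newton's identities the
   coefficients, vanish to a higher order than the slope predicts.  It follows that
   [I^(c+1)] is contained in [J I^c] for some [c], whence [f^p] lies in [J^(p-c)].

   For large primes [p] the quotient by [(f^p, y_1^p, ..., y_n^p)] has dimension at
   most [tau p^n]: in characteristic [p] this is the Frobenius map, and the bound
   lifts to [K].  On the other hand the quotient by [(y_1^p, ..., y_n^p)] has the
   basis [e_i y^a] with [a] in [[0, p)^n], where [e] is a basis of the quotient by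
   [J], and [f^p] raises [|a|] by at least [p - c].  The multiples of [f^p] are
   therefore spanned by the [f^p e_i y^a] with [|a| < s] together with the [e_i y^a]
   with [|a| >= s + p - c], so [mu * #{a | s <= |a| < s + p - c} <= tau p^n].
   Take [s = (n-1)p/2], divide by [p^n] and let [p] tend to infinity. *)

From HB Require Import structures.
Require Import Defs.
From mathcomp Require Import all_boot all_order all_algebra.
From mathcomp Require Import perm closed_field.
From mathcomp Require Import mpoly.
From mathcomp Require Import boolp classical_sets reals constructive_ereal.
From mathcomp Require Import zify ring lra.

Set Implicit Arguments.
Unset Strict Implicit.
Unset Printing Implicit Defensive.

Import Order.TTheory GRing.Theory Num.Theory.

Local Open Scope ring_scope.

(** Freeness over [K[y]] forces a polynomial model, and [F] then has critical points besides the
    origin. Their nonzero critical values are killed by a factor [q(F)] with [q(0) != 0], the unit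
    of the overview. Their share of the quotient by [(y_1^p, ..., y_n^p)], which has dimension
    [d^n p^n] in all, is cut off by an idempotent. Localization at the origin is expressed by
    congruences modulo [m^L] for every [L].

    The identity [E F = (E - 1) phi] combines [dF = \sum_j y_j dx_j] with [E y_j = y_j]. The gain
    comes from [phi] lying in [J], hence having slope 1. But [E phi] has the Hessian determinant as
    denominator, so its traces are not bounded directly: they are integrated by parts against powers
    of [phi].

    The choice of [F] threatens to be circular: [c] depends on [F], while [F] must agree with [f]
    beyond a multiple of [c] to share its Jacobian ideal. A coarse approximation supplies [c], and a
    Nakayama argument carries the same [c] to finer ones.

    The value of [s] places the slab in the middle of the box, where a window of given width holds
    the most lattice points. *)

Lemma exists_fun X Y (P : X -> Y -> Prop) :
  (forall x, exists y, P x y) -> exists f, forall x, P x (f x).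
Proof. by move=> /boolp.choice[f fP]; exists f. Qed.

(** * Linear algebra modulo a subspace *)

Section DimensionModulo.
Context (K : fieldType) (V : lmodType K).
Implicit Types (U W : V -> Prop).

Definition subspace W := W 0 /\ forall a u v, W u -> W v -> W (a *: u + v).

Definition spans_mod U W (I : finType) (e : I -> V) :=
  forall v, U v -> exists c : I -> K, W (v - \sum_i c i *: e i).

Definition free_mod W (I : finType) (e : I -> V) :=
  forall c : I -> K, W (\sum_i c i *: e i) -> forall i, c i = 0.

Lemma subspaceZ W a u : subspace W -> W u -> W (a *: u).
Proof. by case=> W0 WD Wu; rewrite -[_ *: _]addr0; apply: WD. Qed.

Lemma subspaceD W u v : subspace W -> W u -> W v -> W (u + v).
Proof. by case=> W0 WD Wu Wv; rewrite -[u]scale1r; apply: WD. Qed.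

Lemma subspace_sum W (I : Type) (r : seq I) (P : pred I) (F : I -> V) :
  subspace W -> (forall i, P i -> W (F i)) -> W (\sum_(i <- r | P i) F i).
Proof.
move=> sW WF; elim/big_ind: _ => //; first by case: sW.
by move=> u v; apply: subspaceD.
Qed.

(** Steinitz exchange in [V / W]: with more vectors than generators, the coefficient matrix has a
    nonzero kernel vector, which is a relation. *)
Lemma free_le_spans W (I J : finType) (e : I -> V) (f : J -> V) :
  subspace W -> spans_mod (fun=> True) W e -> free_mod W f -> (#|J| <= #|I|)%N.
Proof.
move=> sW spe frf.
have [c cP] := exists_fun (fun j => spe (f j) Logic.I).
pose C := \matrix_(j < #|J|, i < #|I|) c (enum_val j) (enum_val i).
case: leqP => // ltIJ.
have: kermx C != 0.
  rewrite kermx_eq0 -row_leq_rank -ltnNge.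
  exact: leq_ltn_trans (rank_leq_col _) ltIJ.
case/rowV0Pn => u /sub_kermxP uC /eqP[].
apply/rowP => j; rewrite mxE.
rewrite -[j]enum_valK; move: (enum_val j) => {}j.
pose a j := u 0 (enum_rank j).
apply: (frf a) => //.
have -> : \sum_j a j *: f j = \sum_j a j *: (f j - \sum_i c j i *: e i).
  under [RHS]eq_bigr do rewrite scalerBr scaler_sumr.
  rewrite sumrB exchange_big /= [X in _ - X]big1 ?subr0 // => i _.
  under eq_bigr do rewrite scalerA.
  rewrite -scaler_suml.
  have /matrixP/(_ 0 (enum_rank i)) := uC.
  rewrite !mxE (reindex enum_rank) /=; last exact/onW_bij/enum_rank_bij.
  move=> s0.
  have -> : \sum_k a k * c k i = 0.
    by rewrite -[RHS]s0; apply: eq_bigr => k _; rewrite mxE !enum_rankK.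
  by rewrite scale0r.
by apply: subspace_sum => // k _; apply: subspaceZ.
Qed.

(** A free family of maximal size spans, since a vector outside its span would enlarge it; the bound
    [B] makes a maximum exist. *)
Lemma exists_basis_mod U W B :
  subspace W ->
  (forall r (z : 'I_r -> V), (forall i, U (z i)) -> free_mod W z -> (r <= B)%N) ->
  exists r (z : 'I_r -> V),
    [/\ forall i, U (z i), free_mod W z & spans_mod U W z].
Proof.
move=> sW bd.
pose P r := `[< exists z : 'I_r -> V, (forall i, U (z i)) /\ free_mod W z >].
have P0 : exists r, P r.
  by exists 0%N; apply/asboolP; exists (fun=> 0); split=> [[]|c _ []].
have PB r : P r -> (r <= B)%N by case/asboolP => z [Uz frz]; apply: bd Uz frz.
case: (ex_maxnP P0 PB) => r /asboolP[z [Uz frz]] rmax.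
exists r, z; split=> // v Uv; apply: contrapT => nov.
suff /rmax : P r.+1 by rewrite ltnn.
apply/asboolP; exists (fun i => oapp z v (unlift ord_max i)); split.
  by move=> i; case: unliftP => [j|] _ /=.
move=> c; rewrite big_ord_recr /= unlift_none /=.
under eq_bigr => i _.
  rewrite (_ : widen_ord _ i = lift ord_max i) ?liftK /=; last first.
    by apply: val_inj; rewrite /= /bump leqNgt ltn_ord.
  over.
move=> Wc.
have c0 : c ord_max = 0.
  apply: contrapT => /eqP cn0; apply: nov.
  exists (fun i => - (c ord_max)^-1 * c (lift ord_max i)).
  rewrite (_ : _ - _ = (c ord_max)^-1 *:
     (\sum_(i < r) c (lift ord_max i) *: z i + c ord_max *: v)).
    exact: subspaceZ.
  rewrite scalerDr scalerA mulVf // scale1r addrC scaler_sumr -sumrN.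
  by congr (_ + _); apply: eq_bigr => i _; rewrite scalerA mulNr scaleNr opprK.
move=> i; case: (unliftP ord_max i) => [j|] -> //.
by apply: (frz (fun j => c (lift ord_max j))); rewrite c0 scale0r addr0 in Wc.
Qed.

End DimensionModulo.

(** * Newton's identities and weights of traces *)

Section Newton.
Context (R : comNzRingType).

Lemma deriv_prod_ord m (F : 'I_m -> {poly R}) :
  (\prod_i F i)^`() = \sum_i (F i)^`() * \prod_(j | j != i) F j.
Proof.
have gen (r : seq 'I_m) : uniq r ->
    (\prod_(i <- r) F i)^`() = \sum_(i <- r) (F i)^`() * \prod_(j <- r | j != i) F j.
  elim: r => [|i r IH] /=; first by rewrite !big_nil derivC.
  case/andP=> ir ur; rewrite !big_cons derivM eqxx /= IH //; congr (_ * _ + _).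
    rewrite big_seq_cond [RHS]big_seq_cond; apply: eq_bigl => j.
    rewrite andbT; case: (boolP (j \in r)) => //= jr.
    by apply/esym; apply: contraNneq ir => <-.
  rewrite mulr_sumr; rewrite big_seq [RHS]big_seq.
  apply: eq_bigr => j jr; rewrite big_cons ifT; last by apply: contraNneq ir => ->.
  by rewrite mulrCA.
by rewrite gen ?index_enum_uniq.
Qed.

(** Jacobi's formula: the Leibniz expansion is differentiated one row at a time. *)
Lemma deriv_det m (M : 'M[{poly R}]_m) :
  (\det M)^`() = \tr (map_mx (@deriv R) M *m \adj M).
Proof.
have -> : (\det M)^`() = \sum_i \det (\matrix_(k, j) (if k == i then (M k j)^`() else M k j)).
  rewrite /determinant raddf_sum exchange_big /=; apply: eq_bigr => s _.
  rewrite -mulr_sumr; rewrite -signr_odd; case: (odd _); rewrite ?expr1 ?expr0 ?mulN1r ?derivN ?mul1r; last first.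
    rewrite deriv_prod_ord; apply: eq_bigr => i _; rewrite [RHS](bigD1 i) //= mxE eqxx.
    by congr (_ * _); apply: eq_bigr => j /negPf ji; rewrite mxE ji.
  congr (- _); rewrite deriv_prod_ord; apply: eq_bigr => i _; rewrite [RHS](bigD1 i) //= mxE eqxx.
  by congr (_ * _); apply: eq_bigr => j /negPf ji; rewrite mxE ji.
apply: eq_bigr => i _; rewrite (expand_det_row _ i) mxE.
apply: eq_bigr => j _; rewrite !mxE eqxx; congr (_ * _).
rewrite /cofactor; congr (_ * \det _); apply/matrixP => a b; rewrite !mxE.
by rewrite eq_sym (negPf (neq_lift _ _)).
Qed.

(** Valid over any commutative ring, without eigenvalues. The coefficient matrices [B i] of the
    adjugate of [X - Z] satisfy a Horner recursion, because [(X - Z)] times the adjugate is [chi],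
    and their traces are the coefficients of the derivative of [chi] by Jacobi's formula. *)
Lemma Newton_char_poly m (Z : 'M[R]_m) k : (0 < k <= m)%N ->
  (char_poly Z)`_(m - k) *+ k =
    - \sum_(j < k) (char_poly Z)`_(m - j) * \tr (Z ^+ (k - j)).
Proof.
set chi := char_poly Z; set N := \adj (char_poly_mx Z).
pose B i := map_mx (coefp i) N.
have trB i : \tr (B i) = chi`_i.+1 *+ i.+1.
  rewrite -coef_deriv /chi /char_poly deriv_det.
  rewrite (_ : map_mx _ _ = 1%:M); last first.
    apply/matrixP => a b; rewrite !mxE derivB derivC subr0.
    by case: (a == b); rewrite ?mulr1n ?mulr0n ?derivX ?derivC.
  by rewrite mul1mx /mxtrace coef_sum; apply: eq_bigr => j _; rewrite mxE.
have recB i : (if i is j.+1 then B j else 0) = Z *m B i + (chi`_i)%:M.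
  have /(congr1 (map_mx (coefp i))) := mul_mx_adj (char_poly_mx Z).
  rewrite -/N -/(char_poly Z) -/chi mulmxBl => e.
  apply/eqP; rewrite addrC -subr_eq; apply/eqP.
  transitivity (map_mx (coefp i) (chi%:M : 'M_m)); last first.
    apply/matrixP => a b; rewrite !mxE /coefp.
    by case: (a == b); rewrite ?mulr1n ?mulr0n ?coef0.
  rewrite -e map_mxB mul_scalar_mx; congr (_ - _); apply/matrixP => a b.
    by rewrite !mxE /= coefXM; case: i {e} => [|i]; rewrite !mxE.
  rewrite !mxE /= coef_sum; apply: eq_bigr => c _.
  by rewrite !mxE /= coefCM.
have chi_gt i : (m < i)%N -> chi`_i = 0.
  by move=> mi; rewrite nth_default // size_char_poly.
(* From index [m] on the recursion reads [B i = Z *m B i.+1], and [B] vanishes beyond the degrees of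
   the entries of the adjugate. *)
have Bhigh i : (m <= i)%N -> B i = 0.
  move=> mi; suff H l : B i = Z ^+ l *m B (i + l)%N.
    pose l := (\max_a \max_b size (N a b))%N.
    have Nl a b : (size (N a b) <= l)%N.
      exact: leq_trans (leq_bigmax b) (leq_bigmax a).
    rewrite (H l) (_ : B (i + l)%N = 0) ?mulmx0 //.
    apply/matrixP => a b; rewrite [LHS]mxE [RHS]mxE /= nth_default //.
    exact: leq_trans (Nl a b) (leq_addl _ _).
  elim: l => [|l ->]; first by rewrite mul1mx addn0.
  rewrite addnS (recB (i + l).+1) chi_gt ?ltnS ?(leq_trans mi (leq_addr _ _)) //.
  by rewrite raddf0 addr0 mulmxA exprSr.
have Bm l : (l < m)%N -> B (m - l.+1)%N = \sum_(j < l.+1) chi`_(m - j) *: Z ^+ (l - j).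
  elim: l => [|l IH] lm.
    rewrite big_ord1 subn0 subnn -[in LHS](prednK lm) subSS subn0.
    by rewrite (recB m.-1.+1) prednK // Bhigh // mulmx0 add0r scalemx1.
  have e : (m - l.+1 = (m - l.+2).+1)%N by lia.
  have := recB (m - l.+1)%N; rewrite {1}e => ->; rewrite IH ?(ltnW lm) //.
  rewrite [RHS]big_ord_recr /= subnn -scalemx1; congr (_ + _).
  rewrite mulmx_sumr; apply: eq_bigr => j _; rewrite -scalemxAr.
  by rewrite (subSn (ltn_ord j : j <= l)%N) [in RHS]exprS.
case/andP=> k0 km.
have trE l : \tr (\sum_(j < l.+1) chi`_(m - j) *: Z ^+ (l - j)) =
    \sum_(j < l) chi`_(m - j) * \tr (Z ^+ (l - j)) + chi`_(m - l) *+ m.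
  rewrite raddf_sum big_ord_recr /= subnn mxtraceZ mxtrace1 mulr_natr.
  by congr (_ + _); apply: eq_bigr => j _; rewrite mxtraceZ.
(* For [k = m] the matrix of index [m - k - 1] does not exist; the recursion at index 0, whose left
   side is 0, takes its place. *)
move: km; rewrite leq_eqVlt => /orP[/eqP km|km].
  have := congr1 mxtrace (recB 0%N).
  rewrite mxtrace0 mxtraceD mxtrace_scalar.
  rewrite (_ : 0 = m - k.-1.+1)%N; last by lia.
  rewrite Bm; last by lia.
  move/eqP; rewrite eq_sym addrC addr_eq0 => /eqP e.
  rewrite {2}km (_ : m - k = m - k.-1.+1)%N; last by lia.
  rewrite e prednK //; congr (- _); rewrite mulmx_sumr [LHS]raddf_sum; apply: eq_bigr => j _.
  rewrite /= -scalemxAr mxtraceZ -[Z *m _]/(Z * _) -exprS.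
  by congr (_ * \tr (Z ^+ _)); have := ltn_ord j; lia.
have := trE k; rewrite -Bm // trB (_ : (m - k.+1).+1 = m - k)%N; last by lia.
rewrite (_ : chi`_(m - k) *+ m = chi`_(m - k) *+ (m - k) + chi`_(m - k) *+ k); last first.
  by rewrite -mulrnDr subnK // ltnW.
rewrite addrCA -[LHS]addr0 => /addrI/esym/eqP.
by rewrite addrC addr_eq0 => /eqP.
Qed.

End Newton.

(** * Order of vanishing in one variable *)

Section Vanish.
Context (D : idomainType).
Implicit Types p : {poly D}.

Definition vanish r p := forall i, (i < r)%N -> p`_i = 0.

Lemma vanish_le r r' p : (r' <= r)%N -> vanish r p -> vanish r' p.
Proof. by move=> le v i ir; apply: v; apply: leq_trans le. Qed.

Lemma vanish0 r : vanish r 0. Proof. by move=> i _; rewrite coef0. Qed.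

Lemma vanishD r p p' : vanish r p -> vanish r p' -> vanish r (p + p').
Proof. by move=> v v' i ir; rewrite coefD v // v' // addr0. Qed.

Lemma vanish_sum r (I : Type) (s : seq I) (P : pred I) (F : I -> {poly D}) :
  (forall i, P i -> vanish r (F i)) -> vanish r (\sum_(i <- s | P i) F i).
Proof.
by move=> v; elim/big_ind: _ => //; [exact: vanish0 | exact: vanishD].
Qed.

Lemma vanishM r r' p p' : vanish r p -> vanish r' p' -> vanish (r + r') (p * p').
Proof.
move=> v v' i ir; rewrite coefM big1 // => j _.
case: (ltnP j r) => jr; first by rewrite v // mul0r.
by rewrite v' ?mulr0 //; have := ltn_ord j; lia.
Qed.

Lemma vanishXn r k : (r <= k)%N -> vanish r 'X^k.
Proof. by move=> rk i ir; rewrite coefXn; case: eqP => // ik; lia. Qed.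

Lemma vanish_prod r (I : finType) (F : I -> {poly D}) :
  (forall i, vanish r (F i)) -> vanish (r * #|I|) (\prod_i F i).
Proof.
move=> v; rewrite cardE -big_enum /=; elim: (enum I) => [|i s IH] /=.
  by rewrite muln0.
by rewrite big_cons mulnS; apply: vanishM.
Qed.

Lemma vanish_det r m (M : 'M[{poly D}]_m) :
  (forall a b, vanish r (M a b)) -> vanish (r * m) (\det M).
Proof.
move=> v; apply: vanish_sum => s _; rewrite -[(r * m)%N]add0n.
by apply: vanishM => //; rewrite -{1}(card_ord m); apply: vanish_prod.
Qed.

(** If [v] is the exact order of [p], then [p ^+ j] has order [v * j], so a bounded loss is
    negligible for large [j]. The exponent [j = m * C + 1] already contradicts [v < m * w]. *)
Lemma vanish_powers p w C m :
  (forall j, vanish (m * (w * j - C)) (p ^+ j)) -> vanish (m * w) p.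
Proof.
move=> vp; case: (eqVneq p 0) => [->|p0]; first exact: vanish0.
have ex : exists i, p`_i != 0.
  by exists (size p).-1; rewrite -lead_coefE lead_coef_eq0.
have := ex_minnP ex => -[v pv vmin].
move=> i ivm; apply/eqP; apply: contraT => /vmin iv.
have e : p = Poly (drop v p) * 'X^v.
  apply/polyP => k; rewrite coefMXn; case: ltnP => kv.
    by apply/eqP; apply: contraTT kv => /vmin; rewrite -leqNgt.
  by rewrite coef_Poly nth_drop subnKC.
have : (p ^+ (m * C).+1)`_(v * (m * C).+1) != 0.
  rewrite e exprMn -exprM coefMXn ltnn subnn -horner_coef0 horner_exp horner_coef0.
  by rewrite expf_neq0 // coef_Poly nth_drop addn0.
rewrite vp ?eqxx // mulnBr mulnA.
have : (v.+1 * (m * C).+1 <= m * w * (m * C).+1)%N by rewrite leq_mul2r (leq_ltn_trans iv).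
by rewrite mulSn; lia.
Qed.

End Vanish.

(** * Fractional orders at the origin *)

Section Weight.
Context (K : fieldType) (n : nat).
Implicit Types s t : {mpoly K[n]}.

(* [wt q r s]: the order of [s] at the origin is at least [r / q]. *)
Definition wt q r s := forall a, s@_a != 0 -> (r <= q * mdeg a)%N.

Lemma wt_le q r r' s : (r' <= r)%N -> wt q r s -> wt q r' s.
Proof. by move=> le v a /v; apply: leq_trans. Qed.

Lemma wt_0 q r : wt q r 0. Proof. by move=> a; rewrite mcoeff0 eqxx. Qed.

Lemma wt0 q s : wt q 0 s. Proof. by []. Qed.

Lemma wtD q r s t : wt q r s -> wt q r t -> wt q r (s + t).
Proof.
move=> vs vt a; rewrite mcoeffD; case: (eqVneq s@_a 0) => [->|/vs //].
by rewrite add0r; apply: vt.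
Qed.

Lemma wtZ q r c s : wt q r s -> wt q r (c *: s).
Proof.
by move=> vs a; rewrite mcoeffZ mulf_eq0 negb_or => /andP[_ /vs].
Qed.

Lemma wtN q r s : wt q r s -> wt q r (- s).
Proof. by rewrite -scaleN1r; apply: wtZ. Qed.

Lemma wtB q r s t : wt q r s -> wt q r t -> wt q r (s - t).
Proof. by move=> vs /wtN; apply: wtD. Qed.

Lemma wt_sum q r (I : Type) (u : seq I) (P : pred I) (F : I -> {mpoly K[n]}) :
  (forall i, P i -> wt q r (F i)) -> wt q r (\sum_(i <- u | P i) F i).
Proof. by move=> v; elim/big_ind: _ => //; [exact: wt_0 | exact: wtD]. Qed.

Lemma wtMn q r s k : wt q r s -> wt q r (s *+ k).
Proof. by move=> vs; rewrite -scaler_nat; apply: wtZ. Qed.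

Lemma wtM q r r' s t : wt q r s -> wt q r' t -> wt q (r + r') (s * t).
Proof.
move=> vs vt a; rewrite -mcoeff_msupp => /msuppM_le/allpairsP[[b c] /= [sb tc ->]].
by rewrite mdegD mulnDr leq_add // ?vs ?vt // -mcoeff_msupp.
Qed.

Lemma wt_var q i : wt q q ('X_i : {mpoly K[n]}).
Proof.
move=> a; rewrite mcoeffX; case: (U_(i)%MM =P a) => [<- _|]; last by rewrite eqxx.
by rewrite mdeg1 muln1.
Qed.

(** With [T] the new variable, [X_i] goes to [X_i T^q], so the order in [T] is [q] times the order
    at the origin. As a ring morphism it passes through determinants. *)
Definition grading q : {mpoly K[n]} -> {poly {mpoly K[n]}} :=
  mmap (polyC \o @mpolyC n K) (fun i => 'X_i *: 'X^q).

HB.instance Definition _ q := GRing.RMorphism.copy (grading q)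
  (mmap (polyC \o @mpolyC n K) (fun i => 'X_i *: 'X^q)).

Lemma gradingE q s :
  grading q s = \sum_(a <- msupp s) (s@_a *: 'X_[a]) *: 'X^(q * mdeg a).
Proof.
apply: eq_bigr => a _ /=; rewrite /mmap1.
under eq_bigr do rewrite exprZn -exprM.
rewrite scaler_prod -mpolyXE_id prodrXr mul_polyC -[in RHS]mul_mpolyC -scalerA.
by rewrite mdegE big_distrr.
Qed.

Lemma coef_grading q s r a :
  ((grading q s)`_r)@_a = if r == (q * mdeg a)%N then s@_a else 0.
Proof.
rewrite gradingE coef_sum raddf_sum /=.
case: (boolP (a \in msupp s)) => sa; last first.
  rewrite memN_msupp_eq0 // if_same big_seq big1 // => b sb.
  rewrite coefZ coefXn mulr_natr mcoeffMn mcoeffZ mcoeffX.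
  case: (b =P a) => [ba|_]; last by rewrite mulr0 mul0rn.
  by rewrite -ba sb in sa.
rewrite (bigD1_seq a) ?msupp_uniq //= big1 ?addr0; last first.
  move=> b /negPf ba; rewrite coefZ coefXn mulr_natr mcoeffMn mcoeffZ mcoeffX ba.
  by rewrite mulr0 mul0rn.
rewrite coefZ coefXn mulr_natr mcoeffMn mcoeffZ mcoeffX eqxx mulr1.
by case: eqP.
Qed.

Lemma vanish_grading q r s : wt q r s <-> vanish r (grading q s).
Proof.
split=> [vs i ir|vs a sa].
  apply/mpolyP => a; rewrite coef_grading mcoeff0; case: eqP => // ia.
  by apply: contraTeq ir => /vs; rewrite -ia -leqNgt.
rewrite leqNgt; apply: contra sa => /vs /mpolyP/(_ a).
by rewrite coef_grading eqxx mcoeff0 => ->.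
Qed.

End Weight.

Lemma map_mx_exp (R R' : nzRingType) (g : {rmorphism R -> R'}) m (Z : 'M[R]_m.+1) k :
  map_mx g (Z ^+ k) = map_mx g Z ^+ k.
Proof. exact: rmorphXn. Qed.

Lemma scalar_mx_exp (R : nzRingType) m (c : R) k :
  c%:M ^+ k = (c ^+ k)%:M :> 'M_m.+1.
Proof. by rewrite -rmorphXn. Qed.

Lemma det_mx_exp (R : comNzRingType) m (Z : 'M[R]_m.+1) k :
  \det (Z ^+ k) = \det Z ^+ k.
Proof. by elim: k => [|k IH]; rewrite ?det1 // !exprS det_mulmx IH. Qed.

Section TraceWeight.
Context (K : fieldType) (n q w : nat).
Local Notation S := {mpoly K[n]}.

(** The variable of [p] receives weight [w]: it goes to [X T^w], with [T] the outer variable, while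
    the coefficients are graded by [q]. *)
Definition bigrading (p : {poly S}) : {poly {poly S}} :=
  horner_eval ('X%:P * 'X^w) (map_poly (map_poly polyC \o grading q) p).

HB.instance Definition _ := GRing.RMorphism.copy bigrading
  (horner_eval ('X%:P * 'X^w) \o map_poly (map_poly polyC \o @grading K n q)).

Lemma coef_bigrading p r i : (bigrading p)`_r`_i =
  if (w * i <= r)%N then (grading q p`_i)`_(r - w * i) else 0.
Proof.
rewrite /bigrading /horner_eval (@horner_coef_wide _ (size p)) ?size_poly //.
rewrite [in LHS]coef_sum [in LHS]coef_sum.
transitivity (\sum_(j < size p) if i == j :> nat then
    (if (w * i <= r)%N then (grading q p`_i)`_(r - w * i) else 0) else 0).
  apply: eq_bigr => j _; rewrite exprMn -exprM mulrA coefMXn -rmorphXn /=.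
  rewrite coef_map /= coefMC coef_map /=.
  case: (eqVneq (i : nat) j) => [->|ij]; last first.
    by case: ifP => _; rewrite ?coef0 // coefCM coefXn (negPf ij) mulr0.
  rewrite ltnNge; case: (w * j <= r)%N; rewrite /= ?coef0 //.
  by rewrite coefCM coefXn eqxx mulr1.
case: (ltnP i (size p)) => ip.
  rewrite (bigD1 (Ordinal ip)) //= eqxx big1 ?addr0 // => j; rewrite -val_eqE /=.
  by rewrite eq_sym => /negPf->.
rewrite big1 => [|j _]; last first.
  by case: eqP => // ij; have := ltn_ord j; rewrite -ij ltnNge ip.
by rewrite (nth_default _ ip) raddf0 coef0 if_same.
Qed.

(* If the powers of [Z] have weight [w j - C] then the eigenvalues of [Z] have
   weight [w]; the bounded loss [C] disappears since the determinant of
   [X - Z] is multiplicative. *)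
Lemma wt_trace C m (Z : 'M[S]_m) :
  (forall j a b, wt q (w * j - C) ((Z ^+ j) a b)) -> wt q w (\tr Z).
Proof.
case: m Z => [|m] Z wZ; first by rewrite /mxtrace big_ord0; apply: wt_0.
have wN j a b : wt q (w * j - C) (((- Z) ^+ j) a b).
  rewrite exprNn -signr_odd -mulmxE; case: (odd j); rewrite ?expr1 ?expr0.
    by rewrite mulmxE mulN1r mxE; apply: wtN.
  by rewrite mulmxE mul1r.
have vchi : vanish (m.+1 * w) (bigrading (char_poly Z)).
  apply: (@vanish_powers _ _ w C) => j.
  rewrite /char_poly -det_map_mx /char_poly_mx map_mxB -map_mx_comp.
  rewrite map_scalar_mx /=.
  set al := bigrading 'X; set f := _ \o _.
  have alE : al = 'X%:P * 'X^w.
    by rewrite /al /bigrading /horner_eval map_polyX hornerX.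
  have fE s : f s = map_poly polyC (grading q s).
    by rewrite /f /= /bigrading /horner_eval map_polyC /= hornerC.
  have -> : \det (al%:M - map_mx f Z) ^+ j = \det ((al%:M - map_mx f Z) ^+ j).
    by rewrite det_mx_exp.
  rewrite mulnC; apply: vanish_det => a b.
  (* Every term of the binomial expansion of [(X - Z) ^+ j] has weight at least [w * j - C]. *)
  rewrite -map_mxN exprDn_comm; last exact/esym/scalar_mxC.
  rewrite summxE; apply: vanish_sum => i _.
  rewrite scalar_mx_exp -map_mx_exp -mulmxE mul_scalar_mx -scaler_nat !mxE.
  rewrite -[X in _ * (_ * X)]/(f (((- Z) ^+ i) a b)) fE.
  rewrite -[(w * j - C)%N]add0n; apply: vanishM => //.
  apply: (@vanish_le _ (w * (j - i) + (w * i - C))).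
    have := ltn_ord i; rewrite ltnS => ij.
    have -> : (w * j = w * (j - i) + w * i)%N by rewrite -mulnDr subnK.
    move: (w * (j - i))%N (w * i)%N => A B; lia.
  apply: vanishM.
    by rewrite alE exprMn -exprM -[(w * (j - i))%N]add0n; apply: vanishM => //; apply: vanishXn.
  have /vanish_grading vN := wN i a b.
  by move=> k kl; rewrite coef_map vN ?raddf0.
have -> : \tr Z = - (char_poly Z)`_m by rewrite char_poly_trace ?opprK.
apply/wtN/vanish_grading => r rw.
(* Of the total weight [m.+1 * w], the monomial [X^m] carries [w * m]; its coefficient, the trace up
   to sign, is left with [w]. *)
have := vchi (r + w * m)%N; rewrite mulSn (mulnC m) ltn_add2r => /(_ rw).
move/(congr1 (fun p : {poly S} => p`_m)).
by rewrite coef_bigrading coef0 leq_addl addnK.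
Qed.

End TraceWeight.

(** * Integral equations with coefficients of high order *)

Section Euler.
Context (K : fieldType) (n : nat).
Local Notation S := {mpoly K[n]}.

Definition euler (s : S) : S := \sum_i 'X_i * s^`M(i).

Lemma euler_is_linear : linear euler.
Proof.
move=> c s t; rewrite /euler scaler_sumr -big_split /=; apply: eq_bigr => i _.
by rewrite mderivD mderivZ mulrDr scalerAr.
Qed.

HB.instance Definition _ := GRing.isLinear.Build K S S *:%R euler euler_is_linear.

Lemma eulerM s t : euler (s * t) = euler s * t + s * euler t.
Proof.
rewrite /euler mulr_suml mulr_sumr -big_split; apply: eq_bigr => i _ /=.
by rewrite mderivM; ring.
Qed.

Lemma mcoeff_euler s a : (euler s)@_a = s@_a *+ mdeg a.
Proof.
have eulerX b : euler 'X_[b] = 'X_[b] *+ mdeg b.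
  rewrite /euler mdegE -sumrMnr; apply: eq_bigr => i _.
  rewrite mderivX -scalerAr -mpolyXD; case: (posnP (b i)) => [->|bi].
    by rewrite scale0r mulr0n.
  by rewrite addmC submK ?scaler_nat //; apply/mnm_lepP => j; rewrite mnm1E; case: eqP => // <-.
transitivity (\sum_(b <- msupp s) (s@_b *: 'X_[b])@_a *+ mdeg a); last first.
  by rewrite sumrMnl -raddf_sum -mpolyE.
rewrite [X in euler X]mpolyE (linear_sum euler) (raddf_sum (mcoeff a)) /=.
apply: eq_bigr => b _; rewrite linearZ /= eulerX !mcoeffZ mcoeffMn mcoeffX.
by case: (b =P a) => [->|]; rewrite ?mul0rn ?mulr0 ?mul0rn // mulrnAr.
Qed.

Lemma wt_euler q r s : wt q r s -> wt q r (euler s).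
Proof.
move=> ws a; rewrite mcoeff_euler; case: (eqVneq s@_a 0) => [->|/ws //].
by rewrite mul0rn eqxx.
Qed.

(** The Euler derivation multiplies the part of degree [k] by [k], so in characteristic zero it
    loses only the constant term. *)
Lemma wt_euler_inv q r s : [pchar K] =i pred0 -> s@_0 = 0 ->
  wt q r (euler s) -> wt q r s.
Proof.
move=> /pcharf0P K0 s0 ws a sa; apply: ws; rewrite mcoeff_euler -mulr_natr mulf_neq0 //.
rewrite K0 mdeg_eq0; apply: contraNneq sa => ->.
by rewrite s0.
Qed.

End Euler.

(** * Multiplication matrices in a free extension *)

Section MultiplicationMatrix.
Context (S : idomainType) (A : idomainType) (sg : {rmorphism S -> A}).
Context (m : nat) (b : 'I_m.+1 -> A).
Hypothesis bspan : forall u, exists c : 'I_m.+1 -> S, u = \sum_i sg (c i) * b i.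
Hypothesis bfree : forall c : 'I_m.+1 -> S,
  \sum_i sg (c i) * b i = 0 -> forall i, c i = 0.

Definition coord u := sval (cid (bspan u)).

Definition mulmat u : 'M[S]_m.+1 := \matrix_(i, j) coord (u * b i) j.

Lemma mulmatE u i : u * b i = \sum_j sg (mulmat u i j) * b j.
Proof.
by under eq_bigr do rewrite mxE; rewrite /coord; case: cid.
Qed.

Lemma mulmat_uniq u (M : 'M[S]_m.+1) :
  (forall i, u * b i = \sum_j sg (M i j) * b j) -> mulmat u = M.
Proof.
move=> e; apply/matrixP => i j; apply/eqP; rewrite -subr_eq0; apply/eqP.
apply: (bfree (c := fun j => mulmat u i j - M i j)).
under eq_bigr do rewrite rmorphB mulrBl.
by rewrite sumrB -mulmatE -e subrr.
Qed.

Lemma mulmatD u v : mulmat (u + v) = mulmat u + mulmat v.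
Proof.
apply: mulmat_uniq => i; rewrite mulrDl !mulmatE -big_split /=.
by apply: eq_bigr => j _; rewrite !mxE rmorphD mulrDl.
Qed.

Lemma mulmatM u v : mulmat (u * v) = mulmat u * mulmat v.
Proof.
apply: mulmat_uniq => i; rewrite mulrAC mulmatE mulr_suml.
under eq_bigr do rewrite -mulrA [b _ * v]mulrC mulmatE mulr_sumr.
rewrite exchange_big /=; apply: eq_bigr => j _.
rewrite mxE rmorph_sum mulr_suml; apply: eq_bigr => k _.
by rewrite rmorphM mulrA.
Qed.

Lemma mulmat_scalar s : mulmat (sg s) = s%:M.
Proof.
apply: mulmat_uniq => i; rewrite (bigD1 i) //= mxE eqxx mulr1n big1 ?addr0 //.
by move=> j /negPf ji; rewrite mxE eq_sym ji mulr0n rmorph0 mul0r.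
Qed.

Lemma mulmat1 : mulmat 1 = 1.
Proof. by rewrite -(rmorph1 sg) mulmat_scalar. Qed.

Lemma mulmatX u k : mulmat (u ^+ k) = mulmat u ^+ k.
Proof. by elim: k => [|k IH]; rewrite ?mulmat1 // !exprS mulmatM IH. Qed.

Lemma mulmat_sum (I : Type) (r : seq I) (P : pred I) (F : I -> A) :
  mulmat (\sum_(i <- r | P i) F i) = \sum_(i <- r | P i) mulmat (F i).
Proof.
apply: (big_morph mulmat mulmatD).
by rewrite -(rmorph0 sg) mulmat_scalar raddf0.
Qed.

Lemma mulmat_eq0 u : mulmat u = 0 -> u = 0.
Proof.
move=> u0; have [c c1] := bspan 1.
rewrite -[u]mulr1 c1 mulr_sumr big1 // => i _.
by rewrite mulrCA mulmatE u0 big1 ?mulr0 // => j _; rewrite mxE rmorph0 mul0r.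
Qed.

Lemma det_mulmat_neq0 u : u != 0 -> \det (mulmat u) != 0.
Proof.
apply: contra => /det0P[v v0 vu].
have : u * (\sum_i sg (v 0 i) * b i) = 0.
  rewrite mulr_sumr; under eq_bigr do rewrite mulrCA mulmatE mulr_sumr.
  rewrite exchange_big big1 //= => j _.
  under eq_bigr do rewrite mulrA -rmorphM.
  rewrite -mulr_suml -rmorph_sum.
  by have /matrixP/(_ 0 j) := vu; rewrite !mxE => ->; rewrite rmorph0 mul0r.
move/eqP; rewrite mulf_eq0 => /orP[//|/eqP/bfree vz].
by case/eqP: v0; apply/rowP => i; rewrite vz mxE.
Qed.

Lemma char_poly_mulmat u :
  \sum_(i < m.+2) sg (char_poly (mulmat u))`_i * u ^+ i = 0.
Proof.
apply: mulmat_eq0; rewrite mulmat_sum -[RHS](Cayley_Hamilton (mulmat u)).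
rewrite /horner_mx /horner_morph (@horner_coef_wide _ m.+2); last first.
  by rewrite -(size_char_poly (mulmat u)) size_poly.
apply: eq_bigr => i _.
by rewrite coef_map mulmatM mulmat_scalar mulmatX.
Qed.

(** The adjugate is a multiple of the inverse over the fraction field; the determinant, nonzero
    because [A] is a domain, is multiplied in and cancelled. *)
Lemma mulmat_adj_comm u v : u != 0 ->
  mulmat v *m \adj (mulmat u) = \adj (mulmat u) *m mulmat v.
Proof.
move=> /det_mulmat_neq0 d0; apply: (scalemx_inj d0).
have uv : mulmat u *m mulmat v = mulmat v *m mulmat u.
  by rewrite -[LHS]mulmatM -[RHS]mulmatM mulrC.
rewrite -!mul_scalar_mx; apply: (etrans (y := \adj (mulmat u) *m mulmat v *m (\det (mulmat u))%:M)).
  rewrite -[in LHS]mul_adj_mx -mul_mx_adj -!mulmxA.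
  by rewrite [mulmat u *m (mulmat v *m _)]mulmxA uv -mulmxA.
by rewrite scalar_mxC.
Qed.

End MultiplicationMatrix.

Lemma wt_mulmx (K : fieldType) n q r r' m (M N : 'M[{mpoly K[n]}]_m) :
  (forall i j, wt q r (M i j)) -> (forall i j, wt q r' (N i j)) ->
  forall i j, wt q (r + r') ((M *m N) i j).
Proof. by move=> wM wN i j; rewrite mxE; apply: wt_sum => k _; apply: wtM. Qed.

(** * Traces under the Euler derivation and the slope bound *)

Section EulerIntegrality.
Context (K : fieldType) (n m : nat) (A : idomainType).
Hypothesis K0 : [pchar K] =i pred0.
Local Notation S := {mpoly K[n]}.
Context (sg : {rmorphism S -> A}) (b : 'I_m.+1 -> A).
Hypothesis bspan : forall u, exists c : 'I_m.+1 -> S, u = \sum_i sg (c i) * b i.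
Hypothesis bfree : forall c : 'I_m.+1 -> S,
  \sum_i sg (c i) * b i = 0 -> forall i, c i = 0.
Context (D : A -> A) (h : A).
Hypothesis h0 : h != 0.
Hypothesis DD : forall u v, D (u + v) = D u + D v.
Hypothesis DM : forall u v, D (u * v) = D u * v + u * D v.
Hypothesis Dsg : forall s, D (sg s) = h * sg (euler s).
Context (F : A) (xx : 'I_n -> A) (pi : {poly K}) (k1 : nat) (u1 : 'I_n -> A).

Let phi := \sum_j sg 'X_j * xx j.
Hypothesis DF : D F = D phi - h * phi.

Definition ev (r : {poly K}) : A :=
  horner_eval F (map_poly (sg \o @mpolyC n K) r).
HB.instance Definition _ := GRing.RMorphism.copy ev
  (horner_eval F \o map_poly (sg \o @mpolyC n K)).

Let G := ev pi.
Hypothesis k1_gt0 : (0 < k1)%N.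
Hypothesis Gnil : G ^+ k1 = \sum_j sg 'X_j * u1 j.

Local Notation Mu := (mulmat bspan).
Let eta := D phi - h * phi.
Let Tr u := \tr (Mu u).
Let Trh u := \tr (Mu u *m \adj (Mu h)).
Let delta := \det (Mu h).

Let D0 : D 0 = 0.
Proof. by apply: (addrI (D 0)); rewrite -DD !addr0. Qed.

Let D1 : D 1 = 0.
Proof. by apply: (addrI (D 1)); rewrite addr0 -{3}(mulr1 1) DM mulr1 mul1r. Qed.

Let DX u k : D (u ^+ k) = u ^+ k.-1 * D u *+ k.
Proof.
elim: k => [|k IH]; first by rewrite expr0 D1 mulr0n.
rewrite exprS DM {}IH; case: k => [|k]; first by rewrite !mulr0n mulr0 addr0 expr0 mulr1 mul1r.
by rewrite /= mulrnAr mulrA -exprS (mulrC (D u)) -mulrS.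
Qed.

Let Dsum (I : Type) (r : seq I) (P : pred I) (f : I -> A) :
  D (\sum_(i <- r | P i) f i) = \sum_(i <- r | P i) D (f i).
Proof. exact: (big_morph D DD D0). Qed.

Let evC c : ev c%:P = sg c%:MP.
Proof. by rewrite /ev /horner_eval map_polyC /= hornerC. Qed.

Let evX : ev 'X = F.
Proof. by rewrite /ev /horner_eval map_polyX hornerX. Qed.

Let D_ev r : D (ev r) = ev r^`() * D F.
Proof.
elim/poly_ind: r => [|r c IH]; first by rewrite deriv0 rmorph0 D0 mul0r.
rewrite derivMXaddC !rmorphD !rmorphM /= evX evC DD DM Dsg IH.
have -> : euler c%:MP = 0 :> S.
  apply/mpolyP => a; rewrite mcoeff_euler mcoeff0 mcoeffC.
  by case: (a =P 0%MM) => [->|_]; rewrite ?mdeg0 ?mulr0 ?mul0rn.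
by rewrite rmorph0 mulr0 addr0 mulrDl mulrAC addrC.
Qed.

Let TrhD u v : Trh (u + v) = Trh u + Trh v.
Proof. by rewrite /Trh mulmatD // mulmxDl mxtraceD. Qed.

Let Trh_sg s u : Trh (sg s * u) = s * Trh u.
Proof. by rewrite /Trh mulmatM // mulmat_scalar // -mulmxE mul_scalar_mx -scalemxAl mxtraceZ. Qed.

Let TrhN u : Trh (- u) = - Trh u.
Proof. by rewrite -mulN1r -(rmorph1 sg) -rmorphN Trh_sg mulN1r. Qed.

Let TrhMn u k : Trh (u *+ k) = Trh u *+ k.
Proof. by rewrite -mulr_natl -(rmorph_nat sg) Trh_sg mulr_natl. Qed.

Let Trh_h u : Trh (h * u) = delta * Tr u.
Proof.
rewrite /Trh mulrC mulmatM // -mulmxE -mulmxA mul_mx_adj.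
by rewrite scalar_mxC mul_scalar_mx mxtraceZ.
Qed.

(* The derivation [h^-1 D] extends the Euler derivation, so it commutes with
   the trace; [\adj (Mu h)] stands for [delta * h^-1]. *)
Let Trh_D u : Trh (D u) = delta * euler (Tr u).
Proof.
pose Gam : 'M[S]_m.+1 := \matrix_(i, j) coord bspan (D (b i)) j.
have GamE i : D (b i) = \sum_j sg (Gam i j) * b j.
  by under eq_bigr do rewrite mxE; rewrite /coord; case: cid.
(* [D] applied to [u * b i] gives the Euler derivative of the matrix together with a commutator with
   [Gam], the matrix of [D] on the basis. *)
have e : Mu (D u) = map_mx (@euler K n) (Mu u) *m Mu h + (Mu u *m Gam - Gam *m Mu u).
  apply: mulmat_uniq => // i.
  have := congr1 D (mulmatE bspan u i).
  rewrite DM Dsum => /eqP; rewrite eq_sym -subr_eq => /eqP <-.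
  under eq_bigr do rewrite DM Dsg.
  rewrite big_split /=.
  transitivity (\sum_j (sg ((map_mx (@euler K n) (Mu u) *m Mu h) i j) * b j
      + (sg ((Mu u *m Gam) i j) * b j - sg ((Gam *m Mu u) i j) * b j))); last first.
    apply: eq_bigr => j _; rewrite [in RHS]mxE [X in sg (_ + X)]mxE.
    by rewrite [X in sg (_ + (_ + X))]mxE !rmorphD rmorphN !mulrDl mulNr.
  rewrite !big_split sumrN /= -addrA; congr (_ + (_ - _)).
  - under [RHS]eq_bigr do rewrite mxE rmorph_sum mulr_suml.
    rewrite exchange_big /=; apply: eq_bigr => k _.
    rewrite mulrAC (mulmatE bspan) mulr_suml; apply: eq_bigr => j _.
    by rewrite [in RHS]mxE rmorphM; ring.
  - under [RHS]eq_bigr do rewrite mxE rmorph_sum mulr_suml.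
    rewrite exchange_big /=; apply: eq_bigr => k _.
    by rewrite GamE mulr_sumr; apply: eq_bigr => j _; rewrite rmorphM mulrA.
  rewrite GamE mulr_sumr.
  under [RHS]eq_bigr do rewrite mxE rmorph_sum mulr_suml.
  rewrite exchange_big /=; apply: eq_bigr => k _.
  rewrite mulrCA (mulmatE bspan) mulr_sumr; apply: eq_bigr => j _.
  by rewrite rmorphM mulrA.
rewrite /Trh e mulmxDl mulmxBl mxtraceD -mulmxA mul_mx_adj raddfB /=.
(* [\adj (Mu h)] commutes with [Mu u], so the commutator contributes nothing to the trace. *)
rewrite [X in _ + (_ - X)](_ : _ = \tr (Mu u *m Gam *m \adj (Mu h))); last first.
  by rewrite -[in LHS]mulmxA (mulmat_adj_comm bspan bfree) // mulmxA mxtrace_mulC mulmxA.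
rewrite subrr addr0 scalar_mxC mul_scalar_mx mxtraceZ; congr (_ * _).
by rewrite /Tr /mxtrace (linear_sum (@euler K n)); apply: eq_bigr => i _; rewrite mxE.
Qed.

Let wt_phi q j i l : wt q (q * j) (Mu (phi ^+ j) i l).
Proof.
elim: j i l => [|j IH] i l; first by rewrite muln0; apply: wt0.
rewrite exprS mulmatM // mulnS; apply: wt_mulmx => // {}i {}l.
rewrite mulmat_sum // summxE; apply: wt_sum => k _.
rewrite mulmatM // mulmat_scalar // -mulmxE mul_scalar_mx mxE -[X in wt _ X]addn0.
by apply: wtM => //; apply: wt_var.
Qed.

Let chi := char_poly (Mu G).

Section Slope.
Context (p q : nat).
Hypothesis pq : (p < q)%N.
Hypothesis wchi : forall i, (i <= m.+1)%N -> wt q (p * (m.+1 - i)) chi`_i.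

Let chi_lead : chi`_m.+1 = 1.
Proof.
have := char_poly_monic (Mu G); rewrite monicE lead_coefE size_char_poly.
by move/eqP.
Qed.

(** Cayley-Hamilton lowers a power above [m] at the expense of coefficients of slope [p / q].
    Nothing is known of the low powers, which is the source of the loss [p * m.+1]. *)
Let wt_G i j l : wt q (p * i - p * m.+1) (Mu (G ^+ i) j l).
Proof.
elim/ltn_ind: i j l => i IH j l.
case: (leqP i m) => im.
  by rewrite -mulnBr (_ : i - m.+1 = 0)%N ?muln0 //; lia.
have e : G ^+ i = - \sum_(k < m.+1) sg chi`_k * G ^+ (k + (i - m.+1)).
  have := char_poly_mulmat bspan bfree G.
  rewrite -/chi big_ord_recr /= chi_lead rmorph1 mul1r => /eqP.
  rewrite addrC addr_eq0 => /eqP Gm.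
  rewrite -{1}(subnKC im) exprD Gm mulNr mulr_suml; congr (- _).
  by apply: eq_bigr => k _; rewrite exprD mulrA.
rewrite e -mulN1r -(rmorph1 sg) -rmorphN mulmatM // mulmat_scalar //.
rewrite -mulmxE mul_scalar_mx mxE mulN1r mulmat_sum // summxE.
apply/wtN/wt_sum => k _; rewrite mulmatM // mulmat_scalar // -mulmxE mul_scalar_mx mxE.
have km := ltn_ord k.
apply: (@wt_le _ _ _ (p * (m.+1 - k) + (p * (k + (i - m.+1)) - p * m.+1))).
  have -> : (p * i = p * (m.+1 - k) + p * (k + (i - m.+1)))%N.
    by rewrite -mulnDr; congr (_ * _)%N; lia.
  move: (p * (m.+1 - k))%N (p * (k + (i - m.+1)))%N (p * m.+1)%N => x y z; lia.
by apply: wtM; [apply: wchi; lia | apply: IH; lia].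
Qed.

(** The loss in [wt_G] stays the same when the product is raised to a power, so [wt_trace] removes
    it. *)
Let wt_Tr k j r : wt q (p * k + q * j) (Tr (G ^+ k * phi ^+ j * ev r)).
Proof.
apply: (@wt_trace _ _ _ _ (p * m.+1)) => l i i'.
rewrite -mulmatX // !exprMn -!exprM mulmatM // -[(_ - _)%N]addn0.
apply: wt_mulmx => // {}i {}i'; rewrite mulmatM //.
apply: (@wt_le _ _ _ ((p * (k * l) - p * m.+1) + q * (j * l))).
  have -> : ((p * k + q * j) * l = p * (k * l) + q * (j * l))%N by ring.
  move: (p * (k * l))%N (p * m.+1)%N (q * (j * l))%N => x y z; lia.
exact: wt_mulmx.
Qed.

(** The witness [x] is the trace of [u / h]: that trace is required to lie in [S] and to have weight
    [r]. *)
Let Pw r u := exists2 x, wt q r x & Trh u = delta * x.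

Let Pw0 r : Pw r 0.
Proof.
exists 0; first exact: wt_0.
by rewrite /Trh -(rmorph0 sg) mulmat_scalar // raddf0 mul0mx mxtrace0 mulr0.
Qed.

Let PwD r u v : Pw r u -> Pw r v -> Pw r (u + v).
Proof.
case=> x wx ex [y wy ey]; exists (x + y); first exact: wtD.
by rewrite TrhD ex ey mulrDr.
Qed.

Let PwN r u : Pw r u -> Pw r (- u).
Proof.
by case=> x wx ex; exists (- x); rewrite ?TrhN ?ex ?mulrN //; apply: wtN.
Qed.

Let PwMn r u k : Pw r u -> Pw r (u *+ k).
Proof.
by case=> x wx ex; exists (x *+ k); rewrite ?TrhMn ?ex ?mulrnAr //; apply: wtMn.
Qed.

Let PwMn_inv r u k : Pw r (u *+ k.+1) -> Pw r u.
Proof.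
move=> [x wx ex]; exists (k.+1%:R^-1 *: x); first exact: wtZ.
have k0 : k.+1%:R != 0 :> K by move/pcharf0P: K0 => ->.
rewrite -scalerAr -ex TrhMn -scaler_nat scalerA mulVf ?scale1r //.
Qed.

Let Pw_le r r' u : (r' <= r)%N -> Pw r u -> Pw r' u.
Proof. by move=> le [x wx ex]; exists x => //; apply: wt_le wx. Qed.

Let D_phi_pow j : D (phi ^+ j) = phi ^+ j.-1 * (eta + h * phi) *+ j.
Proof. by rewrite DX /eta subrK. Qed.

Let DG : D G = ev pi^`() * eta.
Proof. by rewrite /G D_ev DF. Qed.

(** Integration by parts. The Leibniz rule for [D (G ^+ k * phi ^+ j.+1 * ev r)] isolates the term
    with [phi ^+ j * eta]. The trace of the total derivative is bounded through [Trh_D]. The other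
    terms have one more factor [phi], either with [r] differentiated or with one factor [G] lost;
    the exchange of [G] for [phi] is profitable since [p < q]. *)
Let Pw_step k j r :
  Pw (p * k + q * j.+2) (G ^+ k * phi ^+ j.+1 * ev r^`() * eta) ->
  ((0 < k)%N -> Pw (p * k.-1 + q * j.+2)
     (G ^+ k.-1 * phi ^+ j.+1 * ev (pi^`() * r) * eta)) ->
  Pw (p * k + q * j.+1) (G ^+ k * phi ^+ j * ev r * eta).
Proof.
move=> P1 P2; apply: (@PwMn_inv _ _ j).
have -> : (G ^+ k * phi ^+ j * ev r * eta) *+ j.+1 =
    (D (G ^+ k * phi ^+ j.+1 * ev r)
     - h * (G ^+ k * phi ^+ j.+1 * ev r) *+ j.+1)
    - (G ^+ k * phi ^+ j.+1 * ev r^`() * eta)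
    - (G ^+ k.-1 * phi ^+ j.+1 * ev (pi^`() * r) * eta) *+ k.
  rewrite !DM D_ev DF D_phi_pow (DX G) DG rmorphM /= -/eta [phi ^+ j.+1]exprS.
  move: (G ^+ k) (G ^+ k.-1) (phi ^+ j) phi (ev r) (ev r^`()) (ev pi^`()) eta.
  move: j.+1 h => j1 x3 x4 x5 x6 x7 x8 x9 x10 x11.
  clear; ring.
apply: PwD; first apply: PwD; last 2 first.
- apply/PwN/Pw_le/P1; lia.
- case: (posnP k) => [->|k0]; first by rewrite mulr0n; apply/PwN/Pw0.
  apply/PwN/PwMn/Pw_le/P2 => //.
  by rewrite -{1}(prednK k0) !mulnS; lia.
exists (euler (Tr (G ^+ k * phi ^+ j.+1 * ev r)) - Tr (G ^+ k * phi ^+ j.+1 * ev r) *+ j.+1).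
  by apply: wtB; [apply: wt_euler | apply: wtMn]; apply: wt_Tr.
by rewrite TrhD TrhN TrhMn Trh_D Trh_h mulrBr mulrnAr.
Qed.

(** Lexicographic induction on [k] and the size of [r]: losing a factor [G] may enlarge [r] but
    lowers [k], and otherwise [r] is differentiated. *)
Let Pw_eta k j r : Pw (p * k + q * j.+1) (G ^+ k * phi ^+ j * ev r * eta).
Proof.
elim: k j r => [|k IHk] j r; have [N] := ubnP (size r).
all: elim: N j r => // N IHN j r rN; apply: Pw_step => // .
all: case: (eqVneq r 0) => [->|r0]; last by apply: IHN; have := lt_size_deriv r0; lia.
all: rewrite deriv0 rmorph0 mulr0 mul0r; exact: Pw0.
Qed.

(** By [Gnil] the powers of [G] have slope at least [1 / k1], which is positive. This supplies the
    constant term that the Euler derivation does not see. *)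
Let Tr_G_const k : (0 < k)%N -> (Tr (G ^+ k))@_0 = 0.
Proof.
move=> k0; have wGk t i l : wt k1 (k1 * t) (Mu (G ^+ (k1 * t)) i l).
  elim: t i l => [|t IH] i l; first by rewrite muln0; apply: wt0.
  rewrite mulnS exprD mulmatM //; apply: wt_mulmx => // {}i {}l.
  rewrite Gnil mulmat_sum // summxE; apply: wt_sum => j _.
  rewrite mulmatM // mulmat_scalar // -mulmxE mul_scalar_mx mxE -[X in wt _ X]addn0.
  by apply: wtM => //; apply: wt_var.
have : wt k1 k (Tr (G ^+ k)).
  apply: (@wt_trace _ _ _ _ k1) => j i l; rewrite -mulmatX // -exprM.
  apply: (@wt_le _ _ _ (k1 * (k * j %/ k1) + 0)).
    have := divn_eq (k * j) k1; have := ltn_pmod (k * j) k1_gt0.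
    rewrite [(_ %/ _ * _)%N]mulnC addn0.
    by move: (k1 * _)%N (_ %% _)%N => x y yk ->; clear -yk; lia.
  rewrite {2}(divn_eq (k * j) k1) exprD mulmatM // [(_ %/ _ * _)%N]mulnC.
  exact: wt_mulmx.
move=> wk; apply/eqP; apply: contraT => /wk; rewrite mdeg0 muln0; lia.
Qed.

(** The Euler derivative of the trace is [k] times the trace of [G ^+ k.-1 * ev pi' * eta / h], with
    [pi'] the derivative of [pi]. Here [eta] counts for weight [q] where the lost factor [G] counted
    for [p]. *)
Let wt_Tr_G k : (0 < k)%N -> wt q (p * k + (q - p)) (Tr (G ^+ k)).
Proof.
move=> k0; apply: wt_euler_inv => //; first exact: Tr_G_const.
have [x wx ex] := PwMn k (Pw_eta k.-1 0 pi^`()).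
have : delta * euler (Tr (G ^+ k)) = delta * x.
  by rewrite -Trh_D -ex DX DG expr0 mulr1 mulrA.
move/(mulfI (det_mulmat_neq0 bspan bfree h0)) ->.
apply: wt_le wx; rewrite muln1 -{1}(prednK k0) mulnS; lia.
Qed.

(** Each term of Newton's identity contains one trace and therefore the full gain [q - p]. *)
Let wt_chi_gain k : (0 < k <= m.+1)%N -> wt q (p * k + (q - p)) chi`_(m.+1 - k).
Proof.
elim/ltn_ind: k => k IH kk; have [k0 km] := andP kk.
have := Newton_char_poly (Mu G) kk; rewrite -/chi => e.
have kK : k%:R != 0 :> K by move/pcharf0P: K0 => ->; lia.
have -> : chi`_(m.+1 - k) = k%:R^-1 *: (chi`_(m.+1 - k) *+ k).
  by rewrite -[X in _ *: X]scaler_nat scalerA mulVf ?scale1r.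
rewrite e; apply/wtZ/wtN/wt_sum => j _; have jk := ltn_ord j.
rewrite -mulmatX //.
apply: (@wt_le _ _ _ (p * j + (p * (k - j) + (q - p)))).
  by rewrite addnA -mulnDr subnKC // ltnW.
apply: wtM; last by apply: wt_Tr_G; lia.
have := @wchi (m.+1 - j) ltac:(lia); rewrite subKn //; lia.
Qed.

Lemma slope_not_attained k a : (0 < k <= m.+1)%N -> k = q -> mdeg a = p ->
  chi`_(m.+1 - k)@_a = 0.
Proof.
move=> kk kq ap; apply/eqP; apply: contraT => /(wt_chi_gain kk).
rewrite ap kq; lia.
Qed.

End Slope.

(* Otherwise a coefficient of [chi] of smallest slope [p / q < 1] would
   contradict [slope_not_attained]. *)
Lemma wt_char_poly_mulmat i : (i <= m.+1)%N -> wt 1 (m.+1 - i) chi`_i.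
Proof.
pose T := ('I_m.+2 * 'X_{1..n < m.+2})%type.
pose P (x : T) := [&& (0 < x.1)%N, (mdeg x.2 < x.1)%N & chi`_(m.+1 - x.1)@_x.2 != 0].
pose M (x : T) : rat := (mdeg x.2)%:R / (x.1)%:R.
move=> im a ca; rewrite mul1n; case: leqP => // am.
have km : (m.+1 - i < m.+2)%N by lia.
have adeg : (mdeg a < m.+2)%N by lia.
pose x0 : T := (Ordinal km, BMultinom adeg).
have Px0 : P x0 by rewrite /P /= am subKn // ca; lia.
case: (Order.TotalTheory.arg_minP M Px0) => -[k [e em]] /and3P[/= k0 ek ce] Mmin.
(* With [q := k] and [p := mdeg e] read off the minimizer, minimality says that every coefficient
   has slope at least [p / q]. *)
have wk l : (l <= m.+1)%N -> wt k (mdeg e * (m.+1 - l)) chi`_l.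
  move=> lm c cl; rewrite leqNgt; apply/negP => bad.
  have lk : (mdeg c < m.+1 - l)%N.
    rewrite -(ltn_pmul2l k0) (leq_trans bad) // leq_mul2r; apply/orP; right.
    exact: ltnW.
  have lm' : (m.+1 - l < m.+2)%N by lia.
  have cm : (mdeg c < m.+2)%N by lia.
  have := Mmin (Ordinal lm', BMultinom cm); rewrite /P /= lk subKn // cl.
  move=> /(_ ltac:(lia)); rewrite /M /= leNgt => /negP; apply.
  rewrite ltr_pdivrMr ?ltr0n; last by lia.
  rewrite mulrAC ltr_pdivlMr ?ltr0n // -!natrM ltr_nat.
  by rewrite [(mdeg c * _)%N]mulnC.
have km' : (0 < k <= m.+1)%N by have := ltn_ord k; lia.
by have := slope_not_attained ek wk km' erefl erefl; move/eqP: ce.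
Qed.

End EulerIntegrality.

(** * Polynomial rings over the span of the partial derivatives *)

Lemma mnm_factor n (a : 'X_{1..n}) : a != 0%MM -> exists i b, a = (U_(i) + b)%MM.
Proof.
move=> a0; have [i ai] : exists i, a i != 0%N.
  apply: contrapT => noi; case/eqP: a0; apply/mnmP => i; rewrite mnm0E.
  by apply/eqP/negPn/negP => ai; apply: noi; exists i.
exists i, (a - U_(i))%MM; rewrite addmC submK //.
by apply/mnm_lepP => j; rewrite mnm1E; case: eqP => // <-; rewrite lt0n.
Qed.

Section TopTerm.
Context (K : fieldType) (n : nat).
Local Notation A := {mpoly K[n]}.
Implicit Types (u v : A) (be : 'X_{1..n}).

(* [msize] is the total degree plus one: [u] is [c X^be] plus terms of lower degree. *)
Definition top_term be c u := (msize (u - c *: 'X_[be]) <= mdeg be)%N.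

Lemma msizeD_leq k u v : (msize u <= k)%N -> (msize v <= k)%N -> (msize (u + v) <= k)%N.
Proof. by move=> uk vk; apply: leq_trans (msizeD_le _ _) _; rewrite geq_max uk. Qed.

Lemma msizeM_leq k l u v :
  (msize u <= k)%N -> (msize v <= l)%N -> (msize (u * v) <= (k + l).-1)%N.
Proof.
case: (eqVneq u 0) => [->|u0]; first by rewrite mul0r msize0.
case: (eqVneq v 0) => [->|v0]; first by rewrite mulr0 msize0.
by move=> uk vl; rewrite msizeM // -!subn1 leq_sub2r ?leq_add.
Qed.

Lemma top_termX be : top_term be 1 'X_[be].
Proof. by rewrite /top_term scale1r subrr msize0. Qed.

Lemma top_term_low be u : (msize u <= mdeg be)%N -> top_term be 0 u.
Proof. by rewrite /top_term scale0r subr0. Qed.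

Lemma top_termD be c c' u v :
  top_term be c u -> top_term be c' v -> top_term be (c + c') (u + v).
Proof.
move=> tu tv; rewrite /top_term scalerDl opprD addrACA; exact: msizeD_leq.
Qed.

Lemma top_termZ be c a u : top_term be c u -> top_term be (a * c) (a *: u).
Proof.
rewrite /top_term -scalerA -scalerBr; exact: leq_trans (msizeZ_le _ _).
Qed.

Lemma top_term_sum be (I : Type) (r : seq I) (P : pred I) c (F : I -> A) :
  (forall i, P i -> top_term be (c i) (F i)) ->
  top_term be (\sum_(i <- r | P i) c i) (\sum_(i <- r | P i) F i).
Proof.
move=> t; elim/big_ind2: _ => //; last by move=> ? ? ? ?; apply: top_termD.
by apply: top_term_low; rewrite msize0.
Qed.

Lemma top_term_msize be c u : top_term be c u -> (msize u <= (mdeg be).+1)%N.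
Proof.
move=> tu; rewrite -[u](subrK (c *: 'X_[be])); apply: msizeD_leq.
  exact: leq_trans tu (leqnSn _).
by apply: leq_trans (msizeZ_le _ _) _; rewrite msizeX.
Qed.

Lemma top_termM be be' c c' u v :
  top_term be c u -> top_term be' c' v -> top_term (be + be') (c * c') (u * v).
Proof.
move=> tu tv; rewrite /top_term.
have -> : u * v - (c * c') *: 'X_[be + be'] =
   (u - c *: 'X_[be]) * v + (c *: 'X_[be]) * (v - c' *: 'X_[be']).
  rewrite mpolyXD -scalerA -!mul_mpolyC.
  by move: (c%:MP) (c'%:MP) => a a'; ring.
rewrite mdegD; apply: msizeD_leq.
  by apply: leq_trans (msizeM_leq tu (top_term_msize tv)) _; rewrite addnS.
have := msizeM_leq (_ : msize (c *: 'X_[be]) <= (mdeg be).+1)%N tv; apply.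
by apply: leq_trans (msizeZ_le _ _) _; rewrite msizeX.
Qed.

Lemma top_term_prod (I : Type) (r : seq I) (be : I -> 'X_{1..n}) c (F : I -> A) :
  (forall i, top_term (be i) (c i) (F i)) ->
  top_term (\sum_(i <- r) be i)%MM (\prod_(i <- r) c i) (\prod_(i <- r) F i).
Proof.
move=> t; elim: r => [|i r IH]; first by rewrite !big_nil -mpolyX0; apply: top_termX.
by rewrite !big_cons; apply: top_termM.
Qed.

Lemma top_term_exp be c u k : top_term be c u -> top_term (be *+ k) (c ^+ k) (u ^+ k).
Proof.
move=> t; elim: k => [|k IH].
  by rewrite mulm0n !expr0 -mpolyX0; apply: top_termX.
by rewrite mulmS !exprS; apply: top_termM.
Qed.

Lemma top_term_coef be c u be' : top_term be c u -> (mdeg be <= mdeg be')%N ->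
  u@_be' = c *+ (be == be').
Proof.
move=> tu le; rewrite -[u](subrK (c *: 'X_[be])) mcoeffD mcoeffZ mcoeffX.
rewrite memN_msupp_eq0 ?add0r ?mulr_natr //.
by apply: msize_mdeg_ge; apply: leq_trans le.
Qed.

(** The coefficients vanish in decreasing order of degree: to the coefficient of the leading
    monomial of [v j], another [v i] contributes only if its leading degree is larger. *)
Lemma top_term_free (J : finType) (be : J -> 'X_{1..n}) (v : J -> A) c :
  injective be -> (forall j, top_term (be j) 1 (v j)) ->
  \sum_j c j *: v j = 0 -> forall j, c j = 0.
Proof.
move=> be_inj tv s0 j; pose B := (\max_j mdeg (be j))%N.
have jB i : (mdeg (be i) <= B)%N by apply: leq_bigmax.
have [N] := ubnP (B - mdeg (be j)); elim: N j => // N IH j jN.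
have := congr1 (mcoeff (be j)) s0.
rewrite mcoeff0 raddf_sum (bigD1 j) //= mcoeffZ (top_term_coef (tv j)) // eqxx mulr1.
rewrite big1 ?addr0 // => i ij; rewrite mcoeffZ.
case: (leqP (mdeg (be i)) (mdeg (be j))) => ij'.
  by rewrite (top_term_coef (tv i)) // inj_eq // (negPf ij) mulr0.
by rewrite IH ?mul0r //; have := jB i; lia.
Qed.

End TopTerm.

Section IdealClosure.
Context (A : comNzRingType).
Implicit Types (T : A -> Prop).

Definition is_ideal T :=
  [/\ T 0, forall u v, T u -> T v -> T (u + v) & forall a u, T u -> T (a * u)].

Lemma ideal_genP (I : finType) (g : I -> A) : is_ideal (ideal_gen g).
Proof.
split.
- by exists (fun=> 0); rewrite big1 // => i _; rewrite mul0r.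
- move=> _ _ [a ->] [b ->]; exists (fun i => a i + b i).
  by rewrite -big_split; apply: eq_bigr => i _; rewrite mulrDl.
- move=> c _ [a ->]; exists (fun i => c * a i).
  by rewrite mulr_sumr; apply: eq_bigr => i _; rewrite mulrA.
Qed.

Lemma ideal_sum T (I : Type) (r : seq I) (P : pred I) (F : I -> A) : is_ideal T ->
  (forall i, P i -> T (F i)) -> T (\sum_(i <- r | P i) F i).
Proof. by case=> T0 TD _ TF; apply: big_ind. Qed.

Lemma ideal_gen_sub T (I : finType) (g : I -> A) : is_ideal T ->
  (forall i, T (g i)) -> forall u, ideal_gen g u -> T u.
Proof.
by move=> iT Tg _ [a ->]; apply: ideal_sum => // i _; case: iT => _ _; apply.
Qed.

Lemma ideal_gen_mem (I : finType) (g : I -> A) i : ideal_gen g (g i).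
Proof.
exists (fun j => (j == i)%:R); rewrite (bigD1 i) //= eqxx mul1r big1 ?addr0 //.
by move=> j /negPf ->; rewrite mul0r.
Qed.

Lemma idealN T u : is_ideal T -> T u -> T (- u).
Proof. by case=> _ _ TM Tu; rewrite -mulN1r; apply: TM. Qed.

Lemma idealB T u v : is_ideal T -> T u -> T v -> T (u - v).
Proof. by move=> iT Tu /(idealN iT); case: iT => _ TD _; apply: TD. Qed.

End IdealClosure.

Lemma ideal_subspace (K : fieldType) (A : comAlgType K) (T : A -> Prop) :
  is_ideal T -> subspace T.
Proof.
case=> T0 TD TM; split=> // a u v Tu Tv; apply: TD => //.
by rewrite -[u]mul1r scalerAl; apply: TM.
Qed.

Section FreeOverSubalgebra.
Context (K : fieldType) (n d : nat).
Local Notation A := {mpoly K[n]}.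
Context (y : 'I_n -> A).
Hypothesis d0 : (0 < d)%N.
Hypothesis ytop : forall j, top_term (U_(j) *+ d)%MM 1 (y j).

Definition subst : A -> A := mmap (@mpolyC n K) y.
HB.instance Definition _ := GRing.RMorphism.copy subst (mmap (@mpolyC n K) y).

Lemma substX a : subst 'X_[a] = mmap1 y a.
Proof. exact: mmapX. Qed.

Lemma substU j : subst 'X_j = y j.
Proof. by rewrite substX mmap1U. Qed.

Lemma substC c : subst c%:MP = c%:MP.
Proof. exact: mmapC. Qed.

Lemma substZ c s : subst (c *: s) = c *: subst s.
Proof. by rewrite -!mul_mpolyC rmorphM /= substC. Qed.

Lemma mmap1M (a a' : 'X_{1..n}) : mmap1 y (a + a') = mmap1 y a * mmap1 y a'.
Proof. by rewrite -!substX mpolyXD rmorphM. Qed.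

Lemma mmap1_top a : top_term (a *+ d)%MM 1 (mmap1 y a).
Proof.
rewrite /mmap1.
have -> : (a *+ d)%MM = (\sum_(i < n) (U_(i) *+ d) *+ a i)%MM.
  apply/mnmP => i; rewrite mulmnE mnm_sumE (bigD1 i) //= !mulmnE mnm1E eqxx mul1n.
  rewrite big1 ?addn0 1?mulnC // => j /negPf ji.
  by rewrite !mulmnE mnm1E ji.
have -> : 1 = \prod_(i < n) (1 : K) ^+ a i.
  by rewrite big1 // => i _; rewrite expr1n.
by apply: top_term_prod => i; apply: top_term_exp.
Qed.

Definition exps N (g : {ffun 'I_n -> 'I_N}) : 'X_{1..n} := [multinom (g i : nat) | i < n].

Lemma expsE N (g : {ffun 'I_n -> 'I_N}) i : exps g i = g i.
Proof. by rewrite mnmE. Qed.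

Lemma exps_inj N : injective (@exps N).
Proof.
move=> g g' /mnmP e; apply/ffunP => i; apply: val_inj.
by have := e i; rewrite !mnmE.
Qed.

Lemma exps_onto N (a : 'X_{1..n}) : (forall i, (a i < N)%N) ->
  exists g : {ffun 'I_n -> 'I_N}, exps g = a.
Proof.
move=> aN; exists [ffun i => Ordinal (aN i)].
by apply/mnmP => i; rewrite expsE ffunE.
Qed.

Lemma divmod_monom (a : 'X_{1..n}) : exists (g : {ffun 'I_n -> 'I_d}) a',
  a = (a' *+ d + exps g)%MM.
Proof.
have [i|g gE] := @exps_onto d [multinom (a i %% d)%N | i < n]; first by rewrite mnmE ltn_pmod.
exists g, [multinom (a i %/ d)%N | i < n]; apply/mnmP => i.
by rewrite mnmDE mulmnE gE !mnmE -divn_eq.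
Qed.

Lemma divmod_monom_inj (g g' : {ffun 'I_n -> 'I_d}) a a' :
  (a *+ d + exps g = a' *+ d + exps g')%MM -> g = g' /\ a = a'.
Proof.
move=> /mnmP e; suff H i : a i = a' i /\ g i = g' i.
  by split; [apply/ffunP => i; case: (H i) | apply/mnmP => i; case: (H i)].
have := e i; rewrite !mnmDE !mulmnE !expsE => ei.
split; last apply: val_inj.
  by have := congr1 (divn^~ d) ei; rewrite !divnMDl // !divn_small ?ltn_ord // !addn0.
by have := congr1 (modn^~ d) ei; rewrite /= !modnMDl !modn_small ?ltn_ord.
Qed.

(** By Euclidean division of exponents by [d], the leading monomials of these products run through
    every monomial exactly once. *)
Definition ybasis (x : {ffun 'I_n -> 'I_d} * 'X_{1..n}) : A :=
  mmap1 y x.2 * 'X_[exps x.1].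

Lemma ybasis_top x : top_term (x.2 *+ d + exps x.1)%MM 1 (ybasis x).
Proof.
by rewrite -[1]mulr1; apply: top_termM; [apply: mmap1_top | apply: top_termX].
Qed.

(** Subtracting from [X^a] the member of [ybasis] with the same leading monomial leaves terms of
    lower degree. *)
Lemma subst_span u : exists c : {ffun 'I_n -> 'I_d} -> A,
  u = \sum_g subst (c g) * 'X_[exps g].
Proof.
pose T u := exists c : {ffun 'I_n -> 'I_d} -> A, u = \sum_g subst (c g) * 'X_[exps g].
have T0 : T 0 by exists (fun=> 0); rewrite big1 // => g _; rewrite rmorph0 mul0r.
have TD u1 u2 : T u1 -> T u2 -> T (u1 + u2).
  case=> c1 -> [c2 ->]; exists (fun g => c1 g + c2 g); rewrite -big_split.
  by apply: eq_bigr => g _; rewrite rmorphD mulrDl.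
have TZ a u1 : T u1 -> T (a *: u1).
  case=> c1 ->; exists (fun g => a *: c1 g); rewrite scaler_sumr.
  by apply: eq_bigr => g _; rewrite substZ scalerAl.
have TX a : T 'X_[a].
  have [N] := ubnP (mdeg a); elim: N a => // N IH a aN.
  have [g [a' aE]] := divmod_monom a.
  rewrite -['X_[a]](subKr (ybasis (g, a'))); apply: (TD).
    exists (fun g' => if g' == g then 'X_[a'] else 0).
    rewrite (bigD1 g) //= eqxx big1 ?addr0 ?substX // => g' /negPf ->.
    by rewrite rmorph0 mul0r.
  have := ybasis_top (g, a'); rewrite /top_term /= -aE scale1r => low.
  rewrite -scaleN1r; apply: (TZ); rewrite [_ - _]mpolyE big_seq.
  apply: (big_ind T T0 TD) => b bs; apply/TZ/IH.
  exact: leq_trans (leq_trans (msize_mdeg_lt bs) low) _.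
by rewrite -/(T u) [u]mpolyE; apply: (big_ind T T0 TD) => a _; apply/TZ/TX.
Qed.

Lemma subst_free (c : {ffun 'I_n -> 'I_d} -> A) :
  \sum_g subst (c g) * 'X_[exps g] = 0 -> forall g, c g = 0.
Proof.
move=> c0 g; apply/mpolyP => a; rewrite mcoeff0.
pose B := ((\max_g msize (c g)) + mdeg a).+1.
have cB h : (msize (c h) <= B)%N.
  by apply: leqW; apply: leq_trans (leq_addr _ _); apply: leq_bigmax.
pose J : finType := ({ffun 'I_n -> 'I_d} * 'X_{1..n < B})%type.
have aB : (mdeg a < B)%N by rewrite ltnS leq_addl.
have := @top_term_free K n J (fun j => (j.2 *+ d + exps j.1)%MM)
  (fun j => ybasis (j.1, bmnm j.2)) (fun j => (c j.1)@_(j.2)).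
move=> H; apply: (H _ _ _ (g, BMultinom aB)).
- move=> [g1 a1] [g2 a2] e; have [/= -> ea] := divmod_monom_inj e.
  by congr pair; apply: val_inj.
- by move=> j; apply: ybasis_top.
rewrite -[RHS]c0 -(pair_bigA _ (fun g (b : 'X_{1..n < B}) => (c g)@_b *: ybasis (g, bmnm b))) /=.
apply: eq_bigr => h _; rewrite /subst (mmapE B) // mulr_suml; apply: eq_bigr => b _.
by rewrite -mul_mpolyC mulrA.
Qed.

Lemma subst_const s : ideal_gen y (subst s - (s@_0)%:MP).
Proof.
have iy := ideal_genP y; have [_ yD yM] := iy.
pose T s := ideal_gen y (subst s - (s@_0)%:MP).
suff : T s by [].
have TZ c a : T (c *: 'X_[a]).
  rewrite /T substZ mcoeffZ mpolyCM mul_mpolyC -scalerBr -mul_mpolyC; apply: (yM).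
  rewrite substX mcoeffX; case: (eqVneq a 0%MM) => [->|a0].
    by rewrite mmap11 subrr; case: iy.
  have [i [b ->]] := mnm_factor a0.
  by rewrite subr0 mmap1M mmap1U mulrC; apply/yM/ideal_gen_mem.
rewrite [s]mpolyE; elim: (msupp s) => [|a r IH].
  by rewrite big_nil /T mcoeff0 rmorph0 mpolyC0 subrr; case: iy.
rewrite big_cons /T rmorphD mcoeffD raddfD opprD addrACA; apply: yD => //; apply: TZ.
Qed.

Lemma ybasis_span :
  spans_mod (fun=> True) (ideal_gen y) (fun g : {ffun 'I_n -> 'I_d} => 'X_[exps g]).
Proof.
move=> u _; have [c ->] := subst_span u; exists (fun g => (c g)@_0).
rewrite -sumrB; apply: ideal_sum => [|g _]; first exact: ideal_genP.
rewrite -mul_mpolyC -mulrBl mulrC; have [_ _] := ideal_genP y; apply.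
exact: subst_const.
Qed.

(** After the cofactors of the [y i ^+ N] are expanded over the basis, freeness turns a relation
    into an identity between polynomials in the variables that stand for [y], where no monomial of
    the box is divisible by some [X_i^N]. *)
Lemma ybasis_free_mod N :
  free_mod (ideal_gen (fun i => y i ^+ N))
    (fun p : {ffun 'I_n -> 'I_d} * {ffun 'I_n -> 'I_N} => ybasis (p.1, exps p.2)).
Proof.
move=> c [u /esym e] [g a].
have [s sE] := exists_fun (fun i => subst_span (u i)).
pose t g := (\sum_(a : {ffun 'I_n -> 'I_N}) c (g, a) *: 'X_[exps a])
              - \sum_i 'X_i ^+ N * s i g.
have /subst_free/(_ g)/(congr1 (mcoeff (exps a))) : \sum_g subst (t g) * 'X_[exps g] = 0.
  under eq_bigr do rewrite /t rmorphB mulrBl !rmorph_sum /= !mulr_suml.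
  rewrite sumrB; apply/eqP; rewrite subr_eq0; apply/eqP.
  transitivity (\sum_p c p *: ybasis (p.1, exps p.2)).
    rewrite pair_bigA; apply: eq_bigr => -[h b] _ /=.
    by rewrite substZ substX /ybasis scalerAl.
  rewrite -e exchange_big /=; apply: eq_bigr => i _.
  rewrite sE mulr_suml; apply: eq_bigr => h _.
  by rewrite rmorphM rmorphXn /= substU; ring.
rewrite mcoeff0 /t mcoeffB !raddf_sum /= (bigD1 a) //= mcoeffZ mcoeffX eqxx mulr1.
rewrite [X in _ + X + _]big1 ?addr0; last first.
  move=> b /negPf ba; rewrite mcoeffZ mcoeffX (inj_eq (@exps_inj N)) ba.
  by rewrite mulr0.
rewrite big1 ?addr0 // => i _; rewrite -[RHS]oppr0; congr (- _).
apply/eqP; rewrite mcoeff_eq0; apply/negP => /msuppM_le/allpairsP[[b b'] /= [bs _ /mnmP/(_ i)]].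
move: bs; rewrite mpolyXn msuppX inE => /eqP ->.
rewrite mnmDE mulmnE mnm1E eqxx mul1n expsE => ai; have := ltn_ord (a i).
by rewrite ai; lia.
Qed.

End FreeOverSubalgebra.

(** The powers of [x] are dependent in a finite-dimensional quotient. The largest power of the
    variable is split off the relation, so that the other factor is a unit wherever [x] vanishes. *)
Lemma exists_power_relation (K : fieldType) n (W : {mpoly K[n]} -> Prop) (J : finType)
    (e : J -> {mpoly K[n]}) (x : {mpoly K[n]}) :
  is_ideal W -> spans_mod (fun=> True) W e ->
  exists (q : {poly K}) k, q`_0 != 0 /\ W (x ^+ k * (map_poly (@mpolyC n K) q).[x]).
Proof.
move=> iW spe; pose M := #|J|.
have nf : ~ free_mod W (fun i : 'I_M.+1 => x ^+ i).
  move=> fr; have := free_le_spans (ideal_subspace iW) spe fr.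
  by rewrite card_ord ltnn.
have [c [cy [i0 ci0]]] : exists c : 'I_M.+1 -> K,
    W (\sum_i c i *: x ^+ i) /\ exists i, c i != 0.
  apply: contrapT => no; apply: nf => c cy i; apply: contrapT => /eqP ci.
  by apply: no; exists c; split=> //; exists i.
pose r : {poly K} := \poly_(i < M.+1) c (inord i).
have r0 : exists i, r`_i != 0.
  by exists i0; rewrite coef_poly ltn_ord inord_val.
have := ex_minnP r0 => -[k rk kmin].
exists (Poly (drop k r)), k; split; first by rewrite coef_Poly nth_drop addn0.
have rE : r = Poly (drop k r) * 'X^k.
  apply/polyP => i; rewrite coefMXn; case: ltnP => ik.
    by apply/eqP; apply: contraTT ik => /kmin; rewrite -leqNgt.
  by rewrite coef_Poly nth_drop subnKC.
have -> : x ^+ k * (map_poly (@mpolyC n K) (Poly (drop k r))).[x] = (map_poly (@mpolyC n K) r).[x].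
  by rewrite rE rmorphM /= map_polyXn hornerM hornerXn mulrC -rE.
rewrite (horner_coef_wide _ (leq_trans (size_poly _ _) (size_poly _ _))).
rewrite (eq_bigr (fun i : 'I_M.+1 => c i *: x ^+ i)) // => i _.
by rewrite coef_map coef_poly ltn_ord inord_val /= mul_mpolyC.
Qed.

(** * The Euler derivation and the integral equation for a gradient *)

Section Gradient.
Context (K : fieldType) (n d : nat).
Hypothesis K0 : [pchar K] =i pred0.
Local Notation A := {mpoly K[n]}.
Context (F : A).
Let y (j : 'I_n) : A := F^`M(j).
Hypothesis d0 : (0 < d)%N.
Hypothesis ytop : forall j, top_term (U_(j) *+ d)%MM 1 (y j).

Lemma natK_neq0 k : k.+1%:R != 0 :> K.
Proof. by move/pcharf0P: K0 => ->. Qed.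

Let H : 'M[A]_n := \matrix_(i, j) (y j)^`M(i).
Let h := \det H.

Lemma msize_mderiv (u : A) i k : (msize u <= k.+1)%N -> (msize u^`M(i) <= k)%N.
Proof.
move=> uk; rewrite msizeE; apply/bigmax_leqP_seq => a.
rewrite mcoeff_msupp mcoeff_deriv => ua _.
have : (a + U_(i))%MM \in msupp u.
  by rewrite mcoeff_msupp; apply: contra ua => /eqP ->; rewrite mul0rn.
by move/msize_mdeg_lt; rewrite mdegD mdeg1 addn1 => /leq_trans /(_ uk).
Qed.

(** The leading part of the Hessian matrix is diagonal with entries [d x_i^(d-1)], and [d] is
    invertible in characteristic zero. *)
Lemma det_Hessian_neq0 : h != 0.
Proof.
pose e := d.-1.
have Htop i j : top_term (U_(i) *+ e)%MM (d%:R *+ (i == j)) (H i j).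
  rewrite mxE -[y j](subrK (1 *: 'X_[(U_(j) *+ d)%MM])) mderivD scale1r.
  rewrite -[X in top_term _ X]add0r; apply: top_termD.
    apply: top_term_low; rewrite mdegMn mdeg1 mul1n; apply: msize_mderiv.
    by have := ytop j; rewrite /top_term scale1r mdegMn mdeg1 mul1n prednK.
  rewrite mderivX mulmnE mnm1E; case: eqP => [ij|/eqP/negPf ij]; last first.
    rewrite eq_sym ij mul0n scale0r mulr0n.
    by apply: top_term_low; rewrite msize0.
  rewrite -ij eqxx mul1n mulr1n -[X in top_term _ X]mulr1; apply: top_termZ.
  have -> : (U_(i) *+ d - U_(i) = U_(i) *+ e)%MM.
    by apply/mnmP => k; rewrite mnmBE !mulmnE mnm1E /e; case: (i == k); lia.
  by apply: top_termX.
have dtop : top_term (\sum_(i < n) U_(i) *+ e)%MM (\det (\matrix_(i, j) (d%:R *+ (i == j)) : 'M[K]_n)) h.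
  apply: top_term_sum => s _.
  have tp : top_term (\sum_(i < n) U_(i) *+ e)%MM
      (\prod_i (\matrix_(i, j) (d%:R *+ (i == j)) : 'M[K]_n) i (s i)) (\prod_i H i (s i)).
    by apply: top_term_prod => i; rewrite mxE.
  case: (odd_perm s); rewrite ?expr1 ?expr0 ?mul1r //.
  by rewrite !mulN1r -[- (\prod_i H _ _)]scaleN1r -mulN1r; apply: top_termZ.
have := top_term_coef dtop (leqnn _); rewrite eqxx mulr1n.
rewrite (_ : \matrix_(i, j) _ = d%:R%:M) ?det_scalar; last first.
  by apply/matrixP => i j; rewrite !mxE.
move=> hc; apply/eqP => h0; move/eqP: hc; rewrite h0 mcoeff0 eq_sym expf_eq0.
by rewrite -(prednK d0) (negPf (natK_neq0 _)) andbF.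
Qed.

(** Cramer's rule: this vector field multiplies every [y j] by [h], so it is the extension of the
    Euler derivation of [K[y]], cleared of its denominator [h]. *)
Let D (u : A) : A := \sum_i (\sum_l y l * (\adj H) l i) * u^`M(i).

Let DD u v : D (u + v) = D u + D v.
Proof. by rewrite /D -big_split; apply: eq_bigr => i _; rewrite mderivD mulrDr. Qed.

Let DM u v : D (u * v) = D u * v + u * D v.
Proof.
rewrite /D mulr_suml mulr_sumr -big_split; apply: eq_bigr => i _ /=.
rewrite mderivM; move: (\sum_l _) => c; ring.
Qed.

Let Dy j : D (y j) = h * y j.
Proof.
rewrite /D; under eq_bigr do rewrite mulr_suml.
rewrite exchange_big /=.
transitivity (\sum_l y l * (\adj H *m H) l j).
  by apply: eq_bigr => l _; rewrite mxE mulr_sumr; apply: eq_bigr => i _; rewrite [H i j]mxE mulrA.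
rewrite mul_adj_mx (bigD1 j) //= big1 ?addr0 => [|l /negPf lj].
  by rewrite mxE eqxx mulr1n mulrC.
by rewrite mxE lj mulr0n mulr0.
Qed.

Let Dsg s : D (subst y s) = h * subst y (euler s).
Proof.
have TX a : D (subst y 'X_[a]) = h * subst y (euler 'X_[a]).
  have D1 : D 1 = 0.
    by rewrite /D big1 // => i _; rewrite -mpolyC1 mderivC mulr0.
  have eul1 : euler (1 : A) = 0.
    by rewrite /euler big1 // => i _; rewrite -mpolyC1 mderivC mulr0.
  have [N] := ubnP (mdeg a); elim: N a => // N IH a aN.
  case: (eqVneq a 0%MM) => [->|a0]; first by rewrite mpolyX0 rmorph1 D1 eul1 rmorph0 mulr0.
  have [i [a' aE]] := mnm_factor a0.
  rewrite aE mpolyXD rmorphM DM eulerM /= substU Dy IH; last first.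
    by move: aN; rewrite {1}aE mdegD mdeg1 add1n ltnS.
  rewrite rmorphD !rmorphM /= substU.
  have -> : euler 'X_i = 'X_i :> A.
    by apply/mpolyP => b; rewrite mcoeff_euler mcoeffX; case: eqP => [<-|]; rewrite ?mdeg1 ?mul0rn.
  by rewrite substU; move: (subst y _) (subst y _) => s1 s2; ring.
have D0 : D 0 = 0 by apply: (addrI (D 0)); rewrite -DD !addr0.
rewrite [s]mpolyE; elim: (msupp s) => [|a r IH].
  by rewrite big_nil rmorph0 D0 linear0 rmorph0 mulr0.
rewrite big_cons rmorphD DD IH linearD rmorphD mulrDr; congr (_ + _).
rewrite linearZ /= !substZ -scalerAr -TX /D [RHS]scaler_sumr; apply: eq_bigr => i _.
by rewrite mderivZ scalerAr.
Qed.

Let DF : D F = D (\sum_j subst y 'X_j * 'X_j) - h * (\sum_j subst y 'X_j * 'X_j).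
Proof.
have D0 : D 0 = 0 by apply: (addrI (D 0)); rewrite -DD !addr0.
rewrite (big_morph D DD D0) mulr_sumr -sumrB; apply: eq_bigr => j _.
rewrite substU DM Dy.
have -> : D 'X_j = \sum_l y l * (\adj H) l j.
  rewrite /D (bigD1 j) //= mderivX mnm1E eqxx scale1r.
  rewrite (_ : (U_(j) - U_(j))%MM = 0%MM); last by apply/mnmP => k; rewrite mnmBE subnn mnm0E.
  rewrite mpolyX0 mulr1 [X in _ + X]big1 ?addr0 // => i /negPf ij.
  by rewrite mderivX mnm1E eq_sym ij scale0r mulr0.
by rewrite -/(y j); move: (\sum_l _) (y j) => s1 s2; ring.
Qed.

(* Only the critical points where [F] vanishes matter: the factor [q] removes
   the nonzero critical values. *)
Lemma exists_nilpotent_multiple : exists (q : {poly K}) (k : nat), q`_0 != 0 /\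
  ideal_gen y ((F * (map_poly (@mpolyC n K) q).[F]) ^+ k.+1).
Proof.
have iy := ideal_genP y; have [_ _ yM] := iy.
have [q [k [q0 yF]]] := exists_power_relation F iy (ybasis_span d0 ytop).
exists q, k; split=> //; rewrite exprMn exprSr exprS.
move: yF; set Q := (map_poly _ _).[F] => yF.
have -> : F ^+ k * F * (Q * Q ^+ k) = F * Q ^+ k * (F ^+ k * Q) by ring.
exact: yM.
Qed.

(** [wt 1 r s] places [subst y s] in the [r]-th power of the ideal [(y)], so this is an equation of
    integral dependence over that ideal. It concerns [G] because [F] may be nonzero at critical
    points away from the origin. *)
Theorem gradient_integral : exists (q : {poly K}) (m : nat) (chi : nat -> A),
  let G := F * (map_poly (@mpolyC n K) q).[F] in
  [/\ q`_0 != 0, chi m.+1 = 1, forall i, (i <= m.+1)%N -> wt 1 (m.+1 - i) (chi i)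
    & \sum_(i < m.+2) subst y (chi i) * G ^+ i = 0].
Proof.
have [q [k [q0 [u1 Gk]]]] := exists_nilpotent_multiple.
pose T : finType := {ffun 'I_n -> 'I_d}.
have [m mE] : exists m, #|T| = m.+1.
  exists #|T|.-1; rewrite prednK // card_ffun !card_ord expn_gt0 d0 //.
pose f (i : 'I_m.+1) : T := enum_val (cast_ord (esym mE) i).
have fbij : bijective f.
  exists (fun t => cast_ord mE (enum_rank t)) => x; rewrite /f.
    by rewrite enum_valK cast_ordKV.
  by rewrite cast_ordK enum_rankK.
have [f' fK f'K] := fbij.
pose b i : A := 'X_[exps (f i)].
have bspan u : exists c : 'I_m.+1 -> A, u = \sum_i subst y (c i) * b i.
  have [c cE] := subst_span d0 ytop u; exists (c \o f).
  by rewrite cE (reindex f) //; apply: onW_bij.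
have bfree (c : 'I_m.+1 -> A) : \sum_i subst y (c i) * b i = 0 -> forall i, c i = 0.
  move=> c0 i; rewrite -(fK i); apply: (subst_free d0 ytop (c := c \o f')).
  rewrite -[RHS]c0 (reindex f) /=; last exact: onW_bij.
  by apply: eq_bigr => j _; rewrite fK.
pose pi : {poly K} := 'X * q.
pose G := ev (subst y) F pi.
have GE : G = F * (map_poly (@mpolyC n K) q).[F].
  rewrite /G rmorphM /= /ev /horner_eval /= map_polyX hornerX; congr (_ * _.[_]).
  by apply: eq_map_poly => c /=; rewrite substC.
have Gnil : G ^+ k.+1 = \sum_j subst y 'X_j * u1 j.
  by rewrite GE Gk; apply: eq_bigr => j _; rewrite substU mulrC.
exists q, m, (fun i => (char_poly (mulmat bspan G))`_i); split=> //.
- have := char_poly_monic (mulmat bspan G); rewrite monicE lead_coefE.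
  by rewrite size_char_poly => /eqP.
- move=> i im; apply: (wt_char_poly_mulmat K0 bfree det_Hessian_neq0 DD DM Dsg DF _ Gnil) => //.
by rewrite -GE; apply: char_poly_mulmat.
Qed.

End Gradient.

(** * Reduction modulo large primes and the Frobenius map *)

(** The image of [phi] is a subring of [K], and a [psi] that kills the kernel of [phi] is a point of
    this subring in characteristic [p]. Such points are required off any given nonzero element, for
    all large [p]. Presenting the subring by [B] lets elements be adjoined through [{poly B}]. *)
Definition specializable (B : comNzRingType) (K : fieldType) (phi : {rmorphism B -> K}) :=
  forall b, phi b != 0 -> exists N0, forall p, prime p -> (N0 < p)%N ->
  forall k : closedFieldType, p \in [pchar k] ->
  exists psi : {rmorphism B -> k}, psi b != 0 /\ forall x, phi x = 0 -> psi x = 0.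

Lemma specializable_int (K : fieldType) : [pchar K] =i pred0 ->
  specializable (@intmul K 1 : {rmorphism int -> K}).
Proof.
move=> /pcharf0P K0 b b0; exists `|b|%N => p pp bp k pk.
exists (@intmul k 1 : {rmorphism int -> k}).
have bn0 : b != 0 by apply: contraNneq b0 => ->.
split.
  rewrite /= [b]intEsign rmorphM /= rmorphXn rmorphN1.
  rewrite mulf_neq0 ?signr_eq0 // -pmulrn -(dvdn_pcharf pk) gtnNdvd //.
  by rewrite absz_gt0.
move=> x /= /eqP; rewrite [x]intEsign rmorphM /= rmorphXn rmorphN1 mulf_eq0 signr_eq0 /=.
by rewrite -pmulrn K0 => /eqP ->; rewrite mulr0.
Qed.

Section PseudoDivision.
Context (B : comNzRingType).

Lemma pseudo_division (q0 : {poly B}) d : (size q0 <= d.+1)%N ->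
  forall q, exists s h r, q0`_d ^+ s *: q = h * q0 + r /\ (size r <= d)%N.
Proof.
move=> sq0 q; have [N] := ubnP (size q); elim: N q => // N IH q qN.
case: (leqP (size q) d) => [qd|dq].
  by exists 0%N, 0, q; rewrite expr0 scale1r mul0r add0r.
set e := (size q).-1; have eE : size q = e.+1 by rewrite /e prednK // (leq_ltn_trans _ dq).
have de : (d <= e)%N by rewrite -ltnS -eE.
pose q' := q0`_d *: q - (q`_e *: 'X^(e - d)) * q0.
have q'e : (size q' <= e)%N.
  apply/leq_sizeP => j ej; rewrite coefB coefZ -scalerAl coefZ coefXnM.
  rewrite ltnNge (leq_trans (leq_subr _ _) ej) /=.
  case: (ltnP e j) => [ltej|jle].
    have -> : q0`_(j - (e - d)) = 0.
      by rewrite nth_default //; apply: leq_trans sq0 _; clear -de ltej; lia.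
    have qj : q`_j = 0 by apply: nth_default; rewrite eE.
    by rewrite qj !mulr0 subr0.
  have -> : j = e by apply/eqP; rewrite eqn_leq jle.
  by rewrite subKn // mulrC subrr.
have [|s [h [r [e' rd]]]] := IH q'; first by rewrite (leq_ltn_trans q'e) // -eE.
exists s.+1, (h + q0`_d ^+ s *: (q`_e *: 'X^(e - d))), r; split=> //.
rewrite mulrDl addrAC -e' /q' scalerBr exprSr -scalerA -[in X in _ + X]scalerAl.
by rewrite subrK.
Qed.

End PseudoDivision.

Section SpecializePoly.
Context (B : comNzRingType) (K : fieldType) (phi : {rmorphism B -> K}) (c : K).

Definition poly_eval : {poly B} -> K := horner_eval c \o map_poly phi.
HB.instance Definition _ := GRing.RMorphism.copy poly_eval (horner_eval c \o map_poly phi).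

Local Notation mphi := (map_poly phi).

Lemma poly_evalE q : poly_eval q = (mphi q).[c]. Proof. by []. Qed.

Let ker_coef q (k : fieldType) (psi : {rmorphism B -> k}) :
  (forall x, phi x = 0 -> psi x = 0) -> mphi q = 0 -> map_poly psi q = 0.
Proof.
move=> ker q0; apply/polyP => i; rewrite coef_map coef0; apply: ker.
by have := congr1 (coefp i) q0; rewrite /= coef_map coef0.
Qed.

(** No relation constrains the image of [c], so any non-root of the reduction of [a] serves,
    provided one coefficient of [a] survives. *)
Lemma specializable_transcendental : specializable phi ->
  (forall q, poly_eval q = 0 -> mphi q = 0) -> specializable poly_eval.
Proof.
move=> sp tr a a0; have {}a0 : (mphi a).[c] != 0 := a0.
have : mphi a != 0.
  by apply: contraNneq a0 => e; rewrite e horner0.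
move=> /eqP/polyP a1; have [i ai] : exists i, phi a`_i != 0.
  apply: contrapT => no; apply: a1 => i; rewrite coef_map coef0 /=; apply: contrapT => /eqP ai.
  by apply: no; exists i.
have [N0 H] := sp _ ai; exists N0 => p pp Np k pk.
have [psi [psi_i ker]] := H p pp Np k pk.
have psia : map_poly psi a != 0.
  apply: contraNneq psi_i => /(congr1 (coefp i)).
  by rewrite /= coef_map coef0 /= => ->.
have /closed_nonrootP[c' c'P] := psia.
exists (horner_eval c' \o map_poly psi); split=> // x /tr x0 /=.
by rewrite (ker_coef ker x0) horner_evalE horner0.
Qed.

(** The image [c'] is a root of the reduction of an equation [q0] of [c] of minimal degree. If the
    leading coefficient of [q0] survives, pseudo-division shows that what vanishes at [c] vanishes
    at [c']. Since [a] is nonzero at [c], a Bezout identity gives a constant in the ideal of [q0]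
    and [a]; if it survives too, the reduction of [a] is nonzero at [c']. *)
Lemma specializable_algebraic : specializable phi ->
  (exists2 q, poly_eval q = 0 & mphi q != 0) -> specializable poly_eval.
Proof.
move=> sp alg a a0; have {}a0 : (mphi a).[c] != 0 := a0.
pose P s := `[< exists q, [/\ poly_eval q = 0, mphi q != 0 & size (mphi q) = s] >].
have exP : exists s, P s.
  by have [q qc q0] := alg; exists (size (mphi q)); apply/asboolP; exists q.
have := ex_minnP exP => -[s /asboolP[q1 [q1c q10 q1s]] smin] {exP alg}.
pose d := s.-1; have sE : s = d.+1 by rewrite prednK // -q1s size_poly_gt0.
have mind q : poly_eval q = 0 -> (size (mphi q) <= d)%N -> mphi q = 0.
  move=> qc qd; apply: contrapT => /eqP q0.
  have /smin : P (size (mphi q)) by apply/asboolP; exists q.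
  by rewrite sE ltnNge qd.
(* Coefficients of [q1] above [d] lie in the kernel of [phi]; they are cut off to give
   pseudo-division a polynomial of size at most [d.+1]. *)
pose q0 := take_poly d.+1 q1.
have mq0 : mphi q0 = mphi q1.
  apply/polyP => i; rewrite !coef_map coef_take_poly; case: ltnP => // di.
  by rewrite raddf0 -coef_map nth_default // q1s sE.
have sq0 : (size q0 <= d.+1)%N by apply: size_take_poly.
have q0c : poly_eval q0 = 0 by rewrite poly_evalE mq0.
have b00 : phi q0`_d != 0.
  by rewrite -coef_map mq0 (_ : d = (size (mphi q1)).-1) ?lead_coef_eq0 // q1s sE.
have d_gt0 : (0 < d)%N.
  rewrite lt0n; apply: contra_eq_neq q1c => d0; rewrite poly_evalE.
  have /size_poly1P[x x0 ->] : size (mphi q1) == 1%N by rewrite q1s sE d0.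
  by rewrite hornerC.
(* [r] generates, up to the kernel of [phi], the ideal [(q0, a)]: it is a nonzero constant. *)
pose Q t := `[< exists u v, mphi (u * q0 + v * a) != 0 /\ size (mphi (u * q0 + v * a)) = t >].
have exQ : exists t, Q t.
  by exists (size (mphi q0)); apply/asboolP; exists 1, 0; rewrite mul1r mul0r addr0 mq0.
have := ex_minnP exQ => -[t /asboolP[u [v [r0 rt]]] tmin] {exQ}.
set r := u * q0 + v * a in r0 rt.
pose e := t.-1; have tE : t = e.+1 by rewrite prednK // -rt size_poly_gt0.
pose r' := take_poly e.+1 r.
have mr' : mphi r' = mphi r.
  apply/polyP => i; rewrite !coef_map coef_take_poly; case: ltnP => // di.
  by rewrite raddf0 -coef_map nth_default // rt tE.
have sr' : (size r' <= e.+1)%N by apply: size_take_poly.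
have div q : (exists u' v', q = u' * q0 + v' * a) ->
    exists x h, x != 0 /\ x *: mphi q = mphi h * mphi r.
  case=> u' [v' qE]; have [l [h [rem [hE hs]]]] := pseudo_division sr' q.
  exists (phi r'`_e ^+ l), h; split.
    rewrite expf_neq0 // -coef_map mr' (_ : e = (size (mphi r)).-1) ?lead_coef_eq0 //.
    by rewrite rt tE.
  have := congr1 mphi hE; rewrite rmorphD rmorphM /= map_polyZ rmorphXn mr' => ->.
  suff -> : mphi rem = 0 by rewrite addr0.
  apply: contrapT => /eqP rem0.
  pose rem2 := (r'`_e ^+ l *: u' - h * u) * q0 + (r'`_e ^+ l *: v' - h * v) * a.
  have rem2E : rem2 = r'`_e ^+ l *: q - h * r.
    rewrite /rem2 qE /r -!mul_polyC; move: (r'`_e ^+ l)%:P => z; ring.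
  have mrem : mphi rem2 = mphi rem.
    by rewrite rem2E hE rmorphB rmorphD !rmorphM /= mr' addrAC subrr add0r.
  have /tmin : Q (size (mphi rem)).
    apply/asboolP; exists (r'`_e ^+ l *: u' - h * u), (r'`_e ^+ l *: v' - h * v).
    by rewrite -/rem2 mrem.
  rewrite tE ltnNge (leq_trans _ hs) //; apply: leq_trans (size_poly _ _) _ => //.
have r_const : (size (mphi r) <= 1)%N.
  have [|x [h [x0 hE]]] := div q0; first by exists 1, 0; rewrite mul1r mul0r addr0.
  have [|x' [h' [x'0 h'E]]] := div a; first by exists 0, 1; rewrite mul1r mul0r add0r.
  have rc : (mphi r).[c] != 0.
    have := congr1 (fun p => p.[c]) h'E; rewrite hornerZ hornerM => e1.
    have : x' * (mphi a).[c] != 0 by rewrite mulf_neq0.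
    by rewrite e1 mulf_eq0 negb_or => /andP[].
  have hc : poly_eval h = 0.
    have := congr1 (fun p => p.[c]) hE; rewrite hornerZ hornerM.
    have -> : (mphi q0).[c] = 0 by exact: q0c.
    by rewrite mulr0 => /esym/eqP; rewrite mulf_eq0 (negPf rc) orbF => /eqP.
  have h0 : mphi h != 0.
    apply: contraNneq (_ : x *: mphi q0 != 0) => [h0|]; first by rewrite hE h0 mul0r.
    by rewrite scaler_eq0 negb_or x0 mq0.
  have hd : (d < size (mphi h))%N by rewrite ltnNge; apply/negP => /(mind _ hc)/eqP; rewrite (negPf h0).
  have : d.+1 = (size (mphi h) + size (mphi r)).-1.
    by rewrite -size_mul // -hE size_scale // mq0 q1s sE.
  by move: hd; move: (size (mphi h)) (size (mphi r)) => x1 y1; clear; lia.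
have e0 : phi r`_0 != 0.
  apply: contraNneq r0 => e1; rewrite [mphi r]size1_polyC // coef_map.
  by rewrite /= e1.
have [N0 H] := sp (q0`_d * r`_0) (ltac:(by rewrite rmorphM mulf_neq0)).
exists N0 => p pp Np k pk.
have [psi [psi0 ker]] := H p pp Np k pk.
move: psi0; rewrite rmorphM mulf_eq0 negb_or => /andP[psib psir].
have /closed_rootP[c' /eqP c'P] : size (map_poly psi q0) != 1%N.
  apply: contraNneq psib => /eqP/size_poly1P[x _ e1].
  by rewrite -coef_map e1 coefC gtn_eqF.
have ker' x : poly_eval x = 0 -> (map_poly psi x).[c'] = 0.
  move=> xc; have [l [h [rem [hE hs]]]] := pseudo_division sq0 x.
  have mrem : mphi rem = 0.
    apply: mind; last exact: leq_trans (size_poly _ _) _.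
    have := congr1 poly_eval hE; rewrite -mul_polyC !(rmorphM, rmorphD) /= xc q0c !mulr0 add0r.
    by move=> <-.
  have := congr1 (fun p => (map_poly psi p).[c']) hE.
  rewrite -mul_polyC rmorphD !rmorphM /= (ker_coef ker mrem) addr0 !hornerM c'P mulr0.
  rewrite map_polyC hornerC /= rmorphXn => /eqP; rewrite mulf_eq0 expf_eq0 (negPf psib) andbF /=.
  by move/eqP.
exists (horner_eval c' \o map_poly psi); split; last by move=> x /ker'.
rewrite /= horner_evalE.
have : (map_poly psi r).[c'] != 0.
  suff -> : map_poly psi r = (psi r`_0)%:P by rewrite hornerC.
  apply/polyP => i; rewrite coef_map coefC; case: i => //= i; apply: ker.
  by rewrite -coef_map nth_default // (leq_trans r_const).
rewrite /r rmorphD !rmorphM /= hornerD !hornerM (ker' _ q0c) mulr0 add0r.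
by rewrite mulf_eq0 negb_or => /andP[].
Qed.

Lemma specializable_poly : specializable phi -> specializable poly_eval.
Proof.
move=> sp; case: (pselect (exists2 q, poly_eval q = 0 & mphi q != 0)) => [|tr].
  exact: specializable_algebraic.
apply: specializable_transcendental => // q qc; apply: contrapT => /eqP q0.
by apply: tr; exists q.
Qed.

End SpecializePoly.

(** * Ideals at the origin, modulo powers of the maximal ideal *)

Section LocalIdeal.
Context (K : fieldType) (n : nat).
Local Notation A := {mpoly K[n]}.

Definition in_m L (u : A) := forall a, (mdeg a < L)%N -> u@_a = 0.

(* The ideal generated by [g] and the [L]-th power of the maximal ideal. *)
Definition loc (I : finType) (g : I -> A) L (u : A) :=
  exists2 v, ideal_gen g v & in_m L (u - v).

Lemma in_mP L : is_ideal (in_m L).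
Proof.
split.
- by move=> a _; rewrite mcoeff0.
- by move=> u v uL vL a aL; rewrite mcoeffD uL // vL // addr0.
move=> u v vL a aL; apply/eqP; rewrite mcoeff_eq0; apply/negP.
move=> /msuppM_le/allpairsP[[b c] /= [_ cv aE]].
move: cv; rewrite mcoeff_msupp vL ?eqxx //.
by apply: leq_ltn_trans aL; rewrite aE mdegD leq_addl.
Qed.

Lemma in_m_le L L' u : (L' <= L)%N -> in_m L u -> in_m L' u.
Proof. by move=> le uL a aL; apply: uL; apply: leq_trans le. Qed.

Lemma in_mM L L' u v : in_m L u -> in_m L' v -> in_m (L + L') (u * v).
Proof.
move=> uL vL a aL; apply/eqP; rewrite mcoeff_eq0; apply/negP.
move=> /msuppM_le/allpairsP[[b c] /= [bu cv aE]].
move: bu cv; rewrite !mcoeff_msupp => bu cv; move: aL; rewrite aE mdegD ltnNge.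
rewrite leq_add // leqNgt.
  by apply: contra bu => bL; rewrite uL.
by apply: contra cv => cL; rewrite vL.
Qed.

Lemma in_m0 u : in_m 0 u. Proof. by []. Qed.

Lemma in_mX a L : (L <= mdeg a)%N -> in_m L 'X_[a].
Proof.
move=> La b bL; rewrite mcoeffX; case: (a =P b) => // ab.
by move: bL; rewrite -ab ltnNge La.
Qed.

Lemma in_m_exp L k u : in_m L u -> in_m (L * k) (u ^+ k).
Proof.
move=> uL; elim: k => [|k IH]; first by rewrite muln0; apply: in_m0.
by rewrite exprS mulnS; apply: in_mM.
Qed.

Lemma in_m_sum T L u : is_ideal T -> in_m L u ->
  (forall a, (L <= mdeg a)%N -> T 'X_[a]) -> T u.
Proof.
move=> iT uL TX; rewrite [u]mpolyE big_seq; apply: ideal_sum => // a.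
rewrite mcoeff_msupp -mul_mpolyC => ua; case: iT => _ _; apply; apply: TX.
by rewrite leqNgt; apply: contra ua => /uL ->.
Qed.

Lemma monom_split D (a : 'X_{1..n}) : (D <= mdeg a)%N ->
  exists b c, a = (b + c)%MM /\ mdeg b = D.
Proof.
elim: D => [|D IH] Da; first by exists 0%MM, a; rewrite add0m mdeg0.
have [|b [c [aE bD]]] := IH; first exact: ltnW.
have : mdeg c != 0%N by apply: contraTneq Da => c0; rewrite aE mdegD bD c0; lia.
rewrite mdeg_eq0 => /mnm_factor[i [c' cE]].
by exists (b + U_(i))%MM, c'; rewrite mdegD mdeg1 bD addn1 aE cE addmA.
Qed.

Lemma spans_monomials (W : A -> Prop) (J : finType) (e : J -> A) : subspace W ->
  (forall a, exists c : J -> K, W ('X_[a] - \sum_j c j *: e j)) ->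
  spans_mod (fun=> True) W e.
Proof.
move=> sW H u _; rewrite [u]mpolyE.
have T0 : exists c : J -> K, W (0 - \sum_j c j *: e j).
  exists (fun=> 0); rewrite big1 ?subr0; [by case: sW | by move=> j _; rewrite scale0r].
apply: (big_ind (fun u => exists c : J -> K, W (u - \sum_j c j *: e j)) T0).
  move=> u1 u2 [c1 w1] [c2 w2]; exists (fun j => c1 j + c2 j).
  under eq_bigr do rewrite scalerDl.
  by rewrite big_split opprD addrACA; apply: subspaceD.
move=> a _; have [c w] := H a; exists (fun j => u@_a * c j).
under eq_bigr do rewrite -scalerA.
by rewrite -scaler_sumr -scalerBr; apply: subspaceZ.
Qed.

Section Gens.
Context (I : finType) (g : I -> A).

Lemma locP L : is_ideal (loc g L).
Proof.
have [g0 gD gM] := ideal_genP g; have [m0 mD mM] := in_mP L; split.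
- by exists 0; rewrite ?subr0.
- move=> u v [u' gu mu] [v' gv mv]; exists (u' + v'); first exact: gD.
  by rewrite opprD addrACA; apply: mD.
- move=> a u [u' gu mu]; exists (a * u'); first exact: gM.
  by rewrite -mulrBr; apply: mM.
Qed.

Lemma loc_gen L u : ideal_gen g u -> loc g L u.
Proof. by exists u => //; rewrite subrr; case: (in_mP L). Qed.

Lemma loc_mem L i : loc g L (g i).
Proof. exact/loc_gen/ideal_gen_mem. Qed.

Lemma loc_m L u : in_m L u -> loc g L u.
Proof. by exists 0; [case: (ideal_genP g) | rewrite subr0]. Qed.

(** Nakayama's lemma: by hypothesis [m^D] lies in [(g) + m m^D], and multiplying the relations by
    monomials pushes the error to any order. *)
Lemma Nakayama_monomials D :
  (forall a, mdeg a = D -> loc g D.+1 'X_[a]) ->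
  forall L u, in_m D u -> loc g L u.
Proof.
move=> H L.
suff claim j u : in_m D u -> in_m (L - j) u -> loc g L u.
  by move=> u uD; apply: (claim L) => //; rewrite subnn.
elim: j u => [|j IH] u uD uL; first by apply: loc_m; rewrite subn0 in uL.
case: (leqP L j) => Lj; first by apply: IH => //; rewrite (_ : L - j = 0)%N //; lia.
pose E := maxn D (L - j.+1).
apply: (in_m_sum (L := E) (locP L)).
  by move=> a; rewrite leq_max => /orP[/uD|/uL].
move=> a Ea.
have [b [c [aE bD]]] := monom_split (leq_trans (leq_maxl _ _) Ea).
have [v gv vm] := H b bD.
rewrite aE mpolyXD -['X_[b]](subrK v) mulrDl.
have [_ lD lM] := locP L; apply: lD; last by rewrite mulrC; apply/lM/loc_gen.
have mm : in_m (mdeg a).+1 (('X_[b] - v) * 'X_[c]).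
  by rewrite aE mdegD bD -addSn; apply: in_mM => //; apply: in_mX.
apply: IH; apply: in_m_le mm.
  by apply/leqW/leq_trans/Ea; apply: leq_maxl.
have : (L - j.+1 <= mdeg a)%N by apply: leq_trans Ea; apply: leq_maxr.
by clear; lia.
Qed.

Section Spanned.
Context (J : finType) (e : J -> A).

(** The hypotheses concern only coefficients of degree at most [D]. They amount to finitely many
    equations, which can be carried from one field to another, whereas the conclusion holds to every
    order. *)
Lemma spans_loc D :
  (forall a, mdeg a = D -> loc g D.+1 'X_[a]) ->
  (forall a, (mdeg a < D)%N -> exists c : J -> K, loc g D.+1 ('X_[a] - \sum_j c j *: e j)) ->
  forall L, spans_mod (fun=> True) (loc g L) e.
Proof.
move=> HD He L.
have nak := Nakayama_monomials HD.
have [l0 lD lM] := locP L.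
apply: (spans_monomials (ideal_subspace (locP L))) => a.
case: (ltnP (mdeg a) D) => aD.
  have [c [v gv vm]] := He a aD; exists c; rewrite -(subrK v (_ - _)).
  apply: lD; [apply/nak/in_m_le/vm; exact: leqnSn | exact: loc_gen].
exists (fun=> 0); rewrite big1 ?subr0; last by move=> j _; rewrite scale0r.
exact/nak/in_mX.
Qed.

End Spanned.

End Gens.

(* Every monomial is [X^delta (X^b)^p] with the entries of [delta] below [p], and
   the Frobenius is additive. *)
Lemma spans_loc_Frobenius p (I J : finType) (g : I -> A) (e : J -> A) :
  p \in [pchar K] ->
  (forall L, spans_mod (fun=> True) (loc g L) e) ->
  forall L, spans_mod (fun=> True) (loc (fun i => g i ^+ p) L)
    (fun q : J * {ffun 'I_n -> 'I_p} => e q.1 ^+ p * 'X_[exps q.2]).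
Proof.
move=> pK sp L.
have pA : p \in [pchar A].
  move: (pK); rewrite !inE => /andP[-> /eqP p0] /=.
  by rewrite -(rmorph_nat (@mpolyC n K)) p0 rmorph0.
have p_gt0 : (0 < p)%N by apply/prime_gt0/(pcharf_prime pK).
have frD (u v : A) : (u + v) ^+ p = u ^+ p + v ^+ p by rewrite -!(pFrobenius_autE pA) rmorphD.
have frB (u v : A) : (u - v) ^+ p = u ^+ p - v ^+ p by rewrite -!(pFrobenius_autE pA) rmorphB.
have fr_sum (T : finType) (F : T -> A) : (\sum_t F t) ^+ p = \sum_t F t ^+ p.
  by rewrite -(pFrobenius_autE pA) rmorph_sum.
have [l0 lD lM] := locP (fun i => g i ^+ p) L.
apply: (spans_monomials (ideal_subspace (locP _ L))) => a.
have [dl [a' aE]] := divmod_monom p_gt0 a.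
have [c [v [x vE] vm]] := sp L 'X_[a'] Logic.I.
exists (fun q => if q.2 == dl then c q.1 ^+ p else 0).
have -> : \sum_(q : J * {ffun 'I_n -> 'I_p})
    (if q.2 == dl then c q.1 ^+ p else 0) *: (e q.1 ^+ p * 'X_[exps q.2])
    = (\sum_j c j *: e j) ^+ p * 'X_[exps dl].
  rewrite fr_sum mulr_suml.
  rewrite -(pair_bigA _ (fun j t => (if t == dl then c j ^+ p else 0) *: (e j ^+ p * 'X_[exps t]))) /=.
  apply: eq_bigr => j _; rewrite (bigD1 dl) //= eqxx big1 ?addr0.
    by rewrite exprZn scalerAl.
  by move=> t /negPf ->; rewrite scale0r.
rewrite aE mpolyXD -mpolyXn -mulrBl -frB mulrC; apply: lM.
rewrite -(subrK v (_ - _)) frD; apply: lD.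
  apply/loc_m/(in_m_le (leq_pmulr L p_gt0))/in_m_exp/vm.
rewrite vE fr_sum; apply/loc_gen; exists (fun i => x i ^+ p).
by apply: eq_bigr => i _; rewrite exprMn.
Qed.

End LocalIdeal.

Section Lifting.
Context (K : fieldType).
Hypothesis K0 : [pchar K] =i pred0.

Lemma exists_specializable (s : seq K) :
  exists (B : comNzRingType) (phi : {rmorphism B -> K}),
    specializable phi /\ forall x, x \in s -> exists b, phi b = x.
Proof.
elim: s => [|c s [B [phi [sp H]]]].
  by exists int, (@intmul K 1); split=> //; apply: specializable_int.
exists {poly B}, (poly_eval phi c); split; first exact: specializable_poly.
move=> x; rewrite inE => /orP[/eqP -> {x}|/H[b <-]].
  by exists 'X; rewrite -[LHS]/((map_poly phi 'X).[c]) map_polyX hornerX.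
by exists b%:P; rewrite -[LHS]/((map_poly phi b%:P).[c]) map_polyC hornerC.
Qed.

(** Zero coefficients lift to zero itself, so that constant polynomials remain constant under every
    morphism out of [B]. *)
Lemma exists_lift n (T : finType) (P : T -> {mpoly K[n]}) :
  exists (B : comNzRingType) (phi : {rmorphism B -> K}) (Q : T -> {mpoly B[n]}),
  [/\ specializable phi, forall t, map_mpoly phi (Q t) = P t
    & forall t a, (P t)@_a = 0 -> (Q t)@_a = 0].
Proof.
pose s := flatten [seq [seq (P t)@_a | a <- msupp (P t)] | t <- enum T].
have [B [phi [sp H]]] := exists_specializable s.
have Hs t a : exists b, (P t)@_a = phi b /\ ((P t)@_a = 0 -> b = 0).
  case: (eqVneq (P t)@_a 0) => [->|pa]; first by exists 0; rewrite rmorph0.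
  have [|b bE] := H (P t)@_a.
    apply/flattenP; exists [seq (P t)@_a | a <- msupp (P t)].
      by apply/mapP; exists t; rewrite ?mem_enum.
    by apply/mapP; exists a; rewrite ?mcoeff_msupp.
  by exists b; split=> // e; rewrite e eqxx in pa.
have [l lE] := exists_fun (fun t => exists_fun (Hs t)).
pose Q t := \sum_(a <- msupp (P t)) l t a *: 'X_[a] : {mpoly B[n]}.
have QE t a : (Q t)@_a = l t a.
  rewrite /Q raddf_sum /=; case: (boolP (a \in msupp (P t))) => aP.
    rewrite (bigD1_seq a) ?msupp_uniq //= mcoeffZ mcoeffX eqxx mulr1 big1 ?addr0 //.
    by move=> b /negPf ba; rewrite mcoeffZ mcoeffX ba mulr0.
  rewrite big_seq big1 => [|b bP].
    by apply/esym; have [_ ->] := lE t a; rewrite // memN_msupp_eq0.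
  rewrite mcoeffZ mcoeffX; case: (b =P a) => [ba|]; last by rewrite mulr0.
  by rewrite -ba bP in aP.
exists B, phi, Q; split=> // [t|t a Pa].
  by apply/mpolyP => a; rewrite mcoeff_map_mpoly QE /=; have [-> _] := lE t a.
by rewrite QE; have [_ ->] := lE t a.
Qed.

End Lifting.

Section SpanLift.
Context (B : comNzRingType) (K k : fieldType) (phi : {rmorphism B -> K}) (psi : {rmorphism B -> k}).
Hypothesis ker : forall x, phi x = 0 -> psi x = 0.
Context (n L : nat).

Lemma in_m_specialize (w : {mpoly B[n]}) : in_m L (map_mpoly phi w) -> in_m L (map_mpoly psi w).
Proof.
by move=> wL a /wL; rewrite !mcoeff_map_mpoly; apply: ker.
Qed.

(* A maximal minor that is nonzero after specialization is nonzero before. *)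
Lemma span_lift (T : finType) (w : T -> {mpoly B[n]}) :
  spans_mod (fun=> True) (in_m L) (fun t => map_mpoly psi (w t)) ->
  spans_mod (fun=> True) (in_m L) (fun t => map_mpoly phi (w t)).
Proof.
move=> sp; pose C : finType := 'X_{1..n < L}.
pose M : 'M[B]_(#|T|, #|C|) := \matrix_(t, a) (w (enum_val t))@_(bmnm (enum_val a)).
have full : row_full (map_mx psi M).
  have [c cE] := exists_fun (fun a : C => sp 'X_[bmnm a] Logic.I).
  apply/row_fullP; exists (\matrix_(a, t) c (enum_val a) (enum_val t)).
  apply/matrixP => a a'; rewrite !mxE.
  have := cE (enum_val a) (bmnm (enum_val a')) (bmdeg _).
  rewrite mcoeffB mcoeffX raddf_sum /= => /eqP; rewrite subr_eq0 => /eqP.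
  rewrite (inj_eq val_inj) (inj_eq enum_val_inj) => ->.
  rewrite (reindex (@enum_val T T)) /=; last exact/onW_bij/enum_val_bij.
  by apply: eq_bigr => t _; rewrite !mxE mcoeffZ mcoeff_map_mpoly.
have := fullrowsub_unit full; set f := fullrankfun full.
have -> : rowsub f (map_mx psi M) = map_mx psi (rowsub f M).
  by apply/matrixP => i j; rewrite !mxE.
rewrite unitmxE det_map_mx unitfE => det_psi.
have : row_full (map_mx phi M).
  have : row_full (map_mx phi (rowsub f M)).
    rewrite row_full_unit unitmxE det_map_mx unitfE.
    by apply: contraNneq det_psi => /ker ->.
  have -> : map_mx phi (rowsub f M) = rowsub f (map_mx phi M).
    by apply/matrixP => i j; rewrite !mxE.
  rewrite -!sub1mx => /submx_trans; apply; exact: rowsub_sub.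
case/row_fullP => N NM u _.
pose v := (\row_a u@_(bmnm (enum_val a))) *m N.
exists (fun t => v 0 (enum_rank t)) => a aL.
have := congr1 (fun Z => ((\row_a u@_(bmnm (enum_val a)) : 'rV_#|C|) *m Z) 0 (enum_rank (BMultinom aL : C))) NM.
rewrite mulmxA -/v mulmx1 mxE [in RHS]mxE enum_rankK /= => e.
apply/eqP; rewrite mcoeffB raddf_sum subr_eq0 /= -e.
rewrite (reindex (@enum_rank T)) /=; last exact/onW_bij/enum_rank_bij.
apply/eqP/eq_bigr => t _; rewrite !mxE mcoeffZ mcoeff_map_mpoly !enum_rankK //.
Qed.

End SpanLift.

Section PrimePowers.
Context (K : fieldType) (n : nat).
Hypothesis K0 : [pchar K] =i pred0.
Local Notation A := {mpoly K[n]}.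
Context (I J : finType) (g : I -> A) (e : J -> A) (D : nat).
Hypothesis gD : forall a, mdeg a = D -> loc g D.+1 'X_[a].
Hypothesis eD : forall a, (mdeg a < D)%N ->
  exists c : J -> K, loc g D.+1 ('X_[a] - \sum_j c j *: e j).

(** Including the multiples [X^b g_i^p] turns spanning modulo an ideal into spanning modulo [m^L] by
    one finite family: a rank condition, which [span_lift] can compare between fields. *)
Definition prime_power_gens (R : comNzRingType) p L (g' : I -> {mpoly R[n]}) (e' : J -> {mpoly R[n]})
  (t : (J * {ffun 'I_n -> 'I_p} + 'X_{1..n < L} * I)%type) : {mpoly R[n]} :=
  match t with
  | inl q => e' q.1 ^+ p * 'X_[exps q.2]
  | inr q => 'X_[bmnm q.1] * g' q.2 ^+ p
  end.

Lemma spans_prime_power_gens (F : fieldType) p L (g' : I -> {mpoly F[n]}) (e' : J -> {mpoly F[n]}) :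
  spans_mod (fun=> True) (loc (fun i => g' i ^+ p) L)
    (fun q : J * {ffun 'I_n -> 'I_p} => e' q.1 ^+ p * 'X_[exps q.2]) <->
  spans_mod (fun=> True) (in_m L) (prime_power_gens (p := p) (L := L) g' e').
Proof.
split=> sp u _; have [c] := sp u Logic.I.
  case=> v [x vE] vm.
  exists (fun t => match t with inl q => c q | inr q => (x q.2)@_(bmnm q.1) end).
  rewrite big_sumType /= opprD addrA.
  rewrite -(pair_bigA _ (fun b i => (x i)@_(bmnm b) *: ('X_[bmnm b] * g' i ^+ p))) /=.
  rewrite -(subrK v (u - _)) -addrA.
  have [m0 mD mM] := @in_mP F n L; apply: mD => //.
  rewrite vE exchange_big -sumrB; apply: ideal_sum => [|i _ /=]; first exact: in_mP.
  under eq_bigr do rewrite scalerAl.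
  rewrite -mulr_suml -mulrBl mulrC; apply: mM => a aL.
  rewrite mcoeffB raddf_sum /= (bigD1 (BMultinom aL)) //= mcoeffZ mcoeffX eqxx mulr1.
  rewrite big1 ?addr0 ?subrr // => b; rewrite -val_eqE /= => /negPf ba.
  by rewrite mcoeffZ mcoeffX ba mulr0.
rewrite big_sumType /= => w; exists (fun q => c (inl q)).
rewrite -[u - _](subrK (\sum_i c (inr i) *: ('X_[bmnm i.1] * g' i.2 ^+ p))).
have [l0 lD lM] := locP (fun i => g' i ^+ p) L; apply: lD.
  by apply: loc_m; rewrite -addrA -opprD.
apply: ideal_sum => [|q _]; first exact: locP.
rewrite scalerAl; apply/lM/(loc_mem (fun i => g' i ^+ p)).
Qed.

Theorem spans_loc_prime_power : exists N0, forall p, prime p -> (N0 < p)%N ->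
  forall L, spans_mod (fun=> True) (loc (fun i => g i ^+ p) L)
    (fun q : J * {ffun 'I_n -> 'I_p} => e q.1 ^+ p * 'X_[exps q.2]).
Proof.
pose X : finType := 'X_{1..n < D.+1}.
(* For monomials of degree [D] the coefficients on [e] are chosen to be 0, so that [gD] survives the
   specialization as well as [eD]. *)
have [c [v [cv c0]]] : exists (c : X -> J -> K) (v : X -> I -> A),
   (forall a : X, in_m D.+1 ('X_[bmnm a] - \sum_j c a j *: e j - \sum_i v a i * g i)) /\
   (forall a : X, mdeg (bmnm a) = D -> forall j, c a j = 0).
  have H (a : X) : exists cv : (J -> K) * (I -> A),
     in_m D.+1 ('X_[bmnm a] - \sum_j cv.1 j *: e j - \sum_i cv.2 i * g i) /\
     (mdeg (bmnm a) = D -> forall j, cv.1 j = 0).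
    have := bmdeg a; rewrite ltnS leq_eqVlt => /orP[/eqP aD|aD].
      have [_ [v ->] vm] := gD aD; exists (fun=> 0, v); split=> //=.
      by rewrite [X in _ - X - _]big1 ?subr0 // => j _; rewrite scale0r.
    have [c [_ [v ->] vm]] := eD aD; exists (c, v); split=> //= aD'.
    by rewrite aD' ltnn in aD.
  have [cv cvP] := exists_fun H; exists (fun a => (cv a).1), (fun a => (cv a).2).
  by split=> a; case: (cvP a).
pose T : finType := ((I + J) + ((X * I) + (X * J)))%type.
pose P (t : T) : A := match t with
  | inl (inl i) => g i | inl (inr j) => e j
  | inr (inl q) => v q.1 q.2 | inr (inr q) => (c q.1 q.2)%:MP end.
have [B [phi [Q [sp QP Q0]]]] := exists_lift K0 P.
(* The inclusion of kernels is what the transfer uses, so the element to be kept nonzero is 1; in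
   particular [N0] is independent of [L]. *)
have [|N0 H] := sp 1; first by rewrite rmorph1 oner_neq0.
exists N0 => p pp Np L; apply/spans_prime_power_gens.
have [k [FtoK _]] := countable_algebraic_closure 'F_p.
have pk : p \in [pchar k] by rewrite (fmorph_pchar FtoK); apply: pchar_Fp.
have [psi [_ ker]] := H p pp Np k pk.
pose g' i := Q (inl (inl i)); pose e' j := Q (inl (inr j)).
pose v' a i := Q (inr (inl (a, i))); pose c' a j := Q (inr (inr (a, j))).
have cE (R : comNzRingType) (f : {rmorphism B -> R}) a j :
    map_mpoly f (c' a j) = (f (c' a j)@_0)%:MP.
  apply/mpolyP => b; rewrite mcoeff_map_mpoly mcoeffC.
  case: (eqVneq b 0%MM) => [->|b0]; first by rewrite mulr1.
  rewrite mulr0 /= Q0 ?rmorph0 //= mcoeffC.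
  by rewrite (negPf b0) mulr0.
pose w a : {mpoly B[n]} := 'X_[bmnm a] - \sum_j c' a j * e' j - \sum_i v' a i * g' i.
have mapw (R : comNzRingType) (f : {rmorphism B -> R}) a : map_mpoly f (w a) =
    'X_[bmnm a] - \sum_j (f (c' a j)@_0) *: map_mpoly f (e' j)
      - \sum_i map_mpoly f (v' a i) * map_mpoly f (g' i).
  rewrite /w !rmorphB !rmorph_sum /= map_mpolyX; congr (_ - _ - _); apply: eq_bigr => i _; rewrite rmorphM //=.
  by rewrite cE mul_mpolyC.
have wpsi a : in_m D.+1 (map_mpoly psi (w a)).
  apply: (in_m_specialize ker); rewrite mapw.
  have -> : \sum_j phi (c' a j)@_0 *: map_mpoly phi (e' j) = \sum_j c a j *: e j.
    apply: eq_bigr => j _; rewrite QP -!mul_mpolyC -cE QP //.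
  have -> : \sum_i map_mpoly phi (v' a i) * map_mpoly phi (g' i) = \sum_i v a i * g i.
    by apply: eq_bigr => i _; rewrite !QP.
  exact: cv.
have c'0 a : mdeg (bmnm a) = D -> forall j, psi (c' a j)@_0 = 0.
  by move=> aD j; rewrite Q0 ?rmorph0 //= c0 // mcoeff0.
have spk : forall L, spans_mod (fun=> True) (loc (fun i => map_mpoly psi (g' i)) L)
    (fun j => map_mpoly psi (e' j)).
  apply: (spans_loc (D := D)) => a aD.
    have aD1 : (mdeg a < D.+1)%N by rewrite aD.
    exists (\sum_i map_mpoly psi (v' (BMultinom aD1) i) * map_mpoly psi (g' i)).
      by exists (fun i => map_mpoly psi (v' (BMultinom aD1) i)).
    have := wpsi (BMultinom aD1); rewrite mapw [X in _ - X - _]big1 ?subr0 // => j _.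
    by rewrite c'0 ?scale0r.
  have aD1 : (mdeg a < D.+1)%N by apply: ltnW.
  exists (fun j => psi (c' (BMultinom aD1) j)@_0).
  exists (\sum_i map_mpoly psi (v' (BMultinom aD1) i) * map_mpoly psi (g' i)).
    by exists (fun i => map_mpoly psi (v' (BMultinom aD1) i)).
  by have := wpsi (BMultinom aD1); rewrite mapw.
have mapg (R : comNzRingType) (f : {rmorphism B -> R}) t : map_mpoly f (prime_power_gens g' e' t)
   = prime_power_gens (p := p) (L := L) (fun i => map_mpoly f (g' i)) (fun j => map_mpoly f (e' j)) t.
  by case: t => q /=; rewrite rmorphM rmorphXn /= map_mpolyX.
have spk' := (spans_prime_power_gens p L (fun i => map_mpoly psi (g' i))
  (fun j => map_mpoly psi (e' j))).1 (spans_loc_Frobenius pk spk L).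
have := @span_lift B K k phi psi ker n L _ (prime_power_gens (p := p) (L := L) g' e').
have eqf (R : fieldType) (S : finType) (w1 w2 : S -> {mpoly R[n]}) : w1 =1 w2 ->
    spans_mod (fun=> True) (in_m L) w1 -> spans_mod (fun=> True) (in_m L) w2.
  by move=> w12 sp1 u _; have [x xP] := sp1 u Logic.I; exists x; under eq_bigr do rewrite -w12.
move=> H1; apply: (eqf _ _ _ _ _ (H1 _)) => [t|].
  by rewrite mapg; case: t => q /=; rewrite !QP.
by apply: (eqf _ _ _ _ _ spk') => t; rewrite mapg.
Qed.

End PrimePowers.

(** * Lattice points and volumes *)

Section BoxCount.
Context (N : nat).

Definition box_count n s :=
  #|[set a : {ffun 'I_n -> 'I_N} | (mdeg (exps a) < s)%N]|.

Let P : {poly int} := \sum_(j < N) 'X^j.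
Let cumul n s : int := \sum_(t < s) (P ^+ n)`_t.

Lemma mdeg_exps n (a : {ffun 'I_n -> 'I_N}) : mdeg (exps a) = (\sum_i a i)%N.
Proof. by rewrite mdegE; apply: eq_bigr => i _; rewrite expsE. Qed.

Let box_cumul n s : (box_count n s)%:Z = cumul n s.
Proof.
rewrite /cumul; have -> : P ^+ n = \sum_(a : {ffun 'I_n -> 'I_N}) 'X^(mdeg (exps a)).
  rewrite -[in LHS](card_ord n) -prodr_const bigA_distr_bigA; apply: eq_bigr => a _ /=.
  by rewrite mdeg_exps -prodrXr.
under eq_bigr do rewrite coef_sum.
rewrite exchange_big /= /box_count -sum1dep_card big_mkcond -[LHS]natz natr_sum.
apply: eq_bigr => a _ /=; case: ltnP => as_.
  rewrite (bigD1 (Ordinal as_)) //= coefXn eqxx big1 ?addr0 // => t.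
  by rewrite -val_eqE /= coefXn => /negPf ->.
rewrite big1 // => t _; rewrite coefXn; case: eqP => // e.
by have := ltn_ord t; rewrite e ltnNge as_.
Qed.

Let cumul0 s : cumul 0 s = (0 < s)%N%:R.
Proof.
rewrite /cumul expr0; case: s => [|s]; first by rewrite big_ord0.
by rewrite big_ord_recl coef1 big1 ?addr0 // => i _; rewrite coef1.
Qed.

Let cumulS n s : cumul n.+1 s = \sum_(j < N) cumul n (s - j).
Proof.
rewrite /cumul exprSr; set Q := P ^+ n; rewrite [in LHS]/P mulr_sumr.
under eq_bigr do rewrite coef_sum.
rewrite exchange_big /=; apply: eq_bigr => j _.
under eq_bigr do rewrite coefMXn.
case: (leqP s j) => sj.
  rewrite (eqP sj) big_ord0 big1 // => t _; rewrite ifT //.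
  exact: leq_trans (ltn_ord t) sj.
rewrite -(big_mkord predT (fun t => if (t < j)%N then 0 else Q`_(t - j))).
rewrite (big_cat_nat (n := j)) //= ?(ltnW sj) // big_nat big1 ?add0r; last first.
  by move=> t /andP[_ ->].
rewrite -{1}[j : nat]add0n big_addn big_mkord; apply: eq_bigr => t _.
by rewrite ltnNge leq_addl /= addnK.
Qed.

(* The number of [n]-tuples of natural numbers with sum below [t]. *)
Definition simplex_count n t := if t is t'.+1 then 'C(t' + n, n) else 0%N.

Let simplex_countS n t : (simplex_count n.+1 t.+1 = simplex_count n.+1 t + simplex_count n t.+1)%N.
Proof.
rewrite /simplex_count; case: t => [|t]; first by rewrite !add0n !binn.
by rewrite addnS binS addnS -addSn addnC.
Qed.

Let simplex_sum n t M : (M <= t)%N -> \sum_(j < M) (simplex_count n (t - j))%:Z =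
  (simplex_count n.+1 t)%:Z - (simplex_count n.+1 (t - M))%:Z.
Proof.
elim: M => [|M IH] Mt; first by rewrite big_ord0 subn0 subrr.
rewrite big_ord_recr /= IH ?(ltnW Mt) //.
have := simplex_countS n (t - M.+1); rewrite subnSK // => ->.
by rewrite PoszD opprD addrA subrK.
Qed.

Let simplex_sum_trunc n t : \sum_(j < N) (simplex_count n (t - j))%:Z =
  (simplex_count n.+1 t)%:Z - (simplex_count n.+1 (t - N))%:Z.
Proof.
case: (leqP N t) => Nt; first exact: simplex_sum.
transitivity (\sum_(j < t) (simplex_count n (t - j))%:Z).
  rewrite (@big_ord_widen_cond _ _ _ t N xpredT (fun j => (simplex_count n (t - j))%:Z)) ?(ltnW Nt) //.
  rewrite [RHS]big_mkcond; apply: eq_bigr => j _ /=; case: ltnP => // tj.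
  by rewrite (eqP tj).
by rewrite (simplex_sum n (leqnn t)) subnn (eqP (ltnW Nt)).
Qed.

(** Inclusion-exclusion over the coordinates that reach [N]. In the induction on [n], the sum over
    the last coordinate telescopes by the hockey-stick identity. Truncated subtraction gives the
    right terms because [simplex_count n 0 = 0]. *)
Lemma box_countE n s : (box_count n s)%:Z =
  \sum_(i < n.+1) (-1) ^+ i * (simplex_count n (s - i * N))%:Z *+ 'C(n, i).
Proof.
rewrite box_cumul; elim: n s => [|n IH] s.
  rewrite big_ord1 cumul0 expr0 mul1r mul0n subn0 bin0 mulr1n.
  by case: s => // s; rewrite /simplex_count addn0 bin0.
rewrite cumulS; under eq_bigr do rewrite IH.
rewrite exchange_big /=.
pose T i : int := (simplex_count n.+1 (s - i * N))%:Z.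
transitivity (\sum_(i < n.+1) (-1) ^+ i * (T i - T i.+1) *+ 'C(n, i)).
  apply: eq_bigr => i _; rewrite sumrMnl -mulr_sumr; congr (_ * _ *+ _).
  rewrite /T mulSn addnC subnDA -simplex_sum_trunc; apply: eq_bigr => j _.
  by congr (simplex_count n _)%:Z; lia.
rewrite [RHS]big_ord_recl /= expr0 mul1r bin0 mulr1n.
under [in RHS]eq_bigr do rewrite /bump add1n binS mulrnDr.
rewrite big_split /= addrA.
have -> : T 0%N + \sum_(i < n.+1) (-1) ^+ i.+1 * T i.+1 *+ 'C(n, i.+1)
    = \sum_(i < n.+1) (-1) ^+ i * T i *+ 'C(n, i).
  transitivity (\sum_(i < n.+2) (-1) ^+ i * T i *+ 'C(n, i)).
    by rewrite [RHS]big_ord_recl /= expr0 mul1r bin0 mulr1n.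
  by rewrite big_ord_recr /= (bin_small (ltnSn n)) mulr0n addr0.
rewrite -big_split /=; apply: eq_bigr => i _.
by rewrite -mulrnDl exprS mulN1r mulNr mulrBr.
Qed.

Lemma box_count_le n s1 s2 : (s1 <= s2)%N -> (box_count n s1 <= box_count n s2)%N.
Proof.
move=> s12; apply/subset_leq_card/fintype.subsetP => a; rewrite !inE.
by move/leq_trans; apply.
Qed.

Lemma box_count_diff n s1 s2 : (s1 <= s2)%N ->
  (box_count n s2 - box_count n s1)%N =
  #|[set a : {ffun 'I_n -> 'I_N} | (s1 <= mdeg (exps a) < s2)%N]|.
Proof.
move=> s12; rewrite /box_count -cardsDS; last first.
  by apply/fintype.subsetP => a; rewrite !inE => /leq_trans; apply.
by apply: eq_card => a; rewrite !inE -leqNgt.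
Qed.

End BoxCount.

(** * Volumes as limits of lattice point counts *)

Section Asymptotics.
Context (R : realType).

Lemma exprB_le n (x y c B : R) : 0 <= x -> x <= B -> 0 <= y -> y <= B ->
  `|x - y| <= c -> `|x ^+ n - y ^+ n| <= c * (n%:R * B ^+ n.-1).
Proof.
move=> x0 xB y0 yB xyc; rewrite subrXX normrM.
apply: ler_pM => //; apply: (le_trans (ler_norm_sum _ _ _)).
rewrite mulr_natl -[X in _ *+ X]card_ord -sumr_const; apply: ler_sum => i _.
rewrite normrM !normrX !ger0_norm //.
have e : n.-1 = (n.-1 - i + i)%N by have := ltn_ord i; lia.
have B0 : 0 <= B by apply: le_trans xB.
rewrite [in leRHS]e exprD; apply: ler_pM; rewrite ?exprn_ge0 //; exact: lerXn2r.
Qed.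

Lemma ffact_bounds m n : (n <= m)%N -> ((m - n).+1 ^ n <= m ^_ n <= m ^ n)%N.
Proof.
elim: n => [|n IH] nm; first by rewrite !expn0 ffactn0.
have /andP[l u] := IH (ltnW nm).
rewrite ffactnSr !expnSr; apply/andP; split; apply: leq_mul => //; last exact: leq_subr.
  by apply: leq_trans l; case: (posnP n) => [->|n0]; rewrite ?expn0 // leq_exp2r //; lia.
by lia.
Qed.

Lemma simplex_count_bounds n t : (0 < n)%N ->
  (t ^ n <= n`! * simplex_count n t <= (t + n) ^ n)%N.
Proof.
move=> n0; case: t => [|t] /=; first by rewrite exp0n // muln0.
rewrite mulnC bin_ffact; have /andP[l u] := ffact_bounds (leq_addl t n).
rewrite addnK in l; rewrite l (leq_trans u) // leq_exp2r // leq_add2r.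
Qed.

Lemma sum_ord_widen (V : nmodType) (F : nat -> V) k l :
  (forall i, (k <= i)%N -> F i = 0) -> \sum_(i < k) F i = \sum_(i < k + l) F i.
Proof.
move=> F0; rewrite big_split_ord /= [X in _ = _ + X]big1 ?addr0 // => i _.
by rewrite F0 // leq_addr.
Qed.

(** Positive parts replace the cut-off at the integer part of [sigma], which gives the sum the index
    range of [box_countE]. *)
Lemma cube_corner_volumeE n (sigma : R) : (0 < n)%N -> 0 <= sigma ->
  n`!%:R * cube_corner_volume n sigma =
  \sum_(i < n.+1) (-1) ^+ i * 'C(n, i)%:R * Num.max (sigma - i%:R) 0 ^+ n.
Proof.
move=> n0 s0; rewrite /cube_corner_volume big_mkord mulr_sumr.
have f0 : n`!%:R != 0 :> R by rewrite pnatr_eq0 -lt0n fact_gt0.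
set T := (Num.truncn sigma).+1.
transitivity (\sum_(i < T) (-1) ^+ i * 'C(n, i)%:R * Num.max (sigma - i%:R) 0 ^+ n).
  apply: eq_bigr => i _; rewrite max_l; last first.
    rewrite subr_ge0; apply: le_trans (_ : (Num.truncn sigma)%:R <= sigma).
      by rewrite ler_nat -ltnS.
    by rewrite truncn_le.
  by rewrite !mulrA [_ * (-1) ^+ i]mulrC mulfK.
pose F i : R := (-1) ^+ i * 'C(n, i)%:R * Num.max (sigma - i%:R) 0 ^+ n.
transitivity (\sum_(i < T + n.+1) F i).
  apply: (sum_ord_widen (F := F)) => i Ti; rewrite /F max_r ?expr0n ?(gtn_eqF n0) ?mulr0 //.
  by rewrite subr_le0 ltW // (lt_le_trans (truncnS_gt _)) // ler_nat.
rewrite addnC; apply/esym/(sum_ord_widen (F := F)) => i ni.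
by rewrite /F bin_small // mulr0 mul0r.
Qed.

(** Both quantities are the same alternating sum, and [n! * simplex_count n t] lies between [t^n]
    and [(t + n)^n], so each term is off by [O(N^(n-1))]. The tolerance [c] absorbs rounding and a
    bounded change in the width of a slab. *)
Theorem box_count_asymptotics n (sigma : R) (c : nat) : (0 < n)%N -> 0 <= sigma ->
  exists C : R, 0 <= C /\ forall N s : nat, (0 < N)%N -> `|s%:R - sigma * N%:R| <= c%:R ->
    `|(box_count N n s)%:R - cube_corner_volume n sigma * N%:R ^+ n| <= C * N%:R ^+ n.-1.
Proof.
move=> n0 s0; pose C1 : R := (c + n)%:R * (n%:R * (sigma + (c + n)%:R) ^+ n.-1).
have C10 : 0 <= C1 by rewrite !mulr_ge0 ?ler0n // exprn_ge0 // addr_ge0.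
exists (\sum_(i < n.+1) 'C(n, i)%:R * C1); split.
  by apply: sumr_ge0 => i _; rewrite mulr_ge0.
move=> N s N0 sN; have N1 : 1 <= N%:R :> R by rewrite ler1n.
have term i : `|n`!%:R * (simplex_count n (s - i * N))%:R
     - (Num.max (sigma - i%:R) 0 * N%:R) ^+ n| <= C1 * N%:R ^+ n.-1 :> R.
  set t := (s - i * N)%N; set y := Num.max _ _ * _.
  have y0 : 0 <= y by rewrite mulr_ge0 // le_max lexx orbT.
  have yE : y = Num.max (sigma * N%:R - (i * N)%:R) 0.
    by rewrite /y maxr_pMl ?ler0n // mul0r mulrBl natrM.
  have tE : t%:R = Num.max (s%:R - (i * N)%:R) 0 :> R.
    rewrite /t; case: (leqP (i * N) s) => le.
      by rewrite natrB // max_l // subr_ge0 ler_nat.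
    by rewrite (eqP (ltnW le)) max_r // subr_le0 ler_nat ltnW.
  have ty : `|t%:R - y| <= c%:R.
    rewrite tE yE; move: sN; rewrite !ler_norml => /andP[h1 h2].
    by rewrite /Num.max /Order.max; case: ltP => h3; case: ltP => h4; lra.
  have yB : y <= sigma * N%:R.
    by rewrite yE ge_max mulr_ge0 ?ler0n // andbT lerBlDr lerDl ler0n.
  have B0 : sigma * N%:R + (c + n)%:R <= (sigma + (c + n)%:R) * N%:R.
    by rewrite mulrDl lerD2l ler_peMr // ler0n.
  have /andP[lo hi] := simplex_count_bounds t n0.
  have bound z : t%:R <= z -> z <= t%:R + n%:R -> `|z ^+ n - y ^+ n| <= C1 * N%:R ^+ n.-1 :> R.
    move=> tz zt; have z0 : 0 <= z by apply: le_trans tz; rewrite ler0n.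
    have zy : `|z - y| <= (c + n)%:R.
      move: ty; rewrite !ler_norml natrD => /andP[h1 h2]; apply/andP; split; have := ler0n R n; lra.
    have zB : z <= (sigma + (c + n)%:R) * N%:R.
      by apply: le_trans B0; move: zy; rewrite ler_norml => /andP[h1 h2]; lra.
    have yB' : y <= (sigma + (c + n)%:R) * N%:R.
      by apply: le_trans B0; rewrite (le_trans yB) // lerDl ler0n.
    by have := exprB_le n z0 zB y0 yB' zy; rewrite [((_ + _) * _) ^+ _]exprMn /C1 !mulrA.
  have b1 := bound t%:R (lexx _) (ltac:(by rewrite lerDl ler0n)).
  have b2 := bound (t%:R + n%:R) (ltac:(by rewrite lerDl ler0n)) (lexx _).
  have lo' : t%:R ^+ n <= n`!%:R * (simplex_count n t)%:R :> R by rewrite -natrX -natrM ler_nat.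
  have hi' : n`!%:R * (simplex_count n t)%:R <= (t%:R + n%:R) ^+ n :> R.
    by rewrite -natrD -natrX -natrM ler_nat.
  move: b1 b2; rewrite !ler_norml => /andP[h1 h2] /andP[h3 h4].
  by apply/andP; split; lra.
have fac1 : 1 <= n`!%:R :> R by rewrite ler1n fact_gt0.
have : `|n`!%:R * ((box_count N n s)%:R - cube_corner_volume n sigma * N%:R ^+ n)| <=
   (\sum_(i < n.+1) 'C(n, i)%:R * C1) * N%:R ^+ n.-1 :> R.
  rewrite mulrBr mulrA cube_corner_volumeE //.
  have -> : (box_count N n s)%:R =
      \sum_(i < n.+1) (-1) ^+ i * 'C(n, i)%:R * (simplex_count n (s - i * N))%:R :> R.
    rewrite pmulrn box_countE rmorph_sum /=; apply: eq_bigr => i _.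
    by rewrite rmorphMn rmorphM rmorphXn rmorphN1 /= -pmulrn -mulr_natr; ring.
  rewrite mulr_sumr mulr_suml -sumrB mulr_suml; apply: le_trans (ler_norm_sum _ _ _) _.
  apply: ler_sum => i _; rewrite -mulrA.
  have -> : n`!%:R * ((-1) ^+ i * ('C(n, i)%:R * (simplex_count n (s - i * N))%:R)) -
      (-1) ^+ i * 'C(n, i)%:R * Num.max (sigma - i%:R) 0 ^+ n * N%:R ^+ n
    = ((-1) ^+ i * 'C(n, i)%:R) * (n`!%:R * (simplex_count n (s - i * N))%:R
     - (Num.max (sigma - i%:R) 0 * N%:R) ^+ n) :> R by rewrite exprMn; ring.
  rewrite !normrM normrX normrN1 expr1n mul1r normr_nat -mulrA.
  by apply: ler_wpM2l => //.
apply: le_trans; rewrite normrM normr_nat ler_peMl //.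
Qed.

Definition slab_volume n : R := cube_corner_volume n ((n%:R + 1) / 2%:R)
  - cube_corner_volume n ((n%:R - 1) / 2%:R).

Lemma slab_count_asymptotics n (c : nat) : (0 < n)%N ->
  exists C : R, 0 <= C /\ forall N s1 s2 : nat, (0 < N)%N -> (s1 <= s2)%N ->
    `|s1%:R - (n%:R - 1) / 2%:R * N%:R| <= c%:R :> R ->
    `|s2%:R - (n%:R + 1) / 2%:R * N%:R| <= c%:R :> R ->
    `|(box_count N n s2 - box_count N n s1)%:R - slab_volume n * N%:R ^+ n| <= C * N%:R ^+ n.-1.
Proof.
move=> n0; have n1 : 1 <= n%:R :> R by rewrite ler1n.
have p1 : 0 <= (n%:R - 1) / 2%:R :> R by lra.
have p2 : 0 <= (n%:R + 1) / 2%:R :> R by lra.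
have [C1 [C10 H1]] := box_count_asymptotics c n0 p1.
have [C2 [C20 H2]] := box_count_asymptotics c n0 p2.
exists (C1 + C2); split; first exact: addr_ge0.
move=> N s1 s2 N0 s12 a1 a2.
rewrite natrB ?box_count_le // /slab_volume mulrDl.
have := H1 N s1 N0 a1; have := H2 N s2 N0 a2.
rewrite !ler_norml mulrBl => /andP[h1 h2] /andP[h3 h4].
by apply/andP; split; lra.
Qed.

Lemma le0_of_growth (x C : R) n (Q : nat -> Prop) : (0 < n)%N ->
  (forall M, exists2 N, (M < N)%N & Q N) ->
  (forall N, Q N -> x * N%:R ^+ n <= C * N%:R ^+ n.-1) -> x <= 0.
Proof.
move=> n0 Qinf H; rewrite leNgt; apply/negP => x0.
have [N MN QN] := Qinf (Num.truncn `|C / x|).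
have N0 : 0 < N%:R :> R by rewrite ltr0n; apply: leq_trans MN.
have := H N QN; rewrite -{1}(prednK n0) exprS mulrA ler_pM2r ?exprn_gt0 // leNgt.
case/negP; rewrite mulrC -ltr_pdivrMr //.
apply: le_lt_trans (ler_norm _) _.
by apply: lt_le_trans (truncnS_gt _) _; rewrite ler_nat.
Qed.

(** The slab contains the cube of side [1 / n] around the centre of the unit cube, so its volume is
    at least [1 / n^n]; this is verified on lattice points. *)
Lemma slab_volume_gt0 n : (0 < n)%N -> 0 < slab_volume n.
Proof.
move=> n0; have [C [C0 H]] := slab_count_asymptotics 0 n0.
have nn0 : 0 < n%:R :> R by rewrite ltr0n.
suff : 1 / n%:R ^+ n - slab_volume n <= 0.
  by rewrite subr_le0; apply: lt_le_trans; rewrite divr_gt0 // exprn_gt0.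
apply: (@le0_of_growth _ C n (fun N => (0 < N)%N /\ exists M, N = (2 * n * M)%N)) => //.
  (* For multiples of [2 * n] both ends of the slab are integers, so the asymptotics apply with
     tolerance 0. *)
  move=> M; exists (2 * n * M.+1)%N; last by split; [rewrite !muln_gt0 n0 | exists M.+1].
  by rewrite -[X in (X < _)%N]mul1n; apply: ltn_mul => //; lia.
move=> _ [/[swap] [[M ->]]]; set N := (2 * n * M)%N => N0.
pose s1 := (n.-1 * (n * M))%N; pose s2 := (n.+1 * (n * M))%N.
have s12 : (s1 <= s2)%N by rewrite leq_mul2r; apply/orP; right; lia.
have NE : N%:R = 2%:R * (n%:R * M%:R) :> R by rewrite /N -mulnA !natrM.
have s1E : s1%:R = (n%:R - 1) / 2%:R * N%:R :> R.
  by rewrite NE /s1 !natrM -subn1 natrB //; field.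
have s2E : s2%:R = (n%:R + 1) / 2%:R * N%:R :> R.
  by rewrite NE /s2 !natrM -addn1 natrD; field.
have := H N s1 s2 N0 s12; rewrite s1E s2E !subrr normr0 => /(_ (lexx _) (lexx _)).
have lo : ((2 * M) ^ n <= box_count N n s2 - box_count N n s1)%N.
  rewrite box_count_diff //.
  have -> : ((2 * M) ^ n = #|{ffun 'I_n -> 'I_(2 * M)}|)%N by rewrite card_ffun !card_ord.
  have bnd (i : 'I_(2 * M)) : (n.-1 * M + i < N)%N.
    by have := ltn_ord i; rewrite /N; nia.
  pose f (a : {ffun 'I_n -> 'I_(2 * M)}) := [ffun i => Ordinal (bnd (a i))].
  rewrite -(card_imset (f := f) predT); last first.
    move=> a b /ffunP e; apply/ffunP => i; apply: val_inj.
    by have := congr1 val (e i); rewrite !ffunE /= => /addnI.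
  apply/subset_leq_card/fintype.subsetP => _ /imsetP[a _ ->]; rewrite inE mdeg_exps.
  under eq_bigr do rewrite ffunE /=.
  rewrite big_split sum_nat_const card_ord /=.
  have sub : (\sum_(i < n) a i <= \sum_(i < n) (2 * M).-1)%N.
    by apply: leq_sum => i _; have := ltn_ord (a i); lia.
  rewrite sum_nat_const card_ord in sub.
  have M0 : (0 < M)%N by move: N0; rewrite /N !muln_gt0 => /andP[].
  rewrite /s1 /s2; have e1 : (n * (2 * M).-1 + n = 2 * (n * M))%N.
    by rewrite -mulnSr prednK ?muln_gt0 // mulnCA.
  have e2 : (n.+1 * (n * M) = n.-1 * (n * M) + 2 * (n * M))%N.
    by rewrite -mulnDl; congr (_ * _)%N; lia.
  rewrite e2 [(n * (_ * M))%N]mulnCA leq_addr ltn_add2l -e1.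
  by apply: leq_ltn_trans sub _; rewrite -[X in (X < _)%N]addn0 ltn_add2l.
have lo' : 1 / n%:R ^+ n * N%:R ^+ n <= (box_count N n s2 - box_count N n s1)%:R :> R.
  have -> : 1 / n%:R ^+ n * N%:R ^+ n = (2 * M)%:R ^+ n :> R.
    rewrite NE natrM mulrCA exprMn mulrA mul1r mulVf ?mul1r //.
    by rewrite expf_neq0 // lt0r_neq0.
  by rewrite -natrX ler_nat.
rewrite ler_norml => /andP[_ h2]; rewrite mulrBl lerBlDr (le_trans lo') //.
by rewrite -lerBlDr.
Qed.

Theorem slab_volume_limit n (mu tau c N0 : nat) : (0 < n)%N ->
  (forall p, prime p -> (N0 < p)%N -> let a := (n.-1 * p)./2 in
     (mu * (box_count p n (a + p - c) - box_count p n a) <= tau * p ^ n)%N) ->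
  mu%:R * slab_volume n <= tau%:R.
Proof.
move=> n0 H; rewrite -subr_le0.
(* The window falls short by [c], and rounding [(n - 1) p / 2] costs less than 1. *)
have [C [C0 HC]] := slab_count_asymptotics c.+1 n0.
apply: (@le0_of_growth _ (mu%:R * C) n (fun p => prime p /\ (maxn N0 c < p)%N)) => //.
  move=> M; have [p Mp pp] := prime_above (maxn M (maxn N0 c)).
  move: Mp; rewrite gtn_max => /andP[Mp cp].
  by exists p.
move=> p [pp]; rewrite gtn_max => /andP[Np cp].
have p0 := prime_gt0 pp.
have := H p pp Np; set a := (_)./2 => /= le.
have := HC p a (a + p - c)%N p0 (ltac:(lia)).
have np : (n.-1 * p)%:R = (n%:R - 1) * p%:R :> R by rewrite natrM -subn1 natrB.
have aE : (n.-1 * p)%:R = a%:R + a%:R + (odd (n.-1 * p))%:R :> R.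
  by rewrite -{1}(odd_double_half (n.-1 * p)) -/a natrD -addnn natrD addrC.
have o1 : 0 <= ((odd (n.-1 * p))%:R : R) <= 1 by case: (odd _); rewrite /= ?lexx ?ler01.
have cc : 0 <= c%:R :> R by rewrite ler0n.
have sE : (a + p - c)%:R = a%:R + p%:R - c%:R :> R by rewrite natrB ?natrD //; lia.
move: o1; rewrite np in aE => /andP[o1 o2].
rewrite sE -[c.+1]addn1 natrD.
have q1 : `|a%:R - (n%:R - 1) / 2%:R * p%:R| <= c%:R + 1%:R :> R.
  by rewrite ler_norml; apply/andP; split; lra.
have q2 : `|a%:R + p%:R - c%:R - (n%:R + 1) / 2%:R * p%:R| <= c%:R + 1%:R :> R.
  by rewrite ler_norml; apply/andP; split; lra.
move=> /(_ q1 q2); rewrite ler_norml => /andP[h1 h2].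
have le' : mu%:R * (box_count p n (a + p - c) - box_count p n a)%:R <= tau%:R * p%:R ^+ n :> R.
  by rewrite -natrX -!natrM ler_nat.
rewrite mulrBl -!mulrA lerBlDr.
apply: (@le_trans _ _ (mu%:R * ((box_count p n (a + p - c) - box_count p n a)%:R + C * p%:R ^+ n.-1))).
  by apply: ler_wpM2l => //; lra.
by rewrite mulrDr addrC lerD2l.
Qed.

End Asymptotics.

(** * The slab inequality *)

Section IdealPowers.
Context (A : comNzRingType) (I : finType) (g : I -> A).

Fixpoint gpow b (u : A) : Prop :=
  if b is b'.+1 then exists2 v : I -> A, (forall i, gpow b' (v i)) & u = \sum_i v i * g i
  else True.

Lemma gpowP b : is_ideal (gpow b).
Proof.
elim: b => [|b [IH0 IHD IHM]] //=; split.
- by exists (fun=> 0) => //; rewrite big1 // => i _; rewrite mul0r.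
- move=> u w [v1 gv1 ->] [v2 gv2 ->]; exists (fun i => v1 i + v2 i).
    by move=> i; apply: IHD.
  by rewrite -big_split; apply: eq_bigr => i _; rewrite mulrDl.
- move=> a u [v gv ->]; exists (fun i => a * v i) => [i|]; first exact: IHM.
  by rewrite mulr_sumr; apply: eq_bigr => i _; rewrite mulrA.
Qed.

Lemma gpow_mulS b u i : gpow b u -> gpow b.+1 (u * g i).
Proof.
move=> gu; exists (fun j => if j == i then u else 0) => [j|].
  by case: eqP => // _; case: (gpowP b).
by rewrite (bigD1 i) //= eqxx big1 ?addr0 // => j /negPf ->; rewrite mul0r.
Qed.

Lemma gpowM b b' u v : gpow b u -> gpow b' v -> gpow (b + b') (u * v).
Proof.
elim: b u => [|b IH] u; first by move=> _; have [_ _] := gpowP b'; apply.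
case=> w gw -> gv; exists (fun i => w i * v) => [i|]; first by apply: IH => //; apply: gw.
by rewrite mulr_suml; apply: eq_bigr => i _; rewrite mulrAC.
Qed.

Lemma gpow1P u : gpow 1 u <-> ideal_gen g u.
Proof. by split=> [[v _ ->]|[v ->]]; exists v. Qed.

End IdealPowers.

Section Truncation.
Context (K : fieldType) (n N : nat).
Local Notation A := {mpoly K[n]}.
Local Notation box := {ffun 'I_n -> 'I_N}.
Context (y : 'I_n -> A).
Local Notation yN := (fun i => y i ^+ N).
Local Notation yp a := (mmap1 y a).

Lemma ypow_box_or a : (exists b : box, a = exps b) \/ ideal_gen yN (yp a).
Proof.
case: (pselect (forall i, (a i < N)%N)) => [/exps_onto[b <-]|]; first by left; exists b.
move=> /existsNP[i /negP]; rewrite -leqNgt => Na; right.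
have -> : a = ((U_(i) *+ N) + (a - U_(i) *+ N))%MM.
  rewrite addmC submK //; apply/mnm_lepP => j; rewrite mulmnE mnm1E.
  by case: eqP => [<-|]; rewrite ?mul1n ?mul0n.
rewrite mmap1M mulrC; have [_ _] := ideal_genP yN; apply.
have -> : yp (U_(i) *+ N)%MM = y i ^+ N.
  by rewrite -substX -mpolyXn rmorphXn /= substU.
exact: ideal_gen_mem.
Qed.

(* Expansion in powers of [y]: if [U] is spanned by [z] modulo [y U] and [W], then
   it is spanned by the [z_i y^a], with [a] in the box, modulo [W]. *)
Lemma ypow_expansion (I : finType) (z : I -> A) (U W : A -> Prop) :
  is_ideal W -> (forall i, W (y i ^+ N)) ->
  (forall v, U v -> exists (c : I -> K) (s : 'I_n -> A), (forall j, U (s j)) /\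
     W (v - \sum_i c i *: z i - \sum_j s j * y j)) ->
  forall a v, U v -> exists2 c : I * box -> K,
    (forall q, (mdeg (exps q.2) < mdeg a)%N -> c q = 0) &
    W (yp a * v - \sum_q c q *: (z q.1 * yp (exps q.2))).
Proof.
move=> iW WyN H.
have [W0 WD WM] := iW.
have subW u : ideal_gen yN u -> W u by apply: ideal_gen_sub.
have addP (B : nat) u1 u2 :
   (exists2 c : I * box -> K, (forall q, (mdeg (exps q.2) < B)%N -> c q = 0) &
      W (u1 - \sum_q c q *: (z q.1 * yp (exps q.2)))) ->
   (exists2 c : I * box -> K, (forall q, (mdeg (exps q.2) < B)%N -> c q = 0) &
      W (u2 - \sum_q c q *: (z q.1 * yp (exps q.2)))) ->
   (exists2 c : I * box -> K, (forall q, (mdeg (exps q.2) < B)%N -> c q = 0) &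
      W (u1 + u2 - \sum_q c q *: (z q.1 * yp (exps q.2)))).
  move=> [c1 s1 w1] [c2 s2 w2]; exists (fun q => c1 q + c2 q).
    by move=> q qB; rewrite s1 // s2 // addr0.
  under eq_bigr do rewrite scalerDl.
  by rewrite big_split opprD addrACA; apply: WD.
have inW (B : nat) w : W w -> exists2 c : I * box -> K, (forall q, (mdeg (exps q.2) < B)%N -> c q = 0) &
      W (w - \sum_q c q *: (z q.1 * yp (exps q.2))).
  move=> Ww; exists (fun=> 0) => //; rewrite [X in _ - X](_ : _ = 0) ?subr0 //.
  by rewrite big1 // => q _; rewrite scale0r.
have zero (B : nat) : exists2 c : I * box -> K, (forall q, (mdeg (exps q.2) < B)%N -> c q = 0) &
      W (0 - \sum_q c q *: (z q.1 * yp (exps q.2))).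
  exact: inW.
(* The induction is on the room left in the box: once an exponent of [a] reaches [N], [y^a] lies in
   [W]. *)
move=> a v; have [M] := ubnP (n * N - mdeg a)%N; elim: M a v => // M IH a v aM Uv.
have [[b ab]|/subW Wa] := ypow_box_or a; last first.
  exists (fun=> 0) => //; rewrite big1 ?subr0 => [|q _]; last by rewrite scale0r.
  by rewrite mulrC; apply: WM.
have bN : (mdeg a < n * N)%N \/ n = 0%N.
  case: (posnP n) => [n0|n0]; [by right | left].
  rewrite ab mdeg_exps.
  have le : (\sum_(i < n) b i <= \sum_(i < n) N.-1)%N.
    by apply: leq_sum => i _; have := ltn_ord (b i); lia.
  apply: leq_ltn_trans le _; rewrite sum_nat_const card_ord ltn_pmul2l //.
  by have := ltn_ord (b (Ordinal n0)); lia.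
have [c [s [Us Wv]]] := H v Uv.
have -> : yp a * v = yp a * (v - \sum_i c i *: z i - \sum_j s j * y j)
   + (\sum_i c i *: (z i * yp a) + \sum_j yp (a + U_(j))%MM * s j).
  have -> : \sum_i c i *: (z i * yp a) = yp a * \sum_i c i *: z i.
    by rewrite mulr_sumr; apply: eq_bigr => i _; rewrite -scalerAr mulrC.
  have -> : \sum_j yp (a + U_(j))%MM * s j = yp a * \sum_j s j * y j.
    by rewrite mulr_sumr; apply: eq_bigr => j _; rewrite mmap1M mmap1U; ring.
  by rewrite -!mulrDr -[v - _ - _]addrA -opprD subrK.
apply: (addP); first exact/inW/WM.
apply: (addP).
  exists (fun q => if q.2 == b then c q.1 else 0).
    by move=> q; case: eqP => // ->; rewrite ab ltnn.
  rewrite -(pair_bigA _ (fun i t => (if t == b then c i else 0) *: (z i * yp (exps t)))) /=.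
  rewrite -sumrB big1 ?W0 // => i _; rewrite (bigD1 b) //= eqxx big1 ?addr0 ?ab ?subrr //.
  by move=> t /negPf ->; rewrite scale0r.
apply: (big_ind (fun u => exists2 c : I * box -> K, (forall q, (mdeg (exps q.2) < mdeg a)%N -> c q = 0) &
      W (u - \sum_q c q *: (z q.1 * yp (exps q.2))))) => //.
  exact: addP.
move=> j _; case: bN => [bN|n0]; last by move: (ltn_ord j); rewrite [X in (_ < X)%N]n0.
have [|c' s' w'] := IH (a + U_(j))%MM (s j) _ (Us j).
  by rewrite mdegD mdeg1; lia.
exists c' => // q qa; apply: s'; rewrite mdegD mdeg1; exact: ltn_addr.
Qed.

End Truncation.

(** * The quotient by the powers of the y_i *)

Section FrobeniusQuotient.
Context (K : fieldType) (n d : nat).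
Local Notation A := {mpoly K[n]}.
Context (y : 'I_n -> A).
Hypothesis d0 : (0 < d)%N.
Hypothesis ytop : forall j, top_term (U_(j) *+ d)%MM 1 (y j).
Local Notation yN N := (fun i => y i ^+ N).
Local Notation yp a := (mmap1 y a).
Local Notation box N := {ffun 'I_n -> 'I_N}.

Lemma ybasis_span_mod N : spans_mod (fun=> True) (ideal_gen (yN N))
  (fun q : box d * box N => 'X_[exps q.1] * yp (exps q.2)).
Proof.
move=> u _.
pose U (v : A) := True.
have H (v : A) : U v -> exists (c : box d -> K) (s : 'I_n -> A), (forall j, U (s j)) /\
    ideal_gen (yN N) (v - \sum_g c g *: 'X_[exps g] - \sum_j s j * y j).
  move=> _; have [c [s sE]] := @ybasis_span K n d y d0 ytop v Logic.I; exists c, s; split=> //.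
  by rewrite sE subrr; case: (ideal_genP (yN N)).
have [c _] := ypow_expansion (ideal_genP (yN N)) (ideal_gen_mem (yN N)) H 0%MM (Logic.I : U u).
by rewrite mmap11 mul1r => w; exists c.
Qed.

(* Modulo [(y_i^N)] the ideals [m^M] stabilize to an ideal generated by an idempotent. *)
Lemma exists_idempotent N : exists L0, forall M, exists2 e, in_m M e &
  forall v, in_m L0 v -> ideal_gen (yN N) (e * v - v).
Proof.
have iW := ideal_genP (yN N); have [W0 WD WM] := iW.
(* In the quotient [X_i^k q(X_i) = 0] with [q(0)] invertible; solving for the constant term of [q]
   shows that a multiple of [X_i] acts on [X_i^k] as the identity. *)
have H (i : 'I_n) : exists kw : nat * A, ideal_gen (yN N) ('X_i ^+ kw.1 - 'X_i ^+ kw.1 * ('X_i * kw.2)).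
  have [q [k [q0 Wq]]] := exists_power_relation 'X_i iW (@ybasis_span_mod N).
  have [q' qE] : exists q', q = q' * 'X + (q`_0)%:P.
    exists (Poly (drop 1 q)); apply/polyP => j; rewrite coefD coefMX coefC.
    by case: j => [|j] /=; rewrite ?add0r // addr0 coef_Poly nth_drop.
  exists (k, - ((q`_0)^-1%:MP * (map_poly (@mpolyC n K) q').['X_i])) => /=.
  move: Wq; rewrite {1}qE rmorphD rmorphM /= map_polyX map_polyC /= hornerD hornerMX hornerC.
  move/(WM (q`_0)^-1%:MP); set Q := _.[_].
  have inv : (q`_0)^-1%:MP * (q`_0)%:MP = 1 :> A by rewrite -mpolyCM mulVf.
  move: inv; move: (_^-1%:MP) (q`_0)%:MP => a b inv.
  have -> : a * ('X_i ^+ k * (Q * 'X_i + b)) = 'X_i ^+ k * (a * b) - 'X_i ^+ k * ('X_i * - (a * Q)) by ring.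
  by rewrite inv mulr1.
have [kw kwE] := exists_fun H.
pose k i := (kw i).1; pose eps M i := ('X_i * (kw i).2) ^+ M.
have epsE M i : ideal_gen (yN N) ((1 - eps M i) * 'X_i ^+ k i).
  elim: M => [|M IH]; first by rewrite /eps expr0 subrr mul0r.
  have -> : (1 - eps M.+1 i) * 'X_i ^+ k i =
     (1 - eps M i) * 'X_i ^+ k i + eps M i * ('X_i ^+ k i - 'X_i ^+ k i * ('X_i * (kw i).2)).
    by rewrite /eps exprS; ring.
  apply: WD => //; exact: (WM _ _ (kwE i)).
(* A monomial of this degree is divisible by some [X_i^(k i)], by the pigeonhole principle, and the
   factor [1 - eps M i] kills it. *)
exists (\sum_i k i).+1 => M.
exists (1 - \prod_i (1 - eps M i)).
  have [m0 mD mM] := @in_mP K n M.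
  rewrite -opprB; apply: (idealN (@in_mP K n M)).
  apply: (big_ind (fun u => in_m M (u - 1))).
  - by rewrite subrr.
  - move=> u v um vm; have -> : u * v - 1 = v * (u - 1) + (v - 1) by ring.
    by apply: mD => //; apply: mM.
  move=> i _; rewrite addrAC subrr add0r; apply: (idealN (@in_mP K n M)).
  rewrite /eps -[M in in_m M]mul1n; apply: in_m_exp; rewrite mulrC.
  by have [_ _] := @in_mP K n 1; apply; apply: in_mX; rewrite mdeg1.
move=> v vL; have -> : (1 - \prod_i (1 - eps M i)) * v - v = - (\prod_i (1 - eps M i)) * v by ring.
rewrite mulNr; apply: (idealN iW).
apply: (in_m_sum (T := fun v => ideal_gen (yN N) (\prod_i (1 - eps M i) * v)) _ vL).
  split; first by rewrite mulr0.
  - by move=> u1 u2 w1 w2; rewrite mulrDr; apply: WD.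
  - by move=> a u w; rewrite mulrCA; apply: WM.
move=> a aL.
have [i ai] : exists i, (k i <= a i)%N.
  apply: contrapT => no; move: aL; rewrite ltnNge mdegE => /negP; apply.
  by apply: leq_sum => i _; rewrite leqNgt; apply/negP => ki; apply: no; exists i; apply: ltnW.
have -> : a = (U_(i) *+ k i + (a - U_(i) *+ k i))%MM.
  rewrite addmC submK //; apply/mnm_lepP => j; rewrite mulmnE mnm1E.
  by case: eqP => [<-|]; rewrite ?mul1n ?mul0n.
rewrite mpolyXD -mpolyXn (bigD1 i) //= mulrACA; rewrite mulrC; apply: WM; exact: epsE.
Qed.

End FrobeniusQuotient.

(** * The dimension count for a fixed exponent *)

Section SlabCount.
Context (K : fieldType) (n d : nat).
Local Notation A := {mpoly K[n]}.
Context (y : 'I_n -> A).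
Hypothesis d0 : (0 < d)%N.
Hypothesis ytop : forall j, top_term (U_(j) *+ d)%MM 1 (y j).
Local Notation yN N := (fun i => y i ^+ N).
Local Notation yp a := (mmap1 y a).
Local Notation box N := {ffun 'I_n -> 'I_N}.
Context (mu : nat) (e : 'I_mu -> A) (L1 : nat).
Hypothesis e_span : forall L, spans_mod (fun=> True) (loc y L) e.
Hypothesis e_free : free_mod (loc y L1) e.

(** In the quotient by the [y_i^N], a high power of the maximal ideal is the part supported at the
    common zeros of [y] other than the origin. Its dimension is at most [(d^n - mu) N^n]: the
    quotient by [(y)] has dimension [d^n], of which the origin takes [mu]. *)
Lemma maximal_ideal_span N : exists L r (z : 'I_r -> A),
  (r + mu <= d ^ n)%N /\
  forall v, in_m L v -> exists c : 'I_r * box N -> K,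
    ideal_gen (yN N) (v - \sum_q c q *: (z q.1 * yp (exps q.2))).
Proof.
have [L0 idem] := exists_idempotent d0 ytop N.
pose L := maxn L0 L1; have iy := ideal_genP y.
have cardbox : #|{: box d}| = (d ^ n)%N by rewrite card_ffun !card_ord.
have [|r [z [zL zfree zspan]]] := @exists_basis_mod _ _ (in_m L) (ideal_gen y) (d ^ n) (ideal_subspace iy).
  move=> r z _ fr; rewrite -cardbox -(card_ord r).
  exact: (free_le_spans (ideal_subspace iy) (ybasis_span d0 ytop) fr).
exists L, r, z; split.
  rewrite addnC -cardbox -[mu]card_ord -[r]card_ord -card_sum.
  apply: (free_le_spans (ideal_subspace iy) (ybasis_span d0 ytop)
    (f := fun t : 'I_mu + 'I_r => match t with inl i => e i | inr i => z i end)).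
  move=> c; rewrite big_sumType /= => cy.
  have ce : forall i, c (inl i) = 0.
    apply: (e_free (c := fun i => c (inl i))).
    exists (\sum_i c (inl i) *: e i + \sum_i c (inr i) *: z i) => //.
    rewrite opprD addrA subrr add0r -sumrN; apply: ideal_sum => [|i _]; first exact: in_mP.
    rewrite -scaleNr -mul_mpolyC; have [_ _] := @in_mP K n L1; apply.
    by apply: in_m_le (zL i); apply: leq_maxr.
  move: cy; rewrite big1 ?add0r => [cy|i _]; last by rewrite ce scale0r.
  by case=> i //; apply: (zfree (fun i => c (inr i))).
have [iota iotaL iotaE] := idem L.
have H (v : A) : in_m L v -> exists (c : 'I_r -> K) (s : 'I_n -> A), (forall j, in_m L (s j)) /\
    ideal_gen (yN N) (v - \sum_i c i *: z i - \sum_j s j * y j).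
  move=> vL; have [c [s sE]] := zspan v vL.
  (* The idempotent acts as the identity on [m^L] modulo the [y_i^N]. It brings the cofactors of the
     [y j] into [m^L], so that the expansion can be repeated on them. *)
  exists c, (fun j => iota * s j); split=> [j|].
    by rewrite mulrC; have [_ _] := @in_mP K n L; apply.
  have [W0 WD WM] := ideal_genP (yN N).
  have small u : in_m L u -> ideal_gen (yN N) (iota * u - u).
    by move=> uL; apply: iotaE; apply: in_m_le uL; apply: leq_maxl.
  have -> : \sum_j iota * s j * y j = iota * (v - \sum_i c i *: z i).
    by rewrite sE mulr_sumr; apply: eq_bigr => j _; rewrite mulrA.
  rewrite -opprB; apply: (idealN (ideal_genP (yN N))); apply: small.
  have [m0 mD mM] := @in_mP K n L; apply: mD => //.
  rewrite -sumrN; apply: ideal_sum => [|i _]; first exact: in_mP.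
  by rewrite -scaleNr -mul_mpolyC; apply: mM.
move=> v vL.
have [c _] := ypow_expansion (ideal_genP (yN N)) (ideal_gen_mem (yN N)) H 0%MM vL.
by rewrite mmap11 mul1r => w; exists c.
Qed.

(** Each factor [y_j] of [v] is moved into the monomial [y^a] and raises its degree by one. *)
Lemma gpow_expansion N L b a v : gpow y b v -> exists2 c : 'I_mu * box N -> K,
  (forall q, (mdeg (exps q.2) < mdeg a + b)%N -> c q = 0) &
  loc (yN N) L (yp a * v - \sum_q c q *: (e q.1 * yp (exps q.2))).
Proof.
elim: b a v => [|b IH] a v.
  move=> _; rewrite addn0; pose U (v : A) := True.
  have H (u : A) : U u -> exists (c : 'I_mu -> K) (s : 'I_n -> A), (forall j, U (s j)) /\
     loc (yN N) L (u - \sum_i c i *: e i - \sum_j s j * y j).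
    move=> _; have [c [w [s wE] wm]] := @e_span L u Logic.I; exists c, s; split=> //.
    by rewrite -wE; apply: loc_m.
  exact: (ypow_expansion (locP (yN N) L) (fun i => loc_mem (yN N) L i) H a (Logic.I : U v)).
case=> w gw ->.
have {}IH j := IH (a + U_(j))%MM (w j) (gw j).
have H j : exists c : 'I_mu * box N -> K,
   (forall q, (mdeg (exps q.2) < mdeg a + b.+1)%N -> c q = 0) /\
   loc (yN N) L (yp (a + U_(j))%MM * w j - \sum_q c q *: (e q.1 * yp (exps q.2))).
  have [c c1 c2] := IH j; exists c; split=> // q qb.
  by apply: c1; rewrite mdegD mdeg1 addn1 addSn -addnS.
have [c cP] := exists_fun H.
exists (fun q => \sum_j c j q).
  by move=> q qb; rewrite big1 // => j _; have [-> //] := cP j.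
have -> : yp a * (\sum_i w i * y i) - \sum_q (\sum_j c j q) *: (e q.1 * yp (exps q.2))
    = \sum_j (yp (a + U_(j))%MM * w j - \sum_q c j q *: (e q.1 * yp (exps q.2))).
  rewrite sumrB; congr (_ - _).
    by rewrite mulr_sumr; apply: eq_bigr => j _; rewrite mmap1M mmap1U; ring.
  rewrite exchange_big /=; apply: eq_bigr => q _; exact: scaler_suml.
by apply: ideal_sum => [|j _]; [exact: locP | have [] := cP j].
Qed.

Context (F : A) (J : finType) (f : J -> A) (p k : nat).
Hypothesis p0 : (0 < p)%N.
Hypothesis Fk : forall L, exists2 u, gpow y k u & in_m L (F ^+ p - u).
Hypothesis f_span : forall L, spans_mod (fun=> True)
  (loc (fun o : option 'I_n => (if o is Some i then y i else F) ^+ p) L)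
  (fun q : J * box p => f q.1 ^+ p * 'X_[exps q.2]).

(** The four blocks of [fam] span the quotient by the [y_i^p], and [ybasis_free_mod] provides
    [d^n p^n] independent elements there. The block from [z] has [r p^n] members with
    [r + mu <= d^n], so the critical points away from the origin cancel from the comparison. *)
Theorem slab_count_le a : (k <= p)%N ->
  (mu * (box_count p n (a + k) - box_count p n a) <= #|J| * p ^ n)%N.
Proof.
move=> kp; have [L [r [z [rmu zspan]]]] := maximal_ideal_span p.
pose T2 : finType := {q : 'I_mu * box p | (mdeg (exps q.2) < a)%N}.
pose T3 : finType := {q : 'I_mu * box p | (a + k <= mdeg (exps q.2))%N}.
pose T : finType := ((J * box p + T2) + (T3 + 'I_r * box p))%type.
pose fam (t : T) : A := match t with
  | inl (inl q) => f q.1 ^+ p * 'X_[exps q.2]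
  | inl (inr q) => F ^+ p * (e (val q).1 * yp (exps (val q).2))
  | inr (inl q) => e (val q).1 * yp (exps (val q).2)
  | inr (inr q) => z q.1 * yp (exps q.2)
  end.
pose W := ideal_gen (yN p).
have iW : is_ideal W by apply: ideal_genP.
have [W0 WD WM] := iW; have sW := ideal_subspace iW.
pose Sp u := exists c : T -> K, W (u - \sum_t c t *: fam t).
have SpD u v : Sp u -> Sp v -> Sp (u + v).
  case=> c w [c' w']; exists (fun t => c t + c' t).
  under eq_bigr do rewrite scalerDl.
  by rewrite big_split opprD addrACA; apply: WD.
have SpZ x u : Sp u -> Sp (x *: u).
  case=> c w; exists (fun t => x * c t).
  under eq_bigr do rewrite -scalerA.
  by rewrite -scaler_sumr -scalerBr; apply: subspaceZ.
have SpW u : W u -> Sp u.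
  by exists (fun=> 0); rewrite big1 ?subr0 // => t _; rewrite scale0r.
have Sp0 : Sp 0 by apply: SpW.
have Spfam t : Sp (fam t).
  exists (fun t' => (t' == t)%:R); rewrite (bigD1 t) //= eqxx scale1r big1 ?addr0 ?subrr //.
  by move=> t' /negPf ->; rewrite scale0r.
have Sp_sum (I : finType) (G : I -> A) : (forall i, Sp (G i)) -> Sp (\sum_i G i).
  by move=> SG; apply: (big_ind Sp).
have Sp_m u : in_m L u -> Sp u.
  move=> /zspan[c w]; rewrite -[u](subrK (\sum_q c q *: (z q.1 * yp (exps q.2)))).
  apply: SpD; first exact: SpW.
  by apply: (Sp_sum) => q; apply/SpZ/(Spfam (inr (inr q))).
have Sp_loc u : loc (yN p) L u -> Sp u.
  case=> v Wv uv; rewrite -(subrK v u); apply: SpD; [exact: Sp_m | exact: SpW].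
have spanT : spans_mod (fun=> True) W fam.
  move=> u _; rewrite -/(Sp u).
  have [c [_ [x ->] um]] := @f_span L u Logic.I.
  rewrite -[u](subrK (\sum_q c q *: (f q.1 ^+ p * 'X_[exps q.2]))); apply: (SpD); last first.
    by apply: (Sp_sum) => q; apply/SpZ/(Spfam (inl (inl q))).
  rewrite -[_ - _](subrK (\sum_i x i * (if i is Some j then y j else F) ^+ p)).
  apply: (SpD); first exact: Sp_m.
  rewrite (bigD1 None) //=; apply: (SpD); last first.
    apply: SpW; apply: ideal_sum => // -[i|] // _.
    exact/WM/(ideal_gen_mem (yN p)).
  have [c1 _] := @gpow_expansion p L 0 0%MM (x None) Logic.I.
  rewrite mmap11 mul1r => w1.
  rewrite -[x None](subrK (\sum_q c1 q *: (e q.1 * yp (exps q.2)))) mulrDl; apply: (SpD).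
    by apply: Sp_loc; rewrite mulrC; have [_ _] := locP (yN p) L; apply.
  rewrite mulr_suml; apply: (Sp_sum) => q; rewrite -scalerAl mulrC; apply: (SpZ).
  case: (ltnP (mdeg (exps q.2)) a) => qa.
    exact: (Spfam (inl (inr (exist _ q qa)))).
  (* For a [y^b] of degree at least [a], the factor [F ^+ p] lies in the [k]-th power of [(y)] and
     lifts it to degree at least [a + k], where the third block takes over. *)
  have [G gG Gm] := Fk L; rewrite -(subrK G (F ^+ p)) mulrDl; apply: (SpD).
    by apply: Sp_m; rewrite mulrC; have [_ _] := @in_mP K n L; apply.
  have gG' : gpow y k (e q.1 * G) by have [_ _] := gpowP y k; apply.
  have [c2 c2E c2l] := @gpow_expansion p L k (exps q.2) _ gG'.
  have -> : G * (e q.1 * yp (exps q.2)) = yp (exps q.2) * (e q.1 * G) by ring.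
  rewrite -[X in Sp X](subrK (\sum_q c2 q *: (e q.1 * yp (exps q.2)))).
  apply: (SpD); first exact: Sp_loc.
  apply: (Sp_sum) => q'; case: (ltnP (mdeg (exps q'.2)) (a + k)) => qk.
    by rewrite c2E ?scale0r // (leq_trans qk) // leq_add2r.
  exact/SpZ/(Spfam (inr (inl (exist _ q' qk)))).
have := free_le_spans sW spanT (ybasis_free_mod d0 ytop (N := p)).
rewrite card_prod !card_sum !card_prod !card_sig !card_ord !card_ffun !card_ord.
have c2 : #|[pred q : 'I_mu * box p | (mdeg (exps q.2) < a)%N]| = (mu * box_count p n a)%N.
  rewrite (eq_card (B := finset.setX (finset.setT : {set 'I_mu}) [set b : box p | (mdeg (exps b) < a)%N])).
    by rewrite finset.cardsX finset.cardsT card_ord.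
  by case=> q1 q2; rewrite finset.in_setX !inE.
have c3 : (#|[pred q : 'I_mu * box p | (a + k <= mdeg (exps q.2))%N]|
    + mu * box_count p n (a + k) = mu * p ^ n)%N.
  have -> : (mu * p ^ n = #|{: 'I_mu * box p}|)%N by rewrite card_prod card_ffun !card_ord.
  rewrite -[RHS](cardC [pred q : 'I_mu * box p | (a + k <= mdeg (exps q.2))%N]); congr (_ + _)%N.
  rewrite [RHS](eq_card (B := finset.setX (finset.setT : {set 'I_mu})
    [set b : box p | (mdeg (exps b) < a + k)%N])).
    by rewrite finset.cardsX finset.cardsT card_ord.
  by case=> q1 q2; rewrite finset.in_setX !inE /= ltnNge.
rewrite c2; move: c3; set x3 := #|_|.
have mono := box_count_le p n (leq_addr k a).
have : (r * p ^ n + mu * p ^ n <= d ^ n * p ^ n)%N by rewrite -mulnDl leq_mul2r rmu orbT.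
rewrite mulnBr.
have : (mu * box_count p n a <= mu * box_count p n (a + k))%N by rewrite leq_mul2l mono orbT.
move: (mu * box_count p n a)%N (mu * box_count p n (a + k))%N (mu * p ^ n)%N (r * p ^ n)%N => x y1 y2 y3.
move: (d ^ n * p ^ n)%N (#|J| * p ^ n)%N => w1 w2; clear; lia.
Qed.

End SlabCount.

(** * Powers of the Tjurina ideal *)

Section GradientIdeal.
Context (K : fieldType) (n : nat).
Local Notation A := {mpoly K[n]}.

Definition gradient (F : A) (j : 'I_n) : A := F^`M(j).

Definition tjurina_gens (F : A) (o : option 'I_n) : A :=
  if o is Some j then gradient F j else F.

Lemma exists_inverse_mod L (u : A) : u@_0 != 0 -> exists w, in_m L (w * u - 1).
Proof.
move=> u0; pose c := (u@_0)^-1%:MP : A; pose t := 1 - c * u.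
exists (c * \sum_(i < L) t ^+ i).
have -> : c * (\sum_(i < L) t ^+ i) * u - 1 = - t ^+ L.
  have -> : c * (\sum_(i < L) t ^+ i) * u = (1 - t) * \sum_(i < L) t ^+ i by rewrite /t; ring.
  by rewrite -[1 - t]opprB mulNr -subrX1 opprB addrC addKr.
apply: (idealN (@in_mP K n L)); rewrite -[L in in_m L]mul1n; apply: in_m_exp.
move=> a; rewrite ltnS leqn0 mdeg_eq0 => /eqP ->.
by rewrite mcoeffB mcoeff1 eqxx mcoeffCM mulVf ?subrr.
Qed.

Lemma gpow_subst (y : 'I_n -> A) r s : wt 1 r s -> gpow y r (subst y s).
Proof.
move=> ws; have ip := gpowP y r; have [p0 pD pM] := ip.
have mono b (a : 'X_{1..n}) : (b <= mdeg a)%N -> gpow y b (mmap1 y a).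
  elim: b a => [|b IH] a ba //; have [|i [a' aE]] := @mnm_factor n a.
    by rewrite -mdeg_eq0 -lt0n (leq_trans _ ba).
  rewrite aE mmap1M mmap1U mulrC; apply: gpow_mulS; apply: IH.
  by move: ba; rewrite aE mdegD mdeg1 add1n ltnS.
rewrite [s]mpolyE big_seq rmorph_sum; apply: ideal_sum => // a.
rewrite mcoeff_msupp => /ws; rewrite mul1n => ra.
by rewrite /= substZ -mul_mpolyC substX; apply/pM/mono.
Qed.

Lemma tjurina_gpow_le (F : A) b u : gpow (gradient F) b u -> gpow (tjurina_gens F) b u.
Proof.
elim: b u => [|b IH] u // [v gv ->].
apply: ideal_sum => [|i _]; first exact: gpowP.
by apply: (gpow_mulS (g := tjurina_gens F) (Some i)); apply: IH; exact: gv.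
Qed.

(** The ideal [J I^b], with [J] generated by the gradient of [F] and [I = (F) + J]. *)
Definition grad_tjurina F b (u : A) :=
  exists2 v, (forall j, gpow (tjurina_gens F) b (v j)) & u = \sum_j v j * gradient F j.

Lemma grad_tjurinaP F b : is_ideal (grad_tjurina F b).
Proof.
have [p0 pD pM] := gpowP (tjurina_gens F) b; split.
- by exists (fun=> 0) => //; rewrite big1 // => i _; rewrite mul0r.
- move=> u w [v1 gv1 ->] [v2 gv2 ->]; exists (fun i => v1 i + v2 i).
    by move=> i; apply: pD.
  by rewrite -big_split; apply: eq_bigr => i _; rewrite mulrDl.
- move=> a u [v gv ->]; exists (fun i => a * v i) => [i|]; first exact: pM.
  by rewrite mulr_sumr; apply: eq_bigr => i _; rewrite mulrA.
Qed.

(** [I^b = (F^b) + J I^(b-1)], which leaves only a power of [F] to be reduced; for [b = 0] the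
    second summand is 0. *)
Lemma gpow_tjurina_split F b u : gpow (tjurina_gens F) b u ->
  exists x t, u = x * F ^+ b + t /\ (if b is b'.+1 then grad_tjurina F b' t else t = 0).
Proof.
elim: b u => [|b IH] u; first by move=> _; exists u, 0; rewrite expr0 mulr1 addr0.
case=> v gv ->; have [x [t [vE tP]]] := IH _ (gv None).
have e : \sum_i v i * tjurina_gens F i = v None * F + \sum_j v (Some j) * gradient F j.
  rewrite (bigD1 None) //=; congr (_ + _).
  rewrite (reindex_omap Some id) /=; last by case.
  by apply: eq_bigl => j; rewrite eqxx.
exists x, (t * F + \sum_j v (Some j) * gradient F j); split.
  by rewrite e vE exprSr; ring.
have [_ gD _] := grad_tjurinaP F b; apply: gD; last by exists (fun j => v (Some j)) => // j; exact: gv.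
case: b {IH} gv vE tP => [|b] gv vE tP; first by rewrite tP mul0r; case: (grad_tjurinaP F 0).
case: tP => w gw ->; exists (fun j => w j * F) => [j|].
  exact: (gpow_mulS (g := tjurina_gens F) None).
by rewrite mulr_suml; apply: eq_bigr => j _; rewrite mulrAC.
Qed.

(** The integral equation puts [(F * Q) ^+ m.+1] into [J I^m]. Since [F] vanishes at the origin, the
    constant term of [Q] is that of [q], and [Q] can be inverted modulo [m^L]. The exponent [m] is
    independent of [L]. *)
Lemma gpow_tjurina_reduction d (F : A) : [pchar K] =i pred0 -> (0 < d)%N ->
  (forall j, top_term (U_(j) *+ d)%MM 1 (gradient F j)) -> F@_0 = 0 ->
  exists m, forall L u, gpow (tjurina_gens F) m.+1 u ->
    exists2 v, grad_tjurina F m v & in_m L (u - v).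
Proof.
move=> K0 d0 ytop F0.
have [q [m [chi [q0 chi1 wchi rel]]]] := gradient_integral K0 d0 ytop.
exists m => L u /gpow_tjurina_split[x [t [-> tP]]].
have [g0 gD gM] := grad_tjurinaP F m; have [m0 mD mM] := @in_mP K n L.
set Q := (map_poly _ _).[F] in rel.
suff [v gv Fv] : exists2 v, grad_tjurina F m v & in_m L (F ^+ m.+1 - v).
  exists (x * v + t); first by apply: gD => //; apply: gM.
  have -> : x * F ^+ m.+1 + t - (x * v + t) = x * (F ^+ m.+1 - v) by ring.
  exact: mM.
have gG : grad_tjurina F m (F ^+ m.+1 * Q ^+ m.+1).
  move: rel; rewrite big_ord_recr /= chi1 rmorph1 mul1r -exprMn => /eqP.
  rewrite addrC addr_eq0 => /eqP ->; apply: (idealN (grad_tjurinaP F m)).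
  apply: ideal_sum => [|i _]; first exact: grad_tjurinaP.
  have im := ltn_ord i; rewrite ltnS in im.
  have := @gpow_subst (gradient F) _ _ (wchi i (leqW im)); rewrite subSn // => -[v gv ->].
  rewrite exprMn mulrA mulrC; apply: gM; exists (fun j => v j * F ^+ i) => [j|].
    rewrite -[X in gpow _ X](subnK im); apply: gpowM; first exact/tjurina_gpow_le/gv.
    elim: (i : nat) => // l IH; rewrite exprSr.
    exact: (gpow_mulS (g := tjurina_gens F) None).
  by rewrite mulr_suml; apply: eq_bigr => j _; rewrite mulrAC.
have [|w wQ] := @exists_inverse_mod L (Q ^+ m.+1).
  have Q0 : Q@_0 = q`_0.
    by rewrite /Q -horner_map /= F0 horner_coef0 !coef_map /= mcoeffC eqxx mulr1.
  by rewrite rmorphXn /= Q0 expf_neq0.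
exists (w * (F ^+ m.+1 * Q ^+ m.+1)); first exact: gM.
have -> : F ^+ m.+1 - w * (F ^+ m.+1 * Q ^+ m.+1) = - (F ^+ m.+1 * (w * Q ^+ m.+1 - 1)) by ring.
by apply: (idealN (@in_mP K n L)); apply: mM.
Qed.

End GradientIdeal.

(** * Changing the approximation, and containments at the origin *)

Section Reduction.
Context (K : fieldType) (n : nat).
Local Notation A := {mpoly K[n]}.

Lemma gpow_congr (I I' : finType) (g : I -> A) (g' : I' -> A) L :
  (forall i, loc g' L (g i)) ->
  forall b u, gpow g b u -> exists2 u', gpow g' b u' & in_m L (u - u').
Proof.
move=> gg'; have [m0 mD mM] := @in_mP K n L.
have H i : exists h, ideal_gen g' h /\ in_m L (g i - h) by have [h] := gg' i; exists h.
have [h hP] := exists_fun H.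
elim=> [|b IH] u; first by exists u => //; rewrite subrr.
case=> v gv ->.
have {}IH i : exists v', gpow g' b v' /\ in_m L (v i - v') by have [w] := IH _ (gv i); exists w.
have [v' vP] := exists_fun IH.
exists (\sum_i v' i * h i).
  apply: ideal_sum => [|i _]; first exact: gpowP.
  rewrite -addn1; apply: gpowM; first by case: (vP i).
  by apply/gpow1P; case: (hP i).
rewrite -sumrB; apply: ideal_sum => // i _.
have -> : v i * g i - v' i * h i = g i * (v i - v' i) + v' i * (g i - h i) by ring.
by apply: mD; apply: mM; [case: (vP i) | case: (hP i)].
Qed.

Section Transfer.
Context (F1 F2 : A) (D m : nat).
Local Notation tg1 := (tjurina_gens F1).
Local Notation tg2 := (tjurina_gens F2).
Hypothesis hD1 : forall a, mdeg a = D -> loc tg1 D.+1 'X_[a].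
Hypothesis hD2 : forall a, mdeg a = D -> loc tg2 D.+1 'X_[a].
Hypothesis F12 : forall o, in_m D.+1 (tg1 o - tg2 o).
Hypothesis red1 : forall L u, gpow tg1 m.+1 u ->
  exists2 v, grad_tjurina F1 m v & in_m L (u - v).

Let loc_mD1 L u : in_m D u -> loc tg1 L u.
Proof. exact: Nakayama_monomials. Qed.

Let loc_mD2 L u : in_m D u -> loc tg2 L u.
Proof. exact: Nakayama_monomials. Qed.

Let loc_mDS L u : in_m D.+1 u -> exists rho : 'I_n -> A,
  (forall i, gpow tg2 1 (rho i)) /\ in_m L (u - \sum_i 'X_i * rho i).
Proof.
have [m0 mD mM] := @in_mP K n L; have [p0 pD pM] := gpowP tg2 1.
move=> uD; apply: (@in_m_sum K n (fun u => exists rho : 'I_n -> A,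
  (forall i, gpow tg2 1 (rho i)) /\ in_m L (u - \sum_i 'X_i * rho i)) D.+1) => //.
  split.
  - exists (fun=> 0); split=> [i|]; first exact: p0.
    by rewrite big1 ?subr0 // => i _; rewrite mulr0.
  - move=> u1 u2 [r1 [g1 w1]] [r2 [g2 w2]]; exists (fun i => r1 i + r2 i); split=> [i|].
      exact: pD.
    under eq_bigr do rewrite mulrDr.
    by rewrite big_split opprD addrACA; apply: mD.
  - move=> a u1 [r1 [g1 w1]]; exists (fun i => a * r1 i); split=> [i|]; first exact: pM.
    under eq_bigr do rewrite mulrCA.
    by rewrite -mulr_sumr -mulrBr; apply: mM.
move=> a aD.
have [|i [b aE]] := @mnm_factor n a; first by rewrite -mdeg_eq0 -lt0n (leq_trans _ aD).
have bD : (D <= mdeg b)%N by move: aD; rewrite aE mdegD mdeg1 add1n ltnS.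
have [v gv vm] := loc_mD2 L (in_mX K bD).
exists (fun j => if j == i then v else 0); split=> [j|].
  by case: eqP => _; [apply/gpow1P | exact: p0].
rewrite (bigD1 i) //= eqxx big1 ?addr0 => [|j /negPf ->]; last by rewrite mulr0.
by rewrite aE mpolyXD -mulrBr; apply: mM.
Qed.

(** Modulo [m^L] the two polynomials have the same Tjurina ideal [I]. Their gradients differ by
    elements of [m^(D+1)], hence of [m I], so replacing one gradient by the other in [J I^m] leaves
    an error in [m I^(m+1)]. *)
Let step L u : gpow tg2 m.+1 u -> exists t (w : 'I_n -> A),
  [/\ grad_tjurina F2 m t, forall i, gpow tg2 m.+1 (w i)
    & in_m L (u - (t + \sum_i 'X_i * w i))].
Proof.
have iL := @in_mP K n L; have [m0 mD mM] := iL.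
have F12' o : in_m D (tg1 o - tg2 o) by apply: in_m_le (F12 o); apply: leqnSn.
have l12 o : loc tg1 L (tg2 o).
  have -> : tg2 o = tg1 o - (tg1 o - tg2 o) by rewrite subKr.
  by apply: (idealB (locP _ _)); [apply: loc_mem | apply/loc_mD1/F12'].
have l21 o : loc tg2 L (tg1 o).
  rewrite -(subrK (tg2 o) (tg1 o)); have [_ lD _] := locP tg2 L.
  by apply: lD; [apply/loc_mD2/F12' | apply: loc_mem].
move=> /(gpow_congr l12)[u1 /(red1 L)[_ [v gv ->] vm] um].
have H j : exists v', gpow tg2 m v' /\ in_m L (v j - v') by have [w] := gpow_congr l21 (gv j); exists w.
have [v' vP] := exists_fun H.
have [rho rhoP] := exists_fun (fun j => loc_mDS L (F12 (Some j))).
exists (\sum_j v' j * gradient F2 j), (fun i => \sum_j v' j * rho j i); split.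
- by exists v' => // j; case: (vP j).
- move=> i; apply: ideal_sum => [|j _]; first exact: gpowP.
  by rewrite -addn1; apply: gpowM; [case: (vP j) | case: (rhoP j)].
rewrite -(subrK u1 u) -addrA; apply: (mD) => //.
rewrite -(subrK (\sum_j v j * gradient F1 j) u1) -addrA; apply: (mD) => //.
have -> : \sum_i 'X_i * (\sum_j v' j * rho j i) = \sum_j v' j * \sum_i 'X_i * rho j i.
  under eq_bigr do rewrite mulr_sumr.
  rewrite exchange_big; apply: eq_bigr => j _; rewrite mulr_sumr.
  by apply: eq_bigr => i _; rewrite mulrCA.
rewrite -big_split -sumrB; apply: ideal_sum => [|j _] /=; first exact: iL.
have [_ vm'] := vP j; have [_ rm] := rhoP j.
move: vm' rm; rewrite /=; set r := \sum_i _ => vm' rm.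
have -> : v j * gradient F1 j - (v' j * gradient F2 j + v' j * r)
  = gradient F1 j * (v j - v' j) + v' j * (gradient F1 j - gradient F2 j - r) by ring.
by apply: mD; apply: mM.
Qed.

(* The error terms gain a factor in the maximal ideal at each step. *)
Lemma gpow_tjurina_transfer L u : gpow tg2 m.+1 u ->
  exists2 v, grad_tjurina F2 m v & in_m L (u - v).
Proof.
have [m0 mD mM] := @in_mP K n L; have [g0 gD gM] := grad_tjurinaP F2 m.
suff claim k a u' : (L - mdeg a <= k)%N -> gpow tg2 m.+1 u' ->
    exists t, grad_tjurina F2 m t /\ in_m L ('X_[a] * u' - t).
  move=> /(claim L 0%MM)[|t [gt tm]]; first by rewrite leq_subr.
  by exists t => //; rewrite mpolyX0 mul1r in tm.
elim: k a u' => [|k IH] a u' ak gu.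
  exists 0; split=> //; rewrite subr0 mulrC; apply: mM; apply: in_mX.
  by move: ak; rewrite leqn0 subn_eq0.
have [t [w [gt gw um]]] := step L gu.
have H i : exists t', grad_tjurina F2 m t' /\ in_m L ('X_[a + U_(i)] * w i - t').
  by apply: IH; [rewrite mdegD mdeg1; move: ak; clear; lia | exact: gw].
have [t' tP] := exists_fun H.
exists ('X_[a] * t + \sum_i t' i); split.
  apply: gD; first exact: gM.
  by apply: ideal_sum => [|i _]; [exact: grad_tjurinaP | case: (tP i)].
have -> : 'X_[a] * u' - ('X_[a] * t + \sum_i t' i)
  = 'X_[a] * (u' - (t + \sum_i 'X_i * w i)) + \sum_i ('X_[a + U_(i)] * w i - t' i).
  have -> : \sum_i ('X_[a + U_(i)] * w i - t' i)
     = 'X_[a] * (\sum_i 'X_i * w i) - \sum_i t' i.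
    rewrite sumrB mulr_sumr; congr (_ - _); apply: eq_bigr => i _.
    by rewrite mpolyXD mulrA.
  by move: (\sum_i 'X_i * w i) (\sum_i t' i) => p q; ring.
by apply: mD; [apply: mM | apply: ideal_sum => [|i _]; [exact: in_mP | case: (tP i)]].
Qed.

End Transfer.

Section Consequences.
Context (F : A) (D m : nat).
Local Notation tg := (tjurina_gens F).
Hypothesis hD : forall a, mdeg a = D -> loc tg D.+1 'X_[a].
Hypothesis red : forall L u, gpow tg m.+1 u ->
  exists2 v, grad_tjurina F m v & in_m L (u - v).

Lemma monom_gpow_tjurina L k a : (D * k <= mdeg a)%N ->
  exists2 u, gpow tg k u & in_m L ('X_[a] - u).
Proof.
have [m0 mD mM] := @in_mP K n L.
elim: k a => [|k IH] a ak; first by exists 'X_[a]; rewrite ?subrr.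
have [b [c [aE bD]]] : exists b c, a = (b + c)%MM /\ mdeg b = D.
  by apply: monom_split; apply: leq_trans ak; rewrite leq_pmulr.
have [u gu um] : exists2 u, gpow tg k u & in_m L ('X_[c] - u).
  by apply: IH; move: ak; rewrite aE mdegD bD mulnS leq_add2l.
have [v gv vm] := Nakayama_monomials hD L (in_mX K (eq_leq (esym bD))).
exists (v * u); first by rewrite -add1n; apply: gpowM => //; apply/gpow1P.
rewrite aE mpolyXD.
have -> : 'X_[b] * 'X_[c] - v * u = 'X_[c] * ('X_[b] - v) + v * ('X_[c] - u) by ring.
by apply: mD; apply: mM.
Qed.

(** Near the origin [m^D] lies in [I], and [I^(m+1)] lies in [J]; this is where the exponent
    [D * m.+1] comes from. *)
Lemma monom_loc_gradient L a : (D * m.+1 <= mdeg a)%N -> loc (gradient F) L 'X_[a].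
Proof.
move=> /(monom_gpow_tjurina L)[u /(red L)[_ [v _ ->] um] au].
exists (\sum_j v j * gradient F j); first by exists v.
have [_ mD _] := @in_mP K n L.
by rewrite -(subrK u 'X_[a]) -addrA; apply: mD.
Qed.

(** The ideal [J^k I^m], through which [I^(m+k)] is brought into [J^k] one factor at a time. *)
Fixpoint gradient_tjurina_power k (u : A) : Prop :=
  if k is k'.+1 then
    exists2 v, (forall j, gradient_tjurina_power k' (v j)) & u = \sum_j v j * gradient F j
  else gpow tg m u.

Lemma gradient_tjurina_powerP k : is_ideal (gradient_tjurina_power k).
Proof.
elim: k => [|k [g0 gD gM]] /=; [exact: gpowP | split].
- by exists (fun=> 0) => //; rewrite big1 // => i _; rewrite mul0r.
- move=> u w [v1 gv1 ->] [v2 gv2 ->]; exists (fun i => v1 i + v2 i).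
    by move=> i; apply: gD.
  by rewrite -big_split; apply: eq_bigr => i _; rewrite mulrDl.
- move=> a u [v gv ->]; exists (fun i => a * v i) => [i|]; first exact: gM.
  by rewrite mulr_sumr; apply: eq_bigr => i _; rewrite mulrA.
Qed.

Lemma gradient_tjurina_power_mul L k u o : gradient_tjurina_power k u ->
  exists2 v, gradient_tjurina_power k.+1 v & in_m L (u * tg o - v).
Proof.
elim: k u => [|k IH] u; first by move=> /(gpow_mulS o)/(red L)[v gv uv]; exists v.
case=> v gv ->.
have H j : exists w, gradient_tjurina_power k.+1 w /\ in_m L (v j * tg o - w).
  by have [w] := IH _ (gv j); exists w.
have [w wP] := exists_fun H.
exists (\sum_j w j * gradient F j); first by exists w => // j; case: (wP j).
rewrite mulr_suml -sumrB; apply: ideal_sum => [|j _]; first exact: in_mP.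
have -> : v j * gradient F j * tg o - w j * gradient F j
  = gradient F j * (v j * tg o - w j) by ring.
by have [_ _] := @in_mP K n L; apply; case: (wP j).
Qed.

Lemma gpow_tjurina_gradient L k u : gpow tg (m + k) u ->
  exists2 v, gpow (gradient F) k v & in_m L (u - v).
Proof.
have iL := @in_mP K n L; have [m0 mD mM] := iL.
suff claim : gpow tg (m + k) u -> exists2 v, gradient_tjurina_power k v & in_m L (u - v).
  move/claim => -[v gv uv]; exists v => //.
  elim: k v gv {claim uv} => // k IH _ [v gv ->]; exists v => // j; exact/IH/gv.
elim: k u => [|k IH] u; first by rewrite addn0 => gu; exists u; rewrite ?subrr.
rewrite addnS => -[v gv ->].
have H o : exists w, gradient_tjurina_power k.+1 w /\ in_m L (v o * tg o - w).
  have [w gw vw] := IH _ (gv o).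
  have [w' gw' ww] := gradient_tjurina_power_mul L o gw; exists w'; split=> //.
  have -> : v o * tg o - w' = tg o * (v o - w) + (w * tg o - w') by ring.
  by apply: (mD) => //; apply: mM.
have [w wP] := exists_fun H.
exists (\sum_o w o).
  by apply: ideal_sum => [|o _]; [exact: gradient_tjurina_powerP | case: (wP o)].
by rewrite -sumrB; apply: ideal_sum => [|o _]; [exact: iL | case: (wP o)].
Qed.

Lemma exp_gpow_gradient L p : (m <= p)%N ->
  exists2 u, gpow (gradient F) (p - m) u & in_m L (F ^+ p - u).
Proof.
move=> mp; apply: gpow_tjurina_gradient; rewrite subnKC //.
elim: p {mp} => // p IH; rewrite exprSr; exact: (gpow_mulS (g := tg) None).
Qed.

End Consequences.

End Reduction.

(** * From polynomials to power series *)

Section Series.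
Context (K : fieldType) (n : nat).
Local Notation A := {mpoly K[n]}.
Local Notation S := {mpseries K[n]}.

Definition ord L (u : S) := forall a, (mdeg a < L)%N -> pscoeff u a = 0.

Definition agree L (u : S) (g : A) := forall a, (mdeg a < L)%N -> pscoeff u a = g@_a.

Definition series_of (g : A) : S := MPSeries (fun a => g@_a).

Lemma agree_series_of L g : agree L (series_of g) g.
Proof. by []. Qed.

Lemma agree_trunc L u : agree L u (mps_trunc L u).
Proof. by move=> a aL; rewrite mcoeff_trunc. Qed.

Lemma agree_truncP L u g : agree L u g <-> in_m L (mps_trunc L u - g).
Proof.
split=> H a aL; first by rewrite mcoeffB mcoeff_trunc // H // subrr.
by have /eqP := H a aL; rewrite mcoeffB mcoeff_trunc // subr_eq0 => /eqP.
Qed.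

Lemma agree_le L L' u g : (L' <= L)%N -> agree L u g -> agree L' u g.
Proof. by move=> le H a aL; apply: H; apply: leq_trans le. Qed.

Lemma ord_le L L' u : (L' <= L)%N -> ord L u -> ord L' u.
Proof. by move=> le H a aL; apply: H; apply: leq_trans le. Qed.

Lemma agree_in_m L u g h : agree L u g -> agree L u h -> in_m L (g - h).
Proof. by move=> ug uh a aL; rewrite mcoeffB -ug // -uh // subrr. Qed.

Lemma in_m_agree L u g h : agree L u g -> in_m L (g - h) -> agree L u h.
Proof.
move=> ug gh a aL; rewrite ug //; apply/eqP; rewrite -subr_eq0 -mcoeffB.
by rewrite gh.
Qed.

Lemma agree_ord L u v g : agree L u g -> agree L v g -> ord L (u - v).
Proof. by move=> ug vg a aL; rewrite /= ug // vg // subrr. Qed.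

Lemma ord_agree L u : ord L u <-> agree L u 0.
Proof. by split=> H a aL; rewrite H ?mcoeff0. Qed.

Lemma agreeD L u v g h : agree L u g -> agree L v h -> agree L (u + v) (g + h).
Proof. by move=> ug vh a aL; rewrite /= mcoeffD ug // vh. Qed.

Lemma agreeB L u v g h : agree L u g -> agree L v h -> agree L (u - v) (g - h).
Proof. by move=> ug vh a aL; rewrite /= mcoeffB ug // vh. Qed.

Lemma agreeZ L c u g : agree L u g -> agree L (c *: u) (c *: g).
Proof. by move=> ug a aL; rewrite /= mcoeffZ ug. Qed.

Lemma agree_sum L (I : finType) (u : I -> S) (g : I -> A) :
  (forall i, agree L (u i) (g i)) -> agree L (\sum_i u i) (\sum_i g i).
Proof.
move=> ug; apply: (big_ind2 (agree L)) => //; last by move=> x1 x2 y1 y2; apply: agreeD.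
by move=> a _; rewrite mcoeff0.
Qed.

Lemma agreeM L u v g h : agree L u g -> agree L v h -> agree L (u * v) (g * h).
Proof.
move=> /agree_truncP ug /agree_truncP vh.
suff H : in_m L (mps_trunc L u * mps_trunc L v - g * h).
  move=> a aL; rewrite [LHS](pscoeffM_trunc u v aL).
  by apply/eqP; rewrite -subr_eq0 -mcoeffB H.
have [_ mD mM] := @in_mP K n L.
have -> : mps_trunc L u * mps_trunc L v - g * h
  = mps_trunc L v * (mps_trunc L u - g) + g * (mps_trunc L v - h) by ring.
by apply: mD; apply: mM.
Qed.

Lemma ordP L : is_ideal (ord L).
Proof.
split=> [a _|u v uL vL a aL|u v /ord_agree vL] //; first by rewrite /= uL // vL // addr0.
apply/ord_agree; rewrite -(mulr0 (mps_trunc L u)); apply: (agreeM) => //.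
exact: agree_trunc.
Qed.

Lemma ordM L L' u v : ord L u -> ord L' v -> ord (L + L') (u * v).
Proof.
move=> uL vL.
have trunc_m k k' (w : S) : ord k w -> in_m k (mps_trunc k' w).
  move=> wk a ak; case: (ltnP (mdeg a) k') => ak'; first by rewrite mcoeff_trunc ?wk.
  rewrite /mps_trunc raddf_sum big1 //= => i _; rewrite mcoeffZ mcoeffX.
  case: (bmnm i =P a) => [ia|]; last by rewrite mulr0.
  by move: ak'; rewrite -ia leqNgt bmdeg.
have uv := agreeM (@agree_trunc (L + L') u) (@agree_trunc (L + L') v).
by move=> a aL; rewrite uv // (in_mM (trunc_m _ _ _ uL) (trunc_m _ _ _ vL)).
Qed.

Section Ideals.
Context (I : finType) (G : I -> S) (g : I -> A) (d : nat).
Hypothesis Gg : forall i, agree d (G i) (g i).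

Lemma ideal_gen_agree u h : ideal_gen G u -> agree d u h -> loc g d h.
Proof.
move=> [a ->] uh; exists (\sum_i mps_trunc d (a i) * g i); first by exists (fun i => mps_trunc d (a i)).
apply: (agree_in_m uh); apply: agree_sum => i; apply: (agreeM) => //; exact: agree_trunc.
Qed.

Lemma loc_agree h : loc g d h -> exists2 u, ideal_gen G u & agree d u h.
Proof.
move=> [_ [a ->] hm]; exists (\sum_i series_of (a i) * G i).
  by exists (fun i => series_of (a i)).
have e : agree d (\sum_i series_of (a i) * G i) (\sum_i a i * g i).
  by apply: agree_sum => i; apply: (agreeM) => //; apply: agree_series_of.
by apply: (in_m_agree e); rewrite -opprB; apply: (idealN (@in_mP K n d)).
Qed.

End Ideals.

Section Completeness.
Context (I : finType) (G : I -> S) (D : nat).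
Hypothesis GD : forall a, mdeg a = D -> exists2 u, ideal_gen G u & agree D.+1 u 'X_[a].

Let step k v : ord (D + k) v -> exists s : I -> S,
  (forall i, ord k (s i)) /\ ord (D + k).+1 (v - \sum_i s i * G i).
Proof.
move=> vo.
pose T (u : A) := exists s : I -> S, (forall i, ord k (s i)) /\
  agree (D + k).+1 (\sum_i s i * G i) u.
have [o0 oD oM] := ordP k.
have iT : is_ideal T.
  split.
  - exists (fun=> 0); split=> // a _; rewrite big1 ?mcoeff0 // => i _; exact: mul0r.
  - move=> u1 u2 [s1 [o1 a1]] [s2 [o2 a2]]; exists (fun i => s1 i + s2 i); split=> [i|].
      exact: oD.
    under eq_bigr do rewrite mulrDl.
    by rewrite big_split; apply: agreeD.
  - move=> a u [s [os us]]; exists (fun i => series_of a * s i); split=> [i|]; first exact: oM.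
    under eq_bigr do rewrite -mulrA.
    by rewrite -mulr_sumr; apply: (agreeM) => //; apply: agree_series_of.
have tm : in_m (D + k) (mps_trunc (D + k).+1 v).
  by move=> a aL; rewrite mcoeff_trunc ?vo // ltnS ltnW.
have [|s [os us]] := in_m_sum iT tm.
  move=> a aL; have [b [c [aE bD]]] := monom_split (leq_trans (leq_addr k D) aL).
  have [_ [t ->] ut] := GD bD.
  have oc : ord k (series_of 'X_[c]).
    move=> e ek; rewrite /= mcoeffX; case: (c =P e) => // ce.
    by move: aL ek; rewrite aE mdegD bD leq_add2l ce ltnNge => ->.
  exists (fun i => series_of 'X_[c] * t i); split=> [i|]; first by rewrite mulrC; apply: oM.
  under eq_bigr do rewrite -mulrA.
  rewrite -mulr_sumr mulrC aE mpolyXD; set w := \sum_i _ in ut *.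
  have : ord (D.+1 + k) ((w - series_of 'X_[b]) * series_of 'X_[c]).
    by apply: ordM => //; apply: (agree_ord ut); apply: agree_series_of.
  rewrite addSn mulrBl => /ord_agree H; rewrite -[w * _](subrK (series_of 'X_[b] * series_of 'X_[c])).
  by rewrite -['X_[b] * _]add0r; apply: agreeD => //; apply: agreeM; apply: agree_series_of.
exists s; split=> //; apply: agree_ord us; exact: agree_trunc.
Qed.

(** The analogue of [Nakayama_monomials] for series: completeness lets the successive corrections
    converge, so membership is exact and not only modulo powers of the maximal ideal. *)
Lemma ideal_gen_complete v : ord D v -> ideal_gen G v.
Proof.
move=> vD.
have H (q : nat * S) : exists s : I -> S, ord (D + q.1) q.2 ->
    (forall i, ord q.1 (s i)) /\ ord (D + q.1).+1 (q.2 - \sum_i s i * G i).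
  case: (pselect (ord (D + q.1) q.2)) => [/step[s sP]|no]; first by exists s.
  by exists (fun=> 0).
have [s sP] := exists_fun H.
pose w := fix w k := if k is k'.+1 then w k' - \sum_i s (k', w k') i * G i else v.
have wo k : ord (D + k) (w k).
  elim: k => [|k IH]; first by rewrite addn0.
  by rewrite addnS; have [] := sP (k, w k) IH.
pose sk (k : nat) i := s (k, w k) i.
have so k i : ord k (sk k i) by have [so _] := sP (k, w k) (wo k); apply: so.
(* The [k]-th correction has order at least [k], so only those with [k <= mdeg a] reach the
   coefficient at [a]. *)
pose t i : S := MPSeries (fun a => \sum_(k < (mdeg a).+1) pscoeff (sk k i) a).
exists t; apply: mpseriesP => a; set N := (mdeg a).+1.
have tE i : ord N (t i - \sum_(k < N) sk k i).
  move=> b bN.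
  have -> : pscoeff (t i - \sum_(k < N) sk k i) b
     = pscoeff (t i) b - \sum_(k < N) pscoeff (sk k i) b.
    by rewrite /= (big_morph (fun u : S => pscoeff u b) (id1 := 0) (op1 := +%R)).
  rewrite /= (big_ord_widen N (fun k => pscoeff (sk k i) b)) //.
  rewrite [X in X - _]big_mkcond -sumrB big1 // => k _.
  case: ltnP => kb; first by rewrite subrr.
  by rewrite so ?subrr.
have wE k : w k = v - \sum_i (\sum_(l < k) sk l i) * G i.
  elim: k => [|k IH].
    by rewrite big1 ?subr0 // => i _; rewrite big_ord0 mul0r.
  have -> : w k.+1 = w k - \sum_i sk k i * G i by [].
  rewrite IH -addrA -opprD -big_split; congr (_ - _); apply: eq_bigr => i _.
  by rewrite big_ord_recr mulrDl.
have o1 : ord N (v - \sum_i (\sum_(l < N) sk l i) * G i).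
  by rewrite -wE => b bN; apply: (wo N); apply: leq_trans bN (leq_addl _ _).
have o2 : ord N (\sum_i t i * G i - \sum_i (\sum_(l < N) sk l i) * G i).
  have iN := ordP N; rewrite -sumrB; apply: ideal_sum => // i _.
  by rewrite -mulrBl mulrC; have [_ _] := iN; apply.
have : ord N (v - \sum_i t i * G i).
  by rewrite -(subrKA (\sum_i (\sum_(l < N) sk l i) * G i)) -[X in _ + X]opprB; apply: (idealB (ordP N)).
by move=> /(_ a (ltnSn _)) /eqP; rewrite /= subr_eq0 => /eqP.
Qed.

End Completeness.

End Series.

(** * Polynomial approximations of the series *)

Section Approximation.
Context (K : fieldType) (n : nat).
Hypothesis K0 : [pchar K] =i pred0.
Local Notation A := {mpoly K[n]}.
Local Notation S := {mpseries K[n]}.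
Context (f : S).
Hypothesis f0 : ord 2 f.

Definition tjurina_series (o : option 'I_n) : S :=
  if o is Some j then mps_deriv j f else f.

(* The powers of the variables give the partial derivatives the leading forms
   [x_j ^ d] without changing [f] modulo terms of degree [d.+1]. *)
Definition approx d : A :=
  mps_trunc d.+1 f + \sum_(j < n) (d.+1)%:R^-1 *: 'X_[U_(j) *+ d.+1].

Lemma tjurina_idealE u : tjurina_ideal f u <-> ideal_gen tjurina_series u.
Proof.
have unit_sum (F : unit -> S) : \sum_i F i = F tt by rewrite (bigD1 tt) //= big1 ?addr0 // => -[].
split=> [[_ [a ->] [_ [b ->] <-]]|[a ->]].
  exists (fun o => if o is Some j then b j else a tt).
  rewrite (bigD1 None) //= unit_sum; congr (_ + _).
  rewrite (reindex_omap Some id) /=; last by case.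
  by apply: eq_bigl => j; rewrite eqxx.
exists (a None * f); first by exists (fun=> a None); rewrite unit_sum.
exists (\sum_j a (Some j) * mps_deriv j f); first by exists (fun j => a (Some j)).
rewrite [RHS](bigD1 None) //=; congr (_ + _).
rewrite [RHS](reindex_omap Some id) /=; last by case.
by apply: eq_bigl => j; rewrite eqxx.
Qed.

Lemma approx_agree d : agree d.+1 f (approx d).
Proof.
move=> a ad; rewrite /approx mcoeffD mcoeff_trunc // raddf_sum big1 ?addr0 //= => j _.
rewrite mcoeffZ mcoeffX; case: (_ =P a) => [ja|]; last by rewrite mulr0.
by move: ad; rewrite -ja mdegMn mdeg1 mul1n ltnn.
Qed.

Lemma gradient_approx_agree d j : agree d (mps_deriv j f) (gradient (approx d) j).
Proof.
move=> a ad; rewrite /gradient mcoeff_deriv /= (@approx_agree d) //.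
by rewrite mdegD mdeg1 addn1 ltnS.
Qed.

Lemma tjurina_approx_agree d o : agree d (tjurina_series o) (tjurina_gens (approx d) o).
Proof.
case: o => [j|]; first exact: gradient_approx_agree.
exact: agree_le (@approx_agree d).
Qed.

Lemma approx0 d : (approx d)@_0 = 0.
Proof. by rewrite -approx_agree ?f0 ?mdeg0. Qed.

Lemma gradient_approx_top d j : top_term (U_(j) *+ d)%MM 1 (gradient (approx d) j).
Proof.
rewrite /top_term /gradient /approx mderivD scale1r.
have -> : (\sum_k (d.+1)%:R^-1 *: 'X_[U_(k) *+ d.+1] : A)^`M(j) = 'X_[U_(j) *+ d].
  rewrite raddf_sum (bigD1 j) //= big1 ?addr0 => [|k kj]; rewrite mderivZ mderivX mulmnE mnm1E.
    rewrite eqxx mul1n scalerA mulVf ?scale1r; last exact: natK_neq0.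
    congr 'X_[_]; apply/mnmP => i; rewrite mnmBE !mulmnE mnm1E.
    by case: eqP => _; rewrite ?mul1n ?mul0n ?subn1.
  by rewrite (negPf kj) mul0n scale0r scaler0.
rewrite addrK mdegMn mdeg1 mul1n; apply: msize_mderiv.
apply: leq_trans (msize_sum _ _ _) _; apply/bigmax_leqP => a _.
by apply: leq_trans (msizeZ_le _ _) _; rewrite msizeX; apply: bmdeg.
Qed.

Lemma one_notin_tjurina : ~ tjurina_ideal f 1.
Proof.
move/tjurina_idealE => [a a1].
have : ord 1 (1 : S).
  rewrite a1; have iT := @ordP K n 1; apply: ideal_sum => // o _.
  have [_ _ oM] := iT; apply: oM; case: o => [j|] b b1 /=; last by rewrite f0 // ltnW.
  by rewrite f0 ?mul0rn // mdegD mdeg1 addn1.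
by move=> /(_ 0%MM); rewrite /= eqxx mdeg0 => /(_ isT) /eqP; rewrite oner_eq0.
Qed.

(* Otherwise there are tau + 1 monomials, of degrees 0, ..., tau, that are free
   modulo the Tjurina ideal. *)
Lemma tjurina_degree tau (e : 'I_tau -> S) : quot_basis (tjurina_ideal f) e ->
  exists D, forall a, mdeg a = D ->
    exists2 u, ideal_gen tjurina_series u & agree D.+1 u 'X_[a].
Proof.
move=> [espan _]; apply: contrapT => /forallNP noD.
have iT := ideal_genP tjurina_series; have sT := ideal_subspace iT.
have H D : exists a, mdeg a = D /\
    forall u, ideal_gen tjurina_series u -> ~ agree D.+1 u 'X_[a].
  have /existsNP[a /not_implyP[aD na]] := noD D; exists a; split=> // u gu ua.
  by apply: na; exists u.
have [al alP] := exists_fun H.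
have : (#|'I_tau.+1| <= #|'I_tau|)%N; last by rewrite !card_ord ltnn.
apply: (@free_le_spans K S (ideal_gen tjurina_series) _ _ e
   (fun i : 'I_tau.+1 => series_of 'X_[al i])) => //.
  move=> v _; have [c /tjurina_idealE ce] := espan v; by exists c.
(* By induction the coefficients of smaller index vanish. If [c i] did not, dividing by it would
   leave [X^(al i)] modulo higher degree, contrary to the choice of [al i]. *)
move=> c cT i; apply/eqP; have [k] := ubnP (i : nat); elim: k i => // k IH i ik.
apply: contrapT => /negP ci; have [ai /(_ ((c i)^-1 *: \sum_j c j *: series_of 'X_[al j]))] := alP i.
case; first by have [_ sZ] := sT; rewrite -[X in ideal_gen _ X]addr0; apply: sZ => //; case: sT.
rewrite (bigD1 i) //= scalerDr scalerA mulVf // scale1r -[X in agree _ _ X]addr0.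
apply: agreeD; first exact: agree_series_of.
apply/ord_agree; rewrite scaler_sumr; apply: ideal_sum => [|j ji]; first exact: ordP.
rewrite scalerA => b bi /=; rewrite mcoeffX.
case: (al j =P b) => [jb|]; last by rewrite mulr0.
have {}jb : (j < i)%N.
  move: bi; rewrite -jb (alP j).1 ltnS leq_eqVlt => /orP[|//].
  by move=> /eqP/val_inj ij; rewrite ij eqxx in ji.
have /eqP -> := IH j (leq_trans jb ik); by rewrite mulr0 mul0r.
Qed.

End Approximation.

Section MilnorTjurina.
Context (K : fieldType) (n : nat).
Hypothesis n0 : (0 < n)%N.
Hypothesis K0 : [pchar K] =i pred0.
Local Notation A := {mpoly K[n]}.
Local Notation S := {mpseries K[n]}.
Context (f : S) (f0 : ord 2 f).

Lemma truncated_basis_span (I : finType) (G : I -> S) (g : I -> A) tau (e : 'I_tau -> S) L :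
  (forall i, agree L (G i) (g i)) -> spans_mod (fun=> True) (ideal_gen G) e ->
  forall a, exists c : 'I_tau -> K, loc g L ('X_[a] - \sum_j c j *: mps_trunc L (e j)).
Proof.
move=> Gg espan a; have [c ce] := espan (series_of 'X_[a]) Logic.I.
exists c; apply: (ideal_gen_agree Gg ce); apply: agreeB; first exact: agree_series_of.
by apply: agree_sum => i; apply/agreeZ/agree_trunc.
Qed.

Lemma exists_good_approx tau (e : 'I_tau -> S) : quot_basis (tjurina_ideal f) e ->
  exists D m d, [/\ (D < d)%N, (D * m.+1 < d)%N,
    forall a, mdeg a = D -> loc (tjurina_gens (approx f d)) D.+1 'X_[a] &
    forall L u, gpow (tjurina_gens (approx f d)) m.+1 u ->
      exists2 v, grad_tjurina (approx f d) m v & in_m L (u - v)].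
Proof.
move=> /tjurina_degree[D HD].
have agr d o : (D < d)%N -> agree D.+1 (tjurina_series f o) (tjurina_gens (approx f d) o).
  by move=> Dd; apply: (agree_le Dd); apply: tjurina_approx_agree.
have hD d : (D < d)%N -> forall a, mdeg a = D -> loc (tjurina_gens (approx f d)) D.+1 'X_[a].
  by move=> Dd a /HD[u gu ua]; apply: (ideal_gen_agree _ gu ua) => o; apply: agr.
have [m red] := gpow_tjurina_reduction K0 (ltn0Sn D) (gradient_approx_top K0 f D.+1) (approx0 f0 _).
have Dd : (D < D.+1 + D * m.+1)%N by rewrite addSn ltnS leq_addr.
(* The exponent [m] was obtained at order [D.+1], so the final order can be chosen beyond both [D]
   and [D * m.+1]. *)
exists D, m, (D.+1 + D * m.+1)%N; split=> //; first by rewrite addSn ltnS leq_addl.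
  exact: hD.
apply: (gpow_tjurina_transfer (hD _ (ltnSn D)) (hD _ Dd) _ red) => o.
by apply: (agree_in_m (agr _ o _) (agr _ o _)).
Qed.

Section Basis.
Context (tau : nat) (e : 'I_tau -> S).
Hypothesis eP : quot_basis (tjurina_ideal f) e.

Lemma jacobian_ideal_ord : exists D, forall v, ord D v -> jacobian_ideal f v.
Proof.
have [D [m [d [Dd D'd hD red]]]] := exists_good_approx eP.
exists (D * m.+1)%N; apply: ideal_gen_complete => a aD.
apply: (loc_agree (g := gradient (approx f d))) => [j|].
  by apply: (agree_le D'd); apply: gradient_approx_agree.
by apply: (monom_loc_gradient hD red); rewrite aD.
Qed.

(** Finiteness of [mu] from that of [tau]: a power of the maximal ideal lies in the Jacobian ideal,
    so the monomials in a box span the quotient. *)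
Lemma exists_jacobian_basis : exists mu (e' : 'I_mu -> S), quot_basis (jacobian_ideal f) e'.
Proof.
have [D jD] := jacobian_ideal_ord.
have sJ := ideal_subspace (ideal_genP (fun i => mps_deriv i f)).
have span : spans_mod (fun=> True) (jacobian_ideal f)
    (fun b : {ffun 'I_n -> 'I_D} => series_of 'X_[exps b]).
  move=> v _; exists (fun b => pscoeff v (exps b)); apply: jD => a aD.
  have [i|b ba] := @exps_onto n D a.
    by apply: leq_ltn_trans aD; rewrite mdegE (bigD1 i) //= leq_addr.
  have -> : pscoeff (v - \sum_(b : {ffun 'I_n -> 'I_D}) pscoeff v (exps b) *: series_of 'X_[exps b]) a
     = pscoeff v a - \sum_(b : {ffun 'I_n -> 'I_D}) pscoeff v (exps b) * ('X_[exps b] : A)@_a.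
    by rewrite /= (big_morph (fun u : S => pscoeff u a) (id1 := 0) (op1 := +%R)).
  rewrite (bigD1 b) //= mcoeffX ba eqxx mulr1 big1 ?addr0 ?subrr // => b' b'b.
  rewrite mcoeffX; case: (exps b' =P a) => [|_]; last by rewrite mulr0.
  by rewrite -ba => /exps_inj bb; rewrite bb eqxx in b'b.
have [|r [z [_ zf zs]]] := @exists_basis_mod K S (fun=> True) (jacobian_ideal f)
    #|{: {ffun 'I_n -> 'I_D}}| sJ.
  by move=> r z _ zf; rewrite -[r]card_ord; apply: (free_le_spans sJ span zf).
by exists r, z; split=> // v; apply: zs.
Qed.

Lemma milnor_tjurina_le (R : realType) mu (e' : 'I_mu -> S) :
  quot_basis (jacobian_ideal f) e' -> mu%:R * slab_volume R n <= tau%:R.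
Proof.
move=> [e'span e'free].
have [D [m [d [Dd D'd hD red]]]] := exists_good_approx eP.
set F := approx f d in hD red; set D' := (D * m.+1)%N in D'd.
have yag j : agree D'.+1 (mps_deriv j f) (gradient F j).
  by apply: (agree_le D'd); apply: gradient_approx_agree.
have tag o : agree D.+1 (tjurina_series f o) (tjurina_gens F o).
  by apply: (agree_le Dd); apply: tjurina_approx_agree.
have hD' L a : (D' <= mdeg a)%N -> loc (gradient F) L 'X_[a] by apply: monom_loc_gradient.
have jD v : ord D' v -> jacobian_ideal f v.
  apply: ideal_gen_complete => a aD; apply: (loc_agree yag); apply: hD'; by rewrite aD.
have [J0 JD JM] := ideal_genP (fun i => mps_deriv i f).
pose eh j := mps_trunc D'.+1 (e' j).
have span L : spans_mod (fun=> True) (loc (gradient F) L) eh.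
  apply: (@spans_loc _ _ _ _ _ _ D') => [a aD|a _]; first by apply: hD'; rewrite aD.
  by apply: (truncated_basis_span yag) => v _; apply: e'span.
(* Truncation preserves freeness because the discarded tails have order beyond [D'] and lie in the
   Jacobian ideal. *)
have free : free_mod (loc (gradient F) D'.+1) eh.
  move=> c /(loc_agree yag)[u gu ua]; apply: e'free.
  rewrite -[\sum_i _](subrK u); apply: JD => //; apply: jD.
  apply: (@ord_le _ _ D'.+1) => //.
  by apply: (agree_ord _ ua); apply: agree_sum => i; apply/agreeZ/agree_trunc.
have [|N0 fspan] := @spans_loc_prime_power K n K0 _ _ (tjurina_gens F)
    (fun j => mps_trunc D.+1 (e j)) D hD.
  move=> a _; apply: (truncated_basis_span tag) => v _.
  by have [c /tjurina_idealE ce] := eP.1 v; exists c.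
apply: (@slab_volume_limit R n mu tau m (maxn N0 m)) => [//|p pp].
rewrite gtn_max => /andP[N0p mp]; lazy zeta; rewrite -addnBA; last exact: ltnW.
rewrite -[X in (_ <= X * _)%N]card_ord.
have d_gt0 : (0 < d)%N by apply: leq_ltn_trans Dd.
apply: (slab_count_le d_gt0 (gradient_approx_top K0 f d) span free
  (F := F) (f := fun j => mps_trunc D.+1 (e j)) (p := p) (k := (p - m)%N)).
- by move=> L; apply: exp_gpow_gradient => //; exact: ltnW.
- by move=> L v _; have [c [u gu um]] := fspan p pp N0p L v Logic.I; exists c, u.
- exact: leq_subr.
Qed.

End Basis.

End MilnorTjurina.

Section QuotientDimension.
Context (R : realType) (K : fieldType) (V : lmodType K) (W : set V).

Lemma quot_dim_fin : (quot_dim R W < +oo)%E -> exists d (e : 'I_d -> V), quot_basis W e.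
Proof.
move=> fin; apply: contrapT => no; move: fin.
by rewrite /quot_dim xgetPN ?ltxx // => x [d [e eP] _]; apply: no; exists d, e.
Qed.

(** [xget] returns an arbitrary member of its set, so the basis is chosen anew to match the returned
    value. *)
Lemma quot_dim_basis : (exists d (e : 'I_d -> V), quot_basis W e) ->
  exists d (e : 'I_d -> V), quot_basis W e /\ quot_dim R W = d%:R%:E.
Proof.
move=> [d [e eP]]; rewrite /quot_dim; set P := (X in xget _ X).
have /(xgetPex +oo%E) : exists x, P x by exists d%:R%:E, d => //; exists e.
by case=> d' [e' e'P] <-; exists d', e'.
Qed.

End QuotientDimension.

Theorem corollary1p5 (R : realType) (n : nat) (hn : (1 <= n)%N)
    (K : fieldType) (hK : [pchar K] =i pred0)
    (f : {mpseries K[n]}) (hf : isolated_singularity R f) :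
  (milnor_number R f / tjurina_number R f <=
    (1 / (cube_corner_volume n ((n%:R + 1) / 2%:R)
          - cube_corner_volume n ((n%:R - 1) / 2%:R)))%R%:E)%E.
Proof.
have [[k [a [b [am bm fE]]]] fin] := hf.
have m_ord (u : {mpseries K[n]}) : max_ideal u -> ord 1 u.
  have [_ _ oM] := @ordP K n 1.
  move=> [c ->]; apply: ideal_sum => [|i _]; first exact: ordP.
  by apply: oM => t; rewrite ltnS leqn0 mdeg_eq0 => /eqP ->; rewrite /= eq_sym mnm1_eq0.
have f0 : ord 2 f.
  rewrite fE; apply: ideal_sum => [|i _]; first exact: ordP.
  exact: (@ordM _ _ 1 1 _ _ (m_ord _ (am i)) (m_ord _ (bm i))).
have [tau [e [eP tauE]]] := quot_dim_basis R (quot_dim_fin fin).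
have [mu [e' [e'P muE]]] := quot_dim_basis R (exists_jacobian_basis hK f0 eP).
(* This makes the quotient of extended reals a quotient of numbers; [tau = 0] would put 1 into the
   Tjurina ideal. *)
have tau0 : tau != 0%N.
  apply: contra_notN (one_notin_tjurina f0) => /eqP tau0; subst tau.
  by have [c] := eP.1 1; rewrite big_ord0 subr0.
have h0 := slab_volume_gt0 R hn.
rewrite /milnor_number muE /tjurina_number tauE inver pnatr_eq0 (negPf tau0) -EFinM lee_fin -/(slab_volume R n).
rewrite div1r ler_pdivrMr ?ltr0n ?lt0n // mulrC ler_pdivlMr //.
exact: (milnor_tjurina_le hn hK f0 eP R e'P).
Qed.
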